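(* Let $\beta>-1$ be real and let $n\ge1$ be an integer. Let $\vartheta\in\mathfrak{S}(\mathbb{D})$ and let $u\in\mathcal{H}(\mathbb{D})$ be non-zero (not identically zero), such that the operator $W^n_{u,\vartheta}$ is bounded on $\mathcal{A}^2_\beta$. Then $W^n_{u,\vartheta}$ is self-adjoint if and only if there exist $c_0,c_2\in\mathbb{R}$ with $c_0\neq0$ and $c_1\in\mathbb{C}$ such that, for all $z\in\mathbb{D}$, $$u(z)=\frac{c_0z^n}{(1-\overline{c_1}z)^{\beta+n+2}}\qquad\text{and}\qquad \vartheta(z)=c_1+\frac{c_2z}{1-\overline{c_1}z}.$$
   Context: $\mathbb{D}=\{z\in\mathbb{C}:|z|<1\}$; $\mathcal{H}(\mathbb{D})$ is the set of analytic functions on $\mathbb{D}$; $\mathfrak{S}(\mathbb{D})$ is the set of holomorphic self-maps of $\mathbb{D}$. For $\beta>-1$, the weighted Bergman space $\mathcal{A}^2_\beta$ is the Hilbert space of all $f\in\mathcal{H}(\mathbb{D})$ with $\|f\|^2=\int_{\mathbb{D}}|f(z)|^2\,d\mathcal{A}_\beta(z)<\infty$, with inner product $\langle f,g\rangle=\int_{\mathbb{D}}f\overline{g}\,d\mathcal{A}_\beta$, where $d\mathcal{A}_\beta(z)=(\beta+1)(1-|z|^2)^\beta\,d\mathcal{A}(z)$ and $d\mathcal{A}$ is area measure normalized so that $\mathcal{A}(\mathbb{D})=1$; its reproducing kernel is $K_\xi(z)=(1-\overline{\xi}z)^{-(\beta+2)}$. Non-integer powers are principal branches. The weighted composition-differentiation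 operator of order $n$ is $W^n_{u,\vartheta}f=u\cdot(f^{(n)}\circ\vartheta)$, where $f^{(n)}$ is the $n$-th derivative of $f$. A bounded operator $L$ is self-adjoint if $L=L^*$. *)

(* Defs.v *)
From mathcomp Require Import all_boot all_order all_algebra complex.
From mathcomp Require Import all_classical all_reals all_analysis.

Set Implicit Arguments.
Unset Strict Implicit.
Unset Printing Implicit Defensive.

Import Order.TTheory GRing.Theory Num.Theory.
Import numFieldNormedType.Exports.

Local Open Scope classical_set_scope.
Local Open Scope ring_scope.

Section PrincipalPower.
Context {R : realType}.
Implicit Types (z : R[i]) (a : R).

Definition cabs z : R := ComplexField.Normc.normc z.

(* The argument in ]-pi, pi] (the values at [z = 0] are irrelevant). *)
Definition carg z : R :=
  let t := acos (complex.Re z / cabs z) in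
  if 0 <= complex.Im z then t else - t.

Definition cLog z : R[i] := (ln (cabs z) +i* carg z)%C.

Definition cexp z : R[i] :=
  ((expR (complex.Re z) * cos (complex.Im z))
   +i* (expR (complex.Re z) * sin (complex.Im z)))%C.

Definition cpow z a : R[i] := cexp (a%:C%C * cLog z).

End PrincipalPower.

Section Disk.
Context {R : realType}.

Definition unit_disk : set R[i] := [set z | `|z| < 1].

(* Complex differentiability: [R[i]] is regarded as a normed space over itself,
   so the limit of the difference quotient is taken over complex increments.
   Functions on the disk are represented by total functions on [R[i]], of which
   only the values on the disk matter. *)
Definition holomorphic_on_disk (f : R[i] -> R[i]) : Prop :=
  forall z, unit_disk z -> derivable (f : R[i]^o -> R[i]^o) z 1.

Definition holomorphic_self_map (f : R[i] -> R[i]) : Prop :=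
  holomorphic_on_disk f /\ (forall z, unit_disk z -> unit_disk (f z)).

End Disk.

Section WeightedBergman.
Context {R : realType}.
Variable beta : R.
Implicit Types (f g : R[i] -> R[i]) (L M : (R[i] -> R[i]) -> (R[i] -> R[i])).

(* [measurableTypeR R] is [R] with the measurable structure that carries
   [lebesgue_measure]; it differs from the default one only by its display. *)
Definition plane := (measurableTypeR R * measurableTypeR R)%type.

Definition to_complex (p : plane) : R[i] := (p.1 +i* p.2)%C.

Definition disk2 : set plane := to_complex @^-1` unit_disk.

(* Density of [dA_beta] with respect to planar Lebesgue measure; the factor
   [pi^-1] gives the unit disk normalized area 1. *)
Definition bergman_weight (p : plane) : R :=
  (beta + 1) * (1 - cabs (to_complex p) ^+ 2) `^ beta / pi.

Definition bergman_normsq f : \bar R :=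
  (\int[@lebesgue_measure R \x @lebesgue_measure R]_(p in disk2)
     (cabs (f (to_complex p)) ^+ 2 * bergman_weight p)%:E)%E.

Definition bergman f : Prop :=
  holomorphic_on_disk f /\ (bergman_normsq f < +oo)%E.

Definition bergman_norm f : R := Num.sqrt (fine (bergman_normsq f)).

Definition bergman_inner f g : R[i] :=
  let mu := (@lebesgue_measure R \x @lebesgue_measure R)%E in
  let h p := f (to_complex p) * (g (to_complex p))^*%C in
  ((\int[mu]_(p in disk2) (complex.Re (h p) * bergman_weight p))
   +i* (\int[mu]_(p in disk2) (complex.Im (h p) * bergman_weight p)))%C.

(* Linearity and compatibility with equality on the disk are not included:
   they are automatic for [wcomp_diff] on [bergman]. *)
Definition bergman_bounded L : Prop :=
  (forall f, bergman f -> bergman (L f)) /\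
  exists C : R, forall f, bergman f -> bergman_norm (L f) <= C * bergman_norm f.

Definition bergman_adjoint L M : Prop :=
  bergman_bounded M /\
  forall f g, bergman f -> bergman g ->
    bergman_inner (L f) g = bergman_inner f (M g).

(* [L = L^*]: the adjoint of [L] is [L] itself. *)
Definition bergman_self_adjoint L : Prop := bergman_adjoint L L.

End WeightedBergman.

Definition wcomp_diff {R : realType} (n : nat) (u theta f : R[i] -> R[i]) :
  R[i] -> R[i] := fun z => u z * derive1n n (f : R[i]^o -> R[i]^o) (theta z).

(* Main.v *)
Require Import Defs.
From mathcomp Require Import all_boot all_order all_algebra complex.
From mathcomp Require Import all_classical all_reals all_analysis.
From mathcomp Require Import measurable_realfun ring lra.
Set Implicit Arguments.
Unset Strict Implicit.
Unset Printing Implicit Defensive.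
Import Order.TTheory GRing.Theory Num.Theory.
Import numFieldNormedType.Exports.
Local Open Scope classical_set_scope.
Local Open Scope ring_scope.

(** For every weight of this family the monomials [z ^+ k] form an orthogonal
    basis of the Bergman space, and self-adjointness of a bounded operator can be
    read off its matrix in this basis.

    The operator [W] sends [z ^ (n + a)] to a multiple of [u * theta ^ a] and
    kills the monomials of degree less than [n]. If [W] is self-adjoint, [u]
    therefore vanishes to order [n] at [0] ([symbol_factor]): [u = z ^ n * v].
    Let [T a b] be the coefficient of [z ^ b] in [v * theta ^ a]. The squared
    norms [omega k] of the monomials satisfy a first-order recursion, by which
    [omega n / omega (n + m)] is, up to a ratio of factorials, the coefficient
    [bcoef p m] of [x ^ m] in [(1 - x) ^ (- p)], where [p = beta + n + 2]
    ([omega_bcoef]). Hence on the monomials symmetry of [W] amounts to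
      [bcoef p a * T a b = bcoef p b * (T b a)^*]
    for all [a] and [b] ([sym_entry]).

    Rows [a = 0] and [a = 1] of this identity give the coefficients of [v] and of
    [v * theta] in terms of [v 0], [theta 0] and the derivative of [theta] at
    [0], and summing the binomial series produces the two formulas
    ([form_of_sym]). Conversely, for [u] and [theta] of this form the
    coefficients of [v * theta ^ a] are explicit and satisfy the identity
    ([sym_of_form]); the symmetry extends from monomials to the whole space
    because [W] is bounded and Taylor polynomials converge in norm
    ([sym_of_monom], [nsq_rem_cvg]).

    Four facts of analysis support this. Functions that are complex
    differentiable at every point of the disk have Taylor series ([taylor]):
    Goursat's theorem in the coordinate [log z] shows how Fourier coefficients on
    circles depend on the radius, and Chernoff's argument with a divided
    difference gives pointwise convergence. The inner product of [f] and
    [z ^+ k] is the [k]-th Taylor coefficient times [omega k] ([inner_monom]):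
    rotation invariance of planar Lebesgue measure, obtained from shears, makes
    monomials orthogonal on smaller disks. The moments [omega k] follow from the
    image of the area measure under the squared modulus ([push_sqnorm]) and an
    integration by parts ([bmomrS]). Finally, binomial series are principal
    powers ([binser_cpow]): both are exponentials of multiples of the series of
    [log (1 - x)], which is the principal logarithm. *)

Local Open Scope complex_scope.
Local Notation Re := complex.Re.
Local Notation Im := complex.Im.

(** * Complex derivatives with real moduli *)

#[global] Arguments cabs : simpl never.
#[global] Arguments cexp : simpl never.

Section DifferenceQuotient.
Variable K : numFieldType.
Implicit Types (f g : K^o -> K^o) (z d : K).

Lemma cvg_quotientP f z d :
  (h^-1 *: (f (h + z) - f z) @[h --> (0 : K^o)^'] --> (d : K^o)) <->
  forall e : K, 0 < e -> exists2 dl : K, 0 < dl &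
    forall h : K, `|h| < dl -> `|f (h + z) - f z - d * h| <= e * `|h|.
Proof.
split=> [/cvgrPdist_le H e e0|H].
  have /nbhs_ballP[dl /= dl0 Hb] := H e e0.
  exists dl => // h hdl; have [->|h0] := eqVneq h 0.
    by rewrite add0r subrr sub0r mulr0 oppr0 normr0 mulr0.
  have /= := Hb h; rewrite /ball/= sub0r normrN => /(_ hdl h0) H1.
  have -> : f (h + z) - f z - d * h = - h * (d - h^-1 * (f (h + z) - f z)).
    by field.
  by rewrite normrM normrN mulrC ler_pM2r ?normr_gt0.
apply/cvgrPdist_le => e e0; have [dl dl0 Hd] := H e e0.
apply/nbhs_ballP; exists dl => //= h; rewrite /ball/= sub0r normrN => hdl h0.
have -> : d - h^-1 *: (f (h + z) - f z) = - h^-1 * (f (h + z) - f z - d * h).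
  by rewrite /GRing.scale/=; field.
rewrite normrM normrN normfV ler_pdivrMl ?normr_gt0// [leRHS]mulrC.
exact: Hd.
Qed.

Lemma is_derive_quotientP f z d : is_derive (z : K^o) (1 : K^o) f d <->
  (h^-1 *: (f (h + z) - f z) @[h --> (0 : K^o)^'] --> (d : K^o)).
Proof.
have E : (fun h : K^o => h^-1 *: ((f \o shift (z : K^o)) (h *: (1 : K^o)) - f z))
   = (fun h : K^o => h^-1 *: (f (h + z) - f z)).
  by apply/funext => h /=; rewrite /GRing.scale/= mulr1.
split=> [[]|H].
  by rewrite /derivable /derive E => ? <-.
split; first by rewrite /derivable E; apply/cvg_ex; exists d.
by rewrite /derive E; apply: cvg_lim.
Qed.

Lemma is_derive_mul f g z df dg :
  is_derive (z : K^o) (1 : K^o) f df -> is_derive (z : K^o) (1 : K^o) g dg ->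
  is_derive (z : K^o) (1 : K^o) (fun x => (f x : K) * g x) (f z * dg + g z * df).
Proof. by move=> h1 h2; apply: is_deriveM. Qed.

Lemma is_derive_add f g z df dg :
  is_derive (z : K^o) (1 : K^o) f df -> is_derive (z : K^o) (1 : K^o) g dg ->
  is_derive (z : K^o) (1 : K^o) (fun x => (f x : K) + g x) (df + dg).
Proof. by move=> h1 h2; apply: is_deriveD. Qed.

Lemma derive1_is_derive f z d :
  is_derive (z : K^o) (1 : K^o) f d -> derive1 f z = d.
Proof. by move/is_derive_quotientP => H; apply: cvg_lim. Qed.

End DifferenceQuotient.

Section ComplexModulus.
Variable R : realType.
Local Notation C := (R[i]).
Implicit Types (z w : C) (x y : R).

Lemma normE z : `|z| = (cabs z)%:C. Proof. by []. Qed.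

Lemma cabs_ge0 z : 0 <= cabs z.
Proof. by rewrite -(lecR 0) -normE; exact: normr_ge0. Qed.

Lemma cabsM z w : cabs (z * w) = cabs z * cabs w.
Proof. exact: ComplexField.Normc.normcM. Qed.

Lemma cabsV z : cabs z^-1 = (cabs z)^-1.
Proof. exact: ComplexField.Normc.normcV. Qed.

Lemma cabs0 : cabs (0 : C) = 0.
Proof. by apply: complexI; rewrite -normE normr0. Qed.

Lemma cabs1 : cabs (1 : C) = 1.
Proof. by apply: complexI; rewrite -normE normr1. Qed.

Lemma cabsN z : cabs (- z) = cabs z.
Proof. by apply: complexI; rewrite -!normE normrN. Qed.

Lemma cabsB z w : cabs (z - w) = cabs (w - z).
Proof. by rewrite -cabsN opprB. Qed.

Lemma cabsX z n : cabs (z ^+ n) = cabs z ^+ n.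
Proof. by elim: n => [|n IH]; rewrite ?expr0 ?cabs1// !exprS cabsM IH. Qed.

Lemma cabs_eq0 z : (cabs z == 0) = (z == 0).
Proof. by rewrite -(inj_eq (@complexI R)) -normE normr_eq0. Qed.

Lemma cabs_gt0 z : (0 < cabs z) = (z != 0).
Proof. by rewrite lt0r cabs_eq0 cabs_ge0 andbT. Qed.

Lemma cabsR x : cabs x%:C = `|x|.
Proof. by rewrite /cabs/= expr0n addr0 sqrtr_sqr. Qed.

Lemma cabs_nat n : cabs (n%:R : C) = n%:R.
Proof. by apply: complexI; rewrite -normE normr_nat rmorph_nat. Qed.

Lemma cabs_conj z : cabs z^*%C = cabs z.
Proof. by apply: complexI; rewrite -!normE normcJ. Qed.

Lemma cabsD z w : cabs (z + w) <= cabs z + cabs w.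
Proof. by rewrite -lecR rmorphD/= -!normE ler_normD. Qed.

Lemma cabs_sum I (r : seq I) (P : pred I) (F : I -> C) :
  cabs (\sum_(i <- r | P i) F i) <= \sum_(i <- r | P i) cabs (F i).
Proof.
elim/big_ind2 : _ => //; first by rewrite cabs0.
by move=> a b c d h1 h2; apply: le_trans (cabsD _ _) _; apply: lerD.
Qed.

Lemma cabs_sqr z : cabs z ^+ 2 = Re z ^+ 2 + Im z ^+ 2.
Proof. by case: z => a b; rewrite sqr_sqrtr// addr_ge0 ?sqr_ge0. Qed.

Lemma cabs_Re z : `|Re z| <= cabs z.
Proof.
rewrite -ler_sqr ?nnegrE ?normr_ge0 ?cabs_ge0//.
by rewrite cabs_sqr real_normK ?num_real// lerDl sqr_ge0.
Qed.

Lemma cabs_Im z : `|Im z| <= cabs z.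
Proof.
rewrite -ler_sqr ?nnegrE ?normr_ge0 ?cabs_ge0//.
by rewrite cabs_sqr real_normK ?num_real// lerDr sqr_ge0.
Qed.

Lemma cabs_le z : cabs z <= `|Re z| + `|Im z|.
Proof.
rewrite {1}(complexE z); apply: le_trans (cabsD _ _) _.
by rewrite cabsM !cabsR /cabs/= expr0n expr1n add0r sqrtr1 mul1r.
Qed.

Lemma mulcJ z : z * z^*%C = (cabs z ^+ 2)%:C.
Proof. by rewrite -sqr_normc normE rmorphXn. Qed.

Lemma conjcM z w : (z * w)^*%C = z^*%C * w^*%C. Proof. exact: rmorphM. Qed.
Lemma conjcD z w : (z + w)^*%C = z^*%C + w^*%C. Proof. exact: rmorphD. Qed.
Lemma conjcX z n : (z ^+ n)^*%C = z^*%C ^+ n. Proof. exact: rmorphXn. Qed.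
Lemma conjcN z : (- z)^*%C = - z^*%C. Proof. exact: rmorphN. Qed.

Lemma ReM z w : Re (z * w) = Re z * Re w - Im z * Im w.
Proof. by case: z w => [a b] [c d]. Qed.
Lemma ImM z w : Im (z * w) = Re z * Im w + Im z * Re w.
Proof. by case: z w => [a b] [c d]. Qed.
Lemma ReD z w : Re (z + w) = Re z + Re w.
Proof. by case: z w => [a b] [c d]. Qed.
Lemma ImD z w : Im (z + w) = Im z + Im w.
Proof. by case: z w => [a b] [c d]. Qed.
Lemma ReN z : Re (- z) = - Re z. Proof. by case: z. Qed.
Lemma ImN z : Im (- z) = - Im z. Proof. by case: z. Qed.

Lemma unit_diskE z : unit_disk z <-> cabs z < 1.
Proof. by rewrite /unit_disk/= normE -(ltcR _ 1). Qed.

(** Increments are complex, but the moduli live in [R]: estimates then take place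
    in a totally ordered field. *)
Definition cdiff (f : C -> C) z d := forall e : R, 0 < e ->
  exists2 dl : R, 0 < dl &
    forall w, cabs (w - z) < dl ->
      cabs (f w - f z - d * (w - z)) <= e * cabs (w - z).

Lemma cdiffP f z d :
  cdiff f z d <-> is_derive (z : C^o) (1 : C^o) (f : C^o -> C^o) d.
Proof.
rewrite is_derive_quotientP cvg_quotientP; split=> H e e0.
  have eE : e = (Re e)%:C by rewrite RRe_real ?gtr0_real.
  have : 0 < Re e by rewrite -ltcR -eE.
  move=> /H[dl dl0 Hd]; exists dl%:C; first by rewrite (ltcR 0).
  move=> h; rewrite normE ltcR => hdl.
  rewrite eE !normE -rmorphM/= lecR.
  by have := Hd (h + z); rewrite addrK; apply.
have : 0 < e%:C by rewrite (ltcR 0).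
move=> /H[dl dl0 Hd]; have dlE : dl = (Re dl)%:C by rewrite RRe_real ?gtr0_real.
exists (Re dl); first by rewrite -ltcR -dlE.
move=> w wdl; have := Hd (w - z); rewrite subrK !normE dlE ltcR -rmorphM/= lecR.
by apply.
Qed.

Lemma derivable_cdiff f z :
  derivable (f : C^o -> C^o) z 1 <-> exists d, cdiff f z d.
Proof.
split=> [/derivableP H|[d /cdiffP[]//]].
by exists ('D_1 (f : C^o -> C^o) z); apply/cdiffP.
Qed.

Lemma cdiff_derive1 f z d : cdiff f z d -> derive1 (f : C^o -> C^o) z = d.
Proof. by move/cdiffP/derive1_is_derive. Qed.

Lemma cdiff_unique f z d d' : cdiff f z d -> cdiff f z d' -> d = d'.
Proof. by move=> /cdiff_derive1 <- /cdiff_derive1. Qed.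

Lemma cdiffM f g z df dg : cdiff f z df -> cdiff g z dg ->
  cdiff (fun w => f w * g w) z (f z * dg + g z * df).
Proof. by move=> /cdiffP hf /cdiffP hg; apply/cdiffP; apply: (@is_derive_mul C). Qed.

Lemma cdiffD f g z df dg : cdiff f z df -> cdiff g z dg ->
  cdiff (fun w => f w + g w) z (df + dg).
Proof. by move=> /cdiffP hf /cdiffP hg; apply/cdiffP; apply: (@is_derive_add C). Qed.

Lemma cdiff_cst c z : cdiff (fun=> c) z 0.
Proof.
move=> e e0; exists 1 => // w _.
by rewrite subrr mul0r subr0 cabs0 mulr_ge0 ?cabs_ge0// ltW.
Qed.

Lemma cdiff_id z : cdiff (fun w => w) z 1.
Proof.
move=> e e0; exists 1 => // w _.
by rewrite mul1r subrr cabs0 mulr_ge0 ?cabs_ge0// ltW.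
Qed.

Lemma cdiffZ c f z d : cdiff f z d -> cdiff (fun w => c * f w) z (c * d).
Proof. by move=> /(cdiffM (cdiff_cst c z)); rewrite mulr0 addr0. Qed.

Lemma cdiff_near f g z d dl : 0 < dl ->
  (forall w, cabs (w - z) < dl -> f w = g w) -> cdiff f z d -> cdiff g z d.
Proof.
move=> dl0 fg H e /H[dl' dl'0 Hd]; exists (Num.min dl dl'); first by rewrite lt_min dl0.
move=> w; rewrite lt_min => /andP[w1 w2]; rewrite -!fg ?Hd//.
by rewrite subrr cabs0.
Qed.

Lemma cdiffX n z : cdiff (fun w => w ^+ n) z (n%:R * z ^+ n.-1).
Proof.
elim: n => [|n IH]; first by rewrite mul0r; apply: cdiff_cst.
have := cdiffM (cdiff_id z) IH; congr cdiff.
  by apply/funext => w; rewrite exprS.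
by case: n {IH} => [|n]; rewrite ?mul0r ?mulr0 ?add0r ?expr0//= exprS; ring.
Qed.

Lemma cdiff_lip f z d : cdiff f z d -> exists2 dl : R, 0 < dl &
  forall w, cabs (w - z) < dl -> cabs (f w - f z) <= (cabs d + 1) * cabs (w - z).
Proof.
move=> /(_ 1 ltr01)[dl dl0 H]; exists dl => // w /H; rewrite mul1r => Hw.
rewrite -[f w - f z](subrK (d * (w - z))); apply: le_trans (cabsD _ _) _.
by rewrite mulrDl mul1r addrC cabsM lerD.
Qed.

Lemma cdiff_cont f z d : cdiff f z d -> forall e : R, 0 < e ->
  exists2 dl : R, 0 < dl &
  forall w, cabs (w - z) < dl -> cabs (f w - f z) < e.
Proof.
move=> /cdiff_lip[dl dl0 H] e e0.
have M0 : 0 < cabs d + 1 by rewrite ltr_wpDl ?cabs_ge0.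
exists (Num.min dl (e / (cabs d + 1))); first by rewrite lt_min dl0 divr_gt0.
move=> w; rewrite lt_min => /andP[/H Hw w2]; apply: le_lt_trans Hw _.
by rewrite mulrC -ltr_pdivlMr.
Qed.

Lemma cdiff_comp f g z df dg : cdiff g z dg -> cdiff f (g z) df ->
  cdiff (fun w => f (g w)) z (df * dg).
Proof.
move=> hg hf e e0; have [dl1 dl10 H1] := cdiff_lip hg.
have M0 : 0 < cabs dg + 1 by rewrite ltr_wpDl ?cabs_ge0.
have [dl2 dl20 H2] := hf (e / 2 / (cabs dg + 1)) ltac:(by rewrite !divr_gt0).
have [dl3 dl30 H3] := cdiff_cont hg dl20.
have N0 : 0 < cabs df + 1 by rewrite ltr_wpDl ?cabs_ge0.
have [dl4 dl40 H4] := hg (e / 2 / (cabs df + 1)) ltac:(by rewrite !divr_gt0).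
exists (Num.min (Num.min dl1 dl3) dl4); first by rewrite !lt_min dl10 dl30.
move=> w; rewrite !lt_min -andbA => /and3P[/H1 w1 /H3/H2 w3 /H4 w4].
have -> : f (g w) - f (g z) - df * dg * (w - z) =
  (f (g w) - f (g z) - df * (g w - g z)) + df * (g w - g z - dg * (w - z)) by ring.
apply: le_trans (cabsD _ _) _; rewrite (splitr e) mulrDl; apply: lerD.
  apply: le_trans w3 _; rewrite -mulrA ler_pM2l ?divr_gt0//.
  by rewrite mulrC ler_pdivrMr// mulrC.
rewrite cabsM; apply: le_trans (ler_wpM2l (cabs_ge0 _) w4) _.
rewrite mulrA ler_wpM2r ?cabs_ge0// mulrC mulrAC ler_pdivrMr// ler_pM2l ?divr_gt0//.
by rewrite lerDl.
Qed.

End ComplexModulus.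

(** * The complex exponential *)

Section ComplexExponential.
Variable R : realType.
Local Notation C := (R[i]).
Implicit Types (z w : C) (x y : R).

Lemma cexpD z w : cexp (z + w) = cexp z * cexp w.
Proof.
rewrite /cexp; case: z w => [a b] [c d] /=.
by apply/eqP; rewrite eq_complex/= expRD cosD sinD; apply/andP; split; apply/eqP; ring.
Qed.

Lemma cexp0 : cexp (0 : C) = 1.
Proof. by rewrite /cexp /= expR0 cos0 sin0 mulr0 mulr1. Qed.

Lemma cexpN z : cexp (- z) * cexp z = 1.
Proof. by rewrite -cexpD addNr cexp0. Qed.

Lemma cexp_neq0 z : cexp z != 0.
Proof.
by apply/eqP => E; have := cexpN z; rewrite E mulr0 => /eqP; rewrite eq_sym oner_eq0.
Qed.

Lemma cabs_cexp z : cabs (cexp z) = expR (Re z).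
Proof.
apply/eqP; rewrite -(@eqrXn2 _ 2) ?cabs_ge0 ?expR_ge0// cabs_sqr /cexp/=.
by rewrite !exprMn -mulrDr cos2Dsin2 mulr1.
Qed.

Lemma is_derive_eps (f : R -> R) x d : is_derive x 1 f d ->
  forall e : R, 0 < e -> exists2 dl : R, 0 < dl &
  forall h, `|h| < dl -> `|f (h + x) - f x - d * h| <= e * `|h|.
Proof. by move=> /is_derive_quotientP/cvg_quotientP. Qed.

(** The real derivatives of [exp], [cos] and [sin] at [0] suffice; the functional
    equation carries the result to every other point. *)
Lemma cdiff_cexp0 : cdiff (@cexp R) 0 1.
Proof.
move=> e e0; pose e' := Num.min 1 (e / 8).
have e'0 : 0 < e' by rewrite lt_min ltr01 divr_gt0.
have e'1 : e' <= 1 by rewrite ge_min lexx.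
have e'e : 8 * e' <= e by rewrite mulrC -ler_pdivlMr// ge_min lexx orbT.
clearbody e'.
have [d1 d10 H1] := is_derive_eps (is_derive_expR (0 : R)) e'0.
have [d2 d20 H2] := is_derive_eps (is_derive_cos (0 : R)) e'0.
have [d3 d30 H3] := is_derive_eps (is_derive_sin (0 : R)) e'0.
exists (Num.min e' (Num.min d1 (Num.min d2 d3))).
  by do !(rewrite lt_min; apply/andP; split).
move=> w; rewrite subr0 !lt_min => /and4P[we w1 w2 w3].
have := H1 (Re w) (le_lt_trans (cabs_Re _) w1).
have := H2 (Im w) (le_lt_trans (cabs_Im _) w2).
have := H3 (Im w) (le_lt_trans (cabs_Im _) w3).
rewrite !addr0 expR0 cos0 sin0 oppr0 mul0r !subr0 !mul1r addr0 cexp0.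
move=> Hs Hc He.
have xw := cabs_Re w; have yw := cabs_Im w; have w0 := cabs_ge0 w.
apply: (fun c => le_trans (cabs_le _) c).
move: Hs Hc He xw yw we w0; rewrite /cexp !ReD !ReN !ImD !ImN/= subr0.
set x := Re w; set y := Im w; set m := cabs w => Hs Hc He xw yw we w0.
have x1 : `|x| <= 1 by lra.
have Ex : `|expR x - 1| <= 2 * `|x|.
  have -> : expR x - 1 = (expR x - 1 - x) + x by ring.
  by have H := ler_wpM2r (normr_ge0 x) e'1; apply: le_trans (ler_normD _ _) _; lra.
have Ex3 : `|expR x| <= 3.
  have -> : expR x = (expR x - 1) + 1 by ring.
  by apply: le_trans (ler_normD _ _) _; rewrite normr1; lra.
have Hs' := le_trans Hs (ler_wpM2l (ltW e'0) yw).
have Hc' := le_trans Hc (ler_wpM2l (ltW e'0) yw).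
have He' := le_trans He (ler_wpM2l (ltW e'0) xw).
have cy : `|cos y| <= 1 by rewrite ler_norml cos_geN1 cos_le1.
have R1 : `|expR x * cos y - 1 - x| <= 3 * e' * m.
  have -> : expR x * cos y - 1 - x = (expR x - 1 - x) * cos y + (1 + x) * (cos y - 1).
    by ring.
  apply: le_trans (ler_normD _ _) _; rewrite !normrM.
  have A : `|1 + x| <= 2 by apply: le_trans (ler_normD _ _) _; rewrite normr1; lra.
  have A0 := normr_ge0 (1 + x); have B0 := normr_ge0 (cos y - 1).
  have C0 := normr_ge0 (expR x - 1 - x); have D0 := normr_ge0 (cos y).
  have T1 : `|expR x - 1 - x| * `|cos y| <= e' * m.
    by apply: le_trans (ler_pM _ _ He' cy) _ => //; rewrite mulr1.
  have T2 : `|1 + x| * `|cos y - 1| <= 2 * (e' * m).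
    exact: ler_pM.
  by lra.
have R2 : `|expR x * sin y - y| <= 5 * e' * m.
  have -> : expR x * sin y - y = expR x * (sin y - y) + (expR x - 1) * y by ring.
  apply: le_trans (ler_normD _ _) _; rewrite !normrM.
  have T1 : `|expR x| * `|sin y - y| <= 3 * (e' * m).
    exact: ler_pM.
  have T2 : `|expR x - 1| * `|y| <= 2 * (e' * m).
    apply: le_trans (ler_pM _ _ Ex yw) _ => //.
    by rewrite -mulrA ler_pM2l// ler_wpM2r//; apply/ltW/(le_lt_trans xw we).
  by lra.
apply: (le_trans (lerD R1 R2)).
by rewrite -mulrDl -mulrDl ler_wpM2r//; lra.
Qed.

Lemma cdiff_cexp z : cdiff (@cexp R) z (cexp z).
Proof.
have h1 : cdiff (fun w => w - z) z 1.
  by rewrite -[1]addr0; apply: cdiffD (cdiff_id z) (cdiff_cst (- z) z).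
have h0 : cdiff (@cexp R) (z - z) 1 by rewrite subrr; apply: cdiff_cexp0.
have := cdiffZ (cexp z) (cdiff_comp h1 h0); rewrite !mulr1.
by congr cdiff; apply/funext => w; rewrite -cexpD addrC subrK.
Qed.

End ComplexExponential.

(** * Integrals of complex functions of a real variable *)

Section ComplexIntegral.
Variable R : realType.
Local Notation C := (R[i]).
Implicit Types (z w : C) (a b t : R) (f g : R -> C).
Local Notation mu := (@lebesgue_measure R).

Definition ccont f t :=
  {for t, continuous (fun s => Re (f s))} /\ {for t, continuous (fun s => Im (f s))}.

Lemma ccontP f t : ccont f t <-> forall e : R, 0 < e -> exists2 dl : R, 0 < dl &
  forall s, `|s - t| < dl -> cabs (f s - f t) < e.
Proof.
split=> [[/cvgrPdist_lt H1 /cvgrPdist_lt H2] e e0|H].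
  have e2 : 0 < e / 2 by rewrite divr_gt0.
  have /nbhs_ballP[d1 /= d10 D1] := H1 _ e2.
  have /nbhs_ballP[d2 /= d20 D2] := H2 _ e2.
  exists (Num.min d1 d2); first by rewrite lt_min d10.
  move=> s; rewrite lt_min distrC => /andP[/D1/= s1 /D2/= s2].
  apply: le_lt_trans (cabs_le _) _; rewrite ReD ReN ImD ImN (splitr e) ltrD//.
    by rewrite distrC.
  by rewrite distrC.
split; apply/cvgrPdist_lt => e /H[dl dl0 D]; apply/nbhs_ballP; exists dl => //= s;
    rewrite /ball/= distrC => /D Ds; rewrite distrC.
  by apply: le_lt_trans Ds; rewrite -ReN -ReD; apply: cabs_Re.
by apply: le_lt_trans Ds; rewrite -ImN -ImD; apply: cabs_Im.
Qed.

Lemma ccont_cst z t : ccont (fun=> z) t.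
Proof. by split; apply: cst_continuous. Qed.

Lemma ccontD f g t : ccont f t -> ccont g t -> ccont (fun s => f s + g s) t.
Proof.
move=> [f1 f2] [g1 g2]; split.
  under [X in {for t, continuous X}]funext do rewrite ReD; exact: continuousD.
under [X in {for t, continuous X}]funext do rewrite ImD; exact: continuousD.
Qed.

Lemma ccontM f g t : ccont f t -> ccont g t -> ccont (fun s => f s * g s) t.
Proof.
move=> [f1 f2] [g1 g2]; split.
  under [X in {for t, continuous X}]funext do rewrite ReM.
  by apply: cvgB; apply: cvgM.
under [X in {for t, continuous X}]funext do rewrite ImM.
by apply: cvgD; apply: cvgM.
Qed.

Lemma ccontR (h : R -> R) t : {for t, continuous h} -> ccont (fun s => (h s)%:C) t.
Proof. by move=> ch; split => //=; apply: cst_continuous. Qed.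

Lemma ccont_id t : ccont (fun s => s%:C) t.
Proof. by apply: ccontR; apply: cvg_id. Qed.

Lemma ccont_comp (g : C -> C) f t :
  (forall e : R, 0 < e -> exists2 dl : R, 0 < dl &
    forall w, cabs (w - f t) < dl -> cabs (g w - g (f t)) < e) ->
  ccont f t -> ccont (fun s => g (f s)) t.
Proof.
move=> Hg /ccontP Hf; apply/ccontP => e /Hg[dl dl0 D].
have [d d0 D'] := Hf _ dl0; exists d => // s /D'; exact: D.
Qed.

Lemma ccont_cdiff (g : C -> C) f t d :
  cdiff g (f t) d -> ccont f t -> ccont (fun s => g (f s)) t.
Proof. by move=> /cdiff_cont Hg; apply: ccont_comp. Qed.

Definition ccont_on a b f := forall t, a <= t <= b -> ccont f t.

Definition cint a b f : C :=
  (\int[mu]_(t in `[a, b]) Re (f t)) +i* (\int[mu]_(t in `[a, b]) Im (f t)).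

Lemma ccont_on_int a b f : ccont_on a b f ->
  mu.-integrable `[a, b] (EFin \o (fun t => Re (f t))) /\
  mu.-integrable `[a, b] (EFin \o (fun t => Im (f t))).
Proof.
move=> H; split; apply: continuous_compact_integrable; try exact: segment_compact;
  apply: continuous_in_subspaceT => t; rewrite inE/= in_itv/= => /H[] //.
Qed.

Lemma eq_cint a b f g : (forall t, a <= t <= b -> f t = g t) -> cint a b f = cint a b g.
Proof.
move=> fg; rewrite /cint; congr Complex; apply: eq_Rintegral => t;
  by rewrite inE/= in_itv/= => /fg ->.
Qed.

Lemma cintD a b f g : ccont_on a b f -> ccont_on a b g ->
  cint a b (fun t => f t + g t) = cint a b f + cint a b g.
Proof.
move=> /ccont_on_int[f1 f2] /ccont_on_int[g1 g2].
apply/eqP; rewrite eq_complex/= /cint; apply/andP; split; apply/eqP.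
  by under eq_Rintegral do rewrite ReD; rewrite RintegralD.
by under eq_Rintegral do rewrite ImD; rewrite RintegralD.
Qed.

Lemma cintZ a b z f : ccont_on a b f ->
  cint a b (fun t => z * f t) = z * cint a b f.
Proof.
move=> /ccont_on_int[f1 f2].
have Z (r : R) (h : R -> R) : mu.-integrable `[a, b] (EFin \o h) ->
    mu.-integrable `[a, b] (EFin \o (fun t => r * h t)).
  by move=> ih; apply: eq_integrable (integrableZl _ r ih).
apply/eqP; rewrite eq_complex/= /cint; case: z => x y /=; apply/andP; split; apply/eqP.
  under eq_Rintegral do rewrite ReM/=.
  by rewrite RintegralB ?RintegralZl//; apply: Z.
under eq_Rintegral do rewrite ImM/=.
by rewrite RintegralD ?RintegralZl//; apply: Z.
Qed.

Lemma cint_cat a m b f : a <= m -> m <= b -> ccont_on a b f ->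
  cint a b f = cint a m f + cint m b f.
Proof.
move=> am mb /ccont_on_int[f1 f2].
have K (h : R -> R) : mu.-integrable `[a, b] (EFin \o h) ->
  \int[mu]_(t in `[a, b]) h t = \int[mu]_(t in `[a, m]) h t + \int[mu]_(t in `[m, b]) h t.
  move=> ih; apply/eqP; rewrite addrC -subr_eq; apply/eqP.
  rewrite Rintegral_itvB// ?bnd_simp//.
  apply: Rintegral_itv_obnd_cbnd; apply: integrableS ih => //.
  by apply: subset_itv; rewrite bnd_simp.
by apply/eqP; rewrite eq_complex/=; apply/andP; split; apply/eqP; apply: K.
Qed.

Lemma cint_cst a b z : a <= b -> cint a b (fun=> z) = (b - a)%:C * z.
Proof.
case: z => x y ab; rewrite /cint !Rintegral_cst//= lebesgue_measure_itv/=.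
have -> : fine (if (a%:E < b%:E)%E then (b%:E - a%:E)%E else 0%E) = b - a.
  rewrite lte_fin; case: ltP => //= ba.
  by apply/esym/eqP; rewrite subr_eq0 eq_le ba.
by apply/eqP; rewrite eq_complex/= !mul0r subr0 addr0 ![_ * (b - a)]mulrC !eqxx.
Qed.

Lemma cint_id a b : a <= b -> cint a b (fun t => t%:C) = ((b ^+ 2 - a ^+ 2) / 2)%:C.
Proof.
rewrite le_eqVlt => /predU1P[->|ab].
  rewrite /cint set_itv1 !Rintegral_set1 subrr mul0r//.
rewrite /cint/= Rintegral_cst// mul0r; congr Complex.
rewrite /Rintegral (@continuous_FTC2 _ _ (fun x => x ^+ 2 / 2))//.
- by rewrite -EFinB/= mulrBl.
- by apply: continuous_in_subspaceT => x _; apply: cvg_id.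
- have c : continuous (fun x : R => x ^+ 2 / 2).
    by move=> x; apply: cvgM; [apply: exprn_continuous|apply: cvg_cst].
  split=> [x _||]; last 2 first.
  + by apply: cvg_at_right_filter; apply: c.
  + by apply: cvg_at_left_filter; apply: c.
  by apply: ex_derive.
- move=> x _; rewrite derive1E.
  have : is_derive x (1 : R) (fun x : R => x ^+ 2 / 2) x.
    by apply: is_derive_eq; rewrite /GRing.scale/=; field.
  by move=> H; rewrite derive_val.
Qed.

(** The factor 2 comes from bounding real and imaginary parts separately. *)
Lemma cint_bound a b f (M : R) : a <= b -> ccont_on a b f ->
  (forall t, a <= t <= b -> cabs (f t) <= M) ->
  cabs (cint a b f) <= 2 * M * (b - a).
Proof.
move=> ab cf fM; have [i1 i2] := ccont_on_int cf.
have K (h : R -> R) : mu.-integrable `[a, b] (EFin \o h) ->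
  (forall t, a <= t <= b -> `|h t| <= M) -> `|\int[mu]_(t in `[a, b]) h t| <= M * (b - a).
  move=> ih hM; apply: le_trans (le_normr_Rintegral _ ih) _ => //.
  apply: (@le_trans _ _ (\int[mu]_(t in `[a, b]) M)).
    apply: le_Rintegral => //.
    - exact: integrable_norm ih.
    - by apply: continuous_compact_integrable; [exact: segment_compact|
        apply: continuous_subspaceT => ?; exact: cst_continuous].
  rewrite Rintegral_cst//= lebesgue_measure_itv/= lte_fin.
  case: ltP => //= ba.
  by rewrite (_ : b - a = 0)//; apply/eqP; rewrite subr_eq0 eq_le ba.
apply: le_trans (cabs_le _) _; rewrite /cint/=.
have H1 := K _ i1 (fun t tab => le_trans (cabs_Re (f t)) (fM t tab)).
have H2 := K _ i2 (fun t tab => le_trans (cabs_Im (f t)) (fM t tab)).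
apply: le_trans (lerD H1 H2) _.
by rewrite -mulrA mulr_natl mulr2n.
Qed.

End ComplexIntegral.

#[global] Arguments cint : simpl never.

(** * Cauchy-Goursat theorem on rectangles *)

Section Goursat.
Variable R : realType.
Local Notation C := (R[i]).
Implicit Types (z w : C) (a b c d t x y : R) (g : C -> C).

Definition horiz y t : C := t%:C + 'i%C * y%:C.
Definition vert x t : C := x%:C + 'i%C * t%:C.

Definition rect_int g a b c d : C :=
  cint a b (fun t => g (horiz c t)) + 'i%C * cint c d (fun t => g (vert b t))
  - cint a b (fun t => g (horiz d t)) - 'i%C * cint c d (fun t => g (vert a t)).

Definition rect a b c d z := a <= Re z <= b /\ c <= Im z <= d.

Lemma ccont_horiz y t : ccont (horiz y) t.
Proof. by apply: ccontD; [exact: ccont_id|exact: ccont_cst]. Qed.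

Lemma ccont_vert x t : ccont (vert x) t.
Proof.
by apply: ccontD; [exact: ccont_cst|apply: ccontM; [exact: ccont_cst|exact: ccont_id]].
Qed.

Lemma Re_horiz y t : Re (horiz y t) = t.
Proof. by rewrite /= !mul0r mul1r subrr addr0. Qed.
Lemma Im_horiz y t : Im (horiz y t) = y.
Proof. by rewrite /= !mul0r mul1r !add0r. Qed.
Lemma Re_vert x t : Re (vert x t) = x.
Proof. by rewrite /= !mul0r mul1r subrr addr0. Qed.
Lemma Im_vert x t : Im (vert x t) = t.
Proof. by rewrite /= !mul0r mul1r !add0r. Qed.

Section Sides.
Variables (g : C -> C).

Lemma sides_ccont a b c d : a <= b -> c <= d ->
  (forall z, rect a b c d z -> exists d' : C, cdiff g z d') ->
  [/\ ccont_on a b (fun t => g (horiz c t)), ccont_on a b (fun t => g (horiz d t)),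
      ccont_on c d (fun t => g (vert a t)) & ccont_on c d (fun t => g (vert b t))].
Proof.
move=> ab cd H.
have Hh y t : c <= y <= d -> a <= t <= b -> ccont (fun t => g (horiz y t)) t.
  move=> cy at_; have [] := H (horiz y t); first by rewrite /rect Re_horiz Im_horiz.
  by move=> d' D; apply: ccont_cdiff D (ccont_horiz _ _).
have Hv x t : a <= x <= b -> c <= t <= d -> ccont (fun t => g (vert x t)) t.
  move=> cy at_; have [] := H (vert x t); first by rewrite /rect Re_vert Im_vert.
  by move=> d' D; apply: ccont_cdiff D (ccont_vert _ _).
by split=> t tt; [apply: Hh|apply: Hh|apply: Hv|apply: Hv] => //; rewrite lexx ?ab ?cd.
Qed.

Lemma rect_int_splitx a m b c d : a <= m -> m <= b -> c <= d ->
  (forall z, rect a b c d z -> exists d' : C, cdiff g z d') ->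
  rect_int g a b c d = rect_int g a m c d + rect_int g m b c d.
Proof.
move=> am mb cd H; have [h1 h2 _ _] := sides_ccont (le_trans am mb) cd H.
by rewrite /rect_int (cint_cat am mb h1) (cint_cat am mb h2); ring.
Qed.

Lemma rect_int_splity a b c m d : a <= b -> c <= m -> m <= d ->
  (forall z, rect a b c d z -> exists d' : C, cdiff g z d') ->
  rect_int g a b c d = rect_int g a b c m + rect_int g a b m d.
Proof.
move=> ab cm md H; have [_ _ h1 h2] := sides_ccont ab (le_trans cm md) H.
by rewrite /rect_int (cint_cat cm md h1) (cint_cat cm md h2); ring.
Qed.

Lemma rect_int_affine a b c d (p q : C) : a <= b -> c <= d ->
  rect_int (fun z => p + q * z) a b c d = 0.
Proof.
move=> ab cd; rewrite /rect_int.
have Hh y : cint a b (fun t => p + q * horiz y t) =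
    (b - a)%:C * (p + q * ('i%C * y%:C)) + q * ((b ^+ 2 - a ^+ 2) / 2)%:C.
  rewrite -(cint_cst _ ab) -(cint_id ab) -cintZ; last by move=> t _; exact: ccont_id.
  rewrite -cintD; first by apply: eq_cint => t _; rewrite /horiz; ring.
    by move=> t _; exact: ccont_cst.
  by move=> t _; apply: ccontM; [exact: ccont_cst|exact: ccont_id].
have Hv x : cint c d (fun t => p + q * vert x t) =
    (d - c)%:C * (p + q * x%:C) + (q * 'i%C) * ((d ^+ 2 - c ^+ 2) / 2)%:C.
  rewrite -(cint_cst _ cd) -(cint_id cd) -cintZ; last by move=> t _; exact: ccont_id.
  rewrite -cintD; first by apply: eq_cint => t _; rewrite /vert; ring.
    by move=> t _; exact: ccont_cst.
  by move=> t _; apply: ccontM; [exact: ccont_cst|exact: ccont_id].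
by rewrite !Hh !Hv; rewrite !rmorphB/=; ring.
Qed.

Lemma rect_int_bound a b c d (M : R) : a <= b -> c <= d ->
  (forall z, rect a b c d z -> exists d' : C, cdiff g z d') ->
  (forall z, rect a b c d z -> cabs (g z) <= M) ->
  cabs (rect_int g a b c d) <= 4 * M * ((b - a) + (d - c)).
Proof.
move=> ab cd H HM; have [h1 h2 h3 h4] := sides_ccont ab cd H.
have B1 := cint_bound ab h1 (M := M).
have B2 := cint_bound ab h2 (M := M).
have B3 := cint_bound cd h3 (M := M).
have B4 := cint_bound cd h4 (M := M).
have {}B1 : cabs (cint a b (fun t => g (horiz c t))) <= 2 * M * (b - a).
  by apply: B1 => t tt; apply: HM; rewrite /rect Re_horiz Im_horiz lexx cd.
have {}B2 : cabs (cint a b (fun t => g (horiz d t))) <= 2 * M * (b - a).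
  by apply: B2 => t tt; apply: HM; rewrite /rect Re_horiz Im_horiz lexx cd.
have {}B3 : cabs (cint c d (fun t => g (vert a t))) <= 2 * M * (d - c).
  by apply: B3 => t tt; apply: HM; rewrite /rect Re_vert Im_vert lexx ab.
have {}B4 : cabs (cint c d (fun t => g (vert b t))) <= 2 * M * (d - c).
  by apply: B4 => t tt; apply: HM; rewrite /rect Re_vert Im_vert lexx ab.
have ci w : cabs ('i%C * w) = cabs w.
  by rewrite cabsM {1}/cabs/= expr0n expr1n add0r sqrtr1 mul1r.
rewrite /rect_int; apply: le_trans (cabsD _ _) _.
apply: le_trans (lerD (cabsD _ _) (lexx _)) _.
apply: le_trans (lerD (lerD (cabsD _ _) (lexx _)) (lexx _)) _.
rewrite !cabsN !ci; apply: le_trans (lerD (lerD (lerD B1 B4) B2) B3) _.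
by rewrite le_eqVlt; apply/orP; left; apply/eqP; ring.
Qed.

End Sides.

Lemma rect_intD g1 g2 a b c d :
  ccont_on a b (fun t => g1 (horiz c t)) -> ccont_on a b (fun t => g1 (horiz d t)) ->
  ccont_on c d (fun t => g1 (vert a t)) -> ccont_on c d (fun t => g1 (vert b t)) ->
  ccont_on a b (fun t => g2 (horiz c t)) -> ccont_on a b (fun t => g2 (horiz d t)) ->
  ccont_on c d (fun t => g2 (vert a t)) -> ccont_on c d (fun t => g2 (vert b t)) ->
  rect_int (fun z => g1 z + g2 z) a b c d = rect_int g1 a b c d + rect_int g2 a b c d.
Proof.
move=> h1 h2 h3 h4 k1 k2 k3 k4; rewrite /rect_int.
rewrite (cintD h1 k1) (cintD h2 k2) (cintD h3 k3) (cintD h4 k4).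
ring.
Qed.

(** The supremum of the left endpoints lies in every interval. *)
Lemma nested_point (a b : nat -> R) :
  (forall k, a k <= a k.+1) -> (forall k, b k.+1 <= b k) -> (forall k, a k <= b k) ->
  exists x, forall k, a k <= x <= b k.
Proof.
move=> ai bd ab.
have am i j : (i <= j)%N -> a i <= a j by move: i j; apply/nondecreasing_seqP.
have bm i j : (i <= j)%N -> b j <= b i by move: i j; apply/nonincreasing_seqP.
have abij i j : a i <= b j.
  apply: le_trans (am _ _ (leq_maxl i j)) _; apply: le_trans (ab _) _.
  exact: bm (leq_maxr i j).
exists (sup (range a)) => k; apply/andP; split.
  by apply: ub_le_sup; [exists (b 0%N) => _ [i _ <-]|exists k].
by apply: ge_sup; [exists (a 0%N), 0%N|move=> _ [i _ <-]].
Qed.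

(** A rectangle as a pair of intervals: its two real, then its two imaginary
    bounds. *)
Definition quad := ((R * R) * (R * R))%type.
Definition rintq g (q : quad) := rect_int g q.1.1 q.1.2 q.2.1 q.2.2.

Arguments rintq : simpl never.
Arguments rect_int : simpl never.

(** The chosen half carries at least half of the integral in modulus. *)
Definition halvex g (q : quad) : quad :=
  let m := (q.1.1 + q.1.2) / 2 in
  if cabs (rintq g q) <= 2 * cabs (rintq g ((q.1.1, m), q.2))
  then ((q.1.1, m), q.2) else ((m, q.1.2), q.2).

Definition halvey g (q : quad) : quad :=
  let m := (q.2.1 + q.2.2) / 2 in
  if cabs (rintq g q) <= 2 * cabs (rintq g (q.1, (q.2.1, m)))
  then (q.1, (q.2.1, m)) else (q.1, (m, q.2.2)).

Definition subint (p q : R * R) := [/\ q.1 <= p.1, p.2 <= q.2 & p.1 <= p.2].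

Lemma halvexP g q : subint q.1 q.1 -> subint q.2 q.2 ->
  (forall z, rect q.1.1 q.1.2 q.2.1 q.2.2 z -> exists d' : C, cdiff g z d') ->
  [/\ subint (halvex g q).1 q.1, (halvex g q).2 = q.2,
      (halvex g q).1.2 - (halvex g q).1.1 = (q.1.2 - q.1.1) / 2 &
      cabs (rintq g q) <= 2 * cabs (rintq g (halvex g q))].
Proof.
case: q => [[a b] [c d]] [_ _ /= ab] [_ _ /= cd] H; rewrite /halvex/=.
set m := (a + b) / 2.
have am : a <= m by rewrite /m; lra.
have mb : m <= b by rewrite /m; lra.
case: ifPn => /=; first by move=> H1; split => //; rewrite /m; lra.
rewrite -ltNge => H1; split => //; first by rewrite /m; lra.
have E : rintq g ((a, b), (c, d)) = rintq g ((a, m), (c, d)) + rintq g ((m, b), (c, d)).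
  exact: rect_int_splitx am mb cd H.
have := cabsD (rintq g ((a, m), (c, d))) (rintq g ((m, b), (c, d))).
by rewrite -E => H2; lra.
Qed.

Lemma halveyP g q : subint q.1 q.1 -> subint q.2 q.2 ->
  (forall z, rect q.1.1 q.1.2 q.2.1 q.2.2 z -> exists d' : C, cdiff g z d') ->
  [/\ (halvey g q).1 = q.1, subint (halvey g q).2 q.2,
      (halvey g q).2.2 - (halvey g q).2.1 = (q.2.2 - q.2.1) / 2 &
      cabs (rintq g q) <= 2 * cabs (rintq g (halvey g q))].
Proof.
case: q => [[a b] [c d]] [_ _ /= ab] [_ _ /= cd] H; rewrite /halvey/=.
set m := (c + d) / 2.
have am : c <= m by rewrite /m; lra.
have mb : m <= d by rewrite /m; lra.
case: ifPn => /=; first by move=> H1; split => //; rewrite /m; lra.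
rewrite -ltNge => H1; split => //; first by rewrite /m; lra.
have E : rintq g ((a, b), (c, d)) = rintq g ((a, b), (c, m)) + rintq g ((a, b), (m, d)).
  exact: rect_int_splity ab am mb H.
have := cabsD (rintq g ((a, b), (c, m))) (rintq g ((a, b), (m, d))).
by rewrite -E => H2; lra.
Qed.

(** Complex differentiability at every point suffices: halving the rectangle while
    keeping half of the integral leads to a point where the affine part of [g],
    whose integral vanishes, dominates. *)
Lemma goursat g a b c d : a <= b -> c <= d ->
  (forall z, rect a b c d z -> exists d' : C, cdiff g z d') ->
  rect_int g a b c d = 0.
Proof.
move=> ab cd H.
pose Q k := iter k (fun q => halvey g (halvex g q)) ((a, b), (c, d)).
have inv k : [/\ subint (Q k).1 (a, b), subint (Q k).2 (c, d),
    (Q k).1.2 - (Q k).1.1 = (b - a) / 2 ^+ k,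
    (Q k).2.2 - (Q k).2.1 = (d - c) / 2 ^+ k &
    cabs (rintq g ((a, b), (c, d))) <= 4 ^+ k * cabs (rintq g (Q k))] /\
    (subint (Q k.+1).1 (Q k).1 /\ subint (Q k.+1).2 (Q k).2).
  have step q : subint q.1 (a, b) -> subint q.2 (c, d) ->
     let q' := halvey g (halvex g q) in
     [/\ subint q'.1 q.1, subint q'.2 q.2, q'.1.2 - q'.1.1 = (q.1.2 - q.1.1) / 2,
       q'.2.2 - q'.2.1 = (q.2.2 - q.2.1) / 2 &
       cabs (rintq g q) <= 4 * cabs (rintq g q')].
    move=> [s1 s2 s3] [t1 t2 t3] q'.
    have sub u v s t z : a <= u -> v <= b -> c <= s -> t <= d -> rect u v s t z -> exists d' : C, cdiff g z d'.
      move=> au vb cs td [/andP[z1 z2] /andP[z3 z4]]; apply: H; split; apply/andP; split.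
      - exact: le_trans z1.
      - exact: le_trans vb.
      - exact: le_trans z3.
      - exact: le_trans td.
    have [//|//||] := @halvexP g q; first by move=> z; apply: sub.
    move=> [p1 p2 p3] e2 l1 b1; have t0 : subint q.2 q.2 by [].
    have [| | |] := @halveyP g (halvex g q).
    - by split.
    - by rewrite e2.
    - rewrite e2 => z; apply: sub => //; [exact: le_trans p1|exact: le_trans s2].
    rewrite -/q' e2 => e1 r2 l2 b2; rewrite e1; split => //.
    by apply: le_trans b1 _; lra.
  elim: k => [|k [[s1 s2 l1 l2 b1] [i1 i2]]].
    rewrite /= !expr0 !divr1 mul1r; split; first by split.
    by have [||] := step ((a, b), (c, d)).
  have T p q r : subint p q -> subint q r -> subint p r.
    by move=> [p1 p2 p3] [q1 q2 q3]; split => //; [exact: le_trans p1|exact: le_trans q2].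
  have [j1 j2 j3 j4 j5] := step _ s1 s2; rewrite -[halvey _ _]/(Q k.+1) in j1 j2 j3 j4 j5.
  have S1 := T _ _ _ j1 s1; have S2 := T _ _ _ j2 s2.
  split; first split => //.
  - by rewrite j3 l1 exprS; field; rewrite expf_neq0.
  - by rewrite j4 l2 exprS; field; rewrite expf_neq0.
  - apply: le_trans b1 _; rewrite exprSr -mulrA ler_wpM2l// ?exprn_ge0//.
  by have [] := step _ S1 S2.
have [x Hx] : exists x, forall k, (Q k).1.1 <= x <= (Q k).1.2.
  by apply: nested_point => k; have [[[? ? ?] _ _ _ _] [[? ? ?] _]] := inv k.
have [y Hy] : exists y, forall k, (Q k).2.1 <= y <= (Q k).2.2.
  by apply: nested_point => k; have [[_ [? ? ?] _ _ _] [_ [? ? ?]]] := inv k.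
pose p := x +i* y.
have [d' D] : exists d' : C, cdiff g p d'.
  by apply: H; split; [exact: (Hx 0%N)|exact: (Hy 0%N)].
set L := (b - a) + (d - c).
have L0 : 0 <= L by rewrite /L; lra.
suff K e : 0 < e -> cabs (rect_int g a b c d) <= 4 * L ^+ 2 * e.
  apply/eqP; rewrite -cabs_eq0 eq_le cabs_ge0 andbT; apply/ler_addgt0Pr => e e0.
  have E0 : 0 < 4 * L ^+ 2 + 1 by rewrite ltr_wpDl// mulr_ge0// exprn_ge0.
  rewrite add0r; apply: le_trans (K (e / (4 * L ^+ 2 + 1)) _) _; first by rewrite divr_gt0.
  by rewrite mulrCA ger_pMr// ler_pdivrMr// mul1r lerDl.
move=> e0; have [dl dl0 HD] := D e e0.
have [k Lk] : exists k : nat, L / 2 ^+ k < dl.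
  exists (Num.truncn (L / dl)).+1; rewrite ltr_pdivrMr ?exprn_gt0// mulrC -ltr_pdivrMr//.
  apply: lt_trans (Num.Theory.truncnS_gt _) _.
  by rewrite -natrX ltr_nat ltn_expl.
have [[[s1 s2 s3] [t1 t2 t3] l1 l2 b1] _] := inv k.
have near_p z : rect (Q k).1.1 (Q k).1.2 (Q k).2.1 (Q k).2.2 z ->
    cabs (z - p) <= L / 2 ^+ k.
  move=> [zx zy]; apply: le_trans (cabs_le _) _.
  rewrite ReD ImD ReN ImN/= /L mulrDl -l1 -l2.
  move: (Hx k) (Hy k) zx zy => /andP[h1 h2] /andP[h3 h4] /andP[h5 h6] /andP[h7 h8].
  by apply: lerD; rewrite ler_norml; apply/andP; split; lra.
have sub z : rect (Q k).1.1 (Q k).1.2 (Q k).2.1 (Q k).2.2 z -> exists d' : C, cdiff g z d'.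
  move=> [/andP[z1 z2] /andP[z3 z4]]; apply: H; split; apply/andP; split.
  - exact: le_trans z1.
  - exact: le_trans s2.
  - exact: le_trans z3.
  - exact: le_trans t2.
pose r z := g z + (- (g p - d' * p) + (- d') * z).
have E : rintq g (Q k) = rintq r (Q k).
  have [h1 h2 h3 h4] := sides_ccont s3 t3 sub.
  have Ad z : exists d'' : C, cdiff (fun z => - (g p - d' * p) + (- d') * z) z d''.
    exists (0 + (- d') * 1); exact: cdiffD (cdiff_cst _ _) (cdiffZ _ (cdiff_id _)).
  have [k1 k2 k3 k4] := sides_ccont s3 t3 (fun z _ => Ad z).
  by rewrite /rintq /r rect_intD // rect_int_affine// addr0.
have Br : cabs (rintq r (Q k)) <= 4 * (e * (L / 2 ^+ k)) * (L / 2 ^+ k).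
  have LE : L / 2 ^+ k = ((Q k).1.2 - (Q k).1.1) + ((Q k).2.2 - (Q k).2.1).
    by rewrite /L mulrDl -l1 -l2.
  rewrite [X in _ <= _ * X]LE; apply: rect_int_bound => // z Hz.
    have [d'' D''] := sub z Hz; exists (d'' + (0 + (- d') * 1)).
    by apply: cdiffD D'' (cdiffD (cdiff_cst _ _) (cdiffZ _ (cdiff_id _))).
  have -> : r z = g z - g p - d' * (z - p) by rewrite /r; ring.
  have Nz := near_p _ Hz.
  apply: le_trans (HD _ (le_lt_trans Nz Lk)) _.
  by rewrite ler_pM2l.
apply: le_trans b1 _; rewrite E.
apply: le_trans (ler_wpM2l _ Br) _; first by rewrite exprn_ge0.
rewrite le_eqVlt; apply/orP; left; apply/eqP.
rewrite (_ : 4 = 2 * 2 :> R) ?exprMn; last by ring.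
by field; rewrite expf_neq0.
Qed.

End Goursat.

(** * Fourier coefficients on circles *)

Section FourierCoefficients.
Variable R : realType.
Local Notation C := (R[i]).
Implicit Types (z w : C) (a b c d t x y r : R) (f g : C -> C) (k : int) (phi psi : R -> C).

Lemma conjcR x : (x%:C)^*%C = x%:C.
Proof. by rewrite /conjc/= oppr0. Qed.

Lemma cabs_i : cabs ('i%C : C) = 1.
Proof. by rewrite /cabs/= expr0n expr1n add0r sqrtr1. Qed.

Definition cis t : C := cexp ('i%C * t%:C).

Lemma cisD s t : cis (s + t) = cis s * cis t.
Proof. by rewrite /cis rmorphD mulrDr cexpD. Qed.

Lemma cis0 : cis 0 = 1.
Proof. by rewrite /cis rmorph0 mulr0 cexp0. Qed.

Lemma cabs_cis t : cabs (cis t) = 1.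
Proof. by rewrite cabs_cexp /= mul0r mul1r subrr expR0. Qed.

Lemma cisE t : cis t = cos t +i* sin t.
Proof.
by rewrite /cis /cexp/= !(mul0r, mul1r, mulr0, oppr0, subr0, add0r, expR0).
Qed.

Lemma cisN t : cis (- t) = (cis t)^*%C.
Proof. by rewrite !cisE cosN sinN. Qed.

Definition twopi : R := pi *+ 2.

Lemma twopi_gt0 : 0 < twopi.
Proof. by rewrite /twopi pmulrn_lgt0// pi_gt0. Qed.

Lemma cis2pi k : cis (k%:~R * twopi) = 1.
Proof.
have cn n : cis (n%:R * twopi) = 1.
  elim: n => [|n IH]; first by rewrite mul0r cis0.
  by rewrite -natr1 mulrDl mul1r cisD IH mul1r cisE /twopi cos2pi sin2pi.
case: k => n; first exact: cn.
by rewrite NegzE mulrNz mulNr cisN cn conjc1.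
Qed.

Lemma ccont_cis c t : ccont (fun s => cis (c * s)) t.
Proof.
apply: (@ccont_cdiff R (@cexp R)); first exact: cdiff_cexp.
apply: ccontM; first exact: ccont_cst.
by apply: ccontR; apply: cvgM; [apply: cvg_cst|apply: cvg_id].
Qed.

Lemma ccont_cis1 t : ccont cis t.
Proof.
have -> : cis = (fun s => cis (1 * s)) by apply/funext => s; rewrite mul1r.
exact: ccont_cis.
Qed.

(** Fourier coefficient on the circle, with frequencies in [int]. *)
Definition fc phi k : C :=
  (twopi^-1)%:C * cint 0 twopi (fun t => phi t * cis (- k%:~R * t)).

Definition ccirc phi := forall t, ccont phi t.

Lemma ccirc_on phi a b : ccirc phi -> ccont_on a b phi.
Proof. by move=> H t _; apply: H. Qed.

Lemma ccircM phi psi : ccirc phi -> ccirc psi -> ccirc (fun t => phi t * psi t).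
Proof. by move=> h1 h2 t; apply: ccontM. Qed.

Lemma ccircD phi psi : ccirc phi -> ccirc psi -> ccirc (fun t => phi t + psi t).
Proof. by move=> h1 h2 t; apply: ccontD. Qed.

Lemma ccirc_cst z : ccirc (fun=> z).
Proof. by move=> t; apply: ccont_cst. Qed.

Lemma ccirc_cis c : ccirc (fun t => cis (c * t)).
Proof. by move=> t; apply: ccont_cis. Qed.

Lemma ccirc_conj phi : ccirc phi -> ccirc (fun t => (phi t)^*%C).
Proof.
move=> H t; have [h1 h2] := H t; split.
  have -> : (fun s => Re (phi s)^*%C) = (fun s => Re (phi s)).
    by apply/funext => s; case: (phi s).
  exact: h1.
have -> : (fun s => Im (phi s)^*%C) = (fun s => - Im (phi s)).
  by apply/funext => s; case: (phi s).
exact: cvgN h2.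
Qed.

Lemma eq_fc phi psi k : phi =1 psi -> fc phi k = fc psi k.
Proof. by move=> /funext ->. Qed.

Lemma fcD phi psi k : ccirc phi -> ccirc psi ->
  fc (fun t => phi t + psi t) k = fc phi k + fc psi k.
Proof.
move=> h1 h2; rewrite /fc -mulrDr -cintD.
- by congr (_ * _); apply: eq_cint => t _; rewrite mulrDl.
- by apply: ccirc_on; apply: ccircM h1 _; apply: ccirc_cis.
- by apply: ccirc_on; apply: ccircM h2 _; apply: ccirc_cis.
Qed.

Lemma fcZ z phi k : ccirc phi -> fc (fun t => z * phi t) k = z * fc phi k.
Proof.
move=> h1.
have h : ccont_on 0 twopi (fun t => phi t * cis (- k%:~R * t)).
  by apply: ccirc_on; apply: ccircM h1 _; apply: ccirc_cis.
rewrite /fc [RHS]mulrCA -(cintZ z h).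
by congr (_ * _); apply: eq_cint => t _; rewrite mulrA.
Qed.

Lemma fc_cis j phi k : fc (fun t => cis (j%:~R * t) * phi t) k = fc phi (k - j).
Proof.
rewrite /fc; congr (_ * _); apply: eq_cint => t _.
by rewrite mulrAC -cisD mulrC -mulrDl rmorphB/= opprB.
Qed.

(** The factor 2 is that of [cint_bound]. *)
Lemma fc_bound phi k (M : R) : ccirc phi ->
  (forall t, cabs (phi t) <= M) -> cabs (fc phi k) <= 2 * M.
Proof.
move=> h1 hM; rewrite /fc cabsM cabsR ger0_norm ?invr_ge0 ?(ltW twopi_gt0)//.
rewrite ler_pdivrMl ?twopi_gt0//.
apply: le_trans (cint_bound (ltW twopi_gt0) (M := M) _ _) _.
- by apply: ccirc_on; apply: ccircM h1 _; apply: ccirc_cis.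
- by move=> t _; rewrite cabsM cabs_cis mulr1.
- by rewrite subr0 [leRHS]mulrC.
Qed.

Lemma fc_conj phi k : ccirc phi -> fc (fun t => (phi t)^*%C) k = (fc phi (- k))^*%C.
Proof.
move=> H; rewrite /fc conjcM. rewrite conjcR; congr (_ * _).
have -> : cint 0 twopi (fun t => (phi t)^*%C * cis (- k%:~R * t)) =
    cint 0 twopi (fun t => (phi t * cis (- (- k)%:~R * t))^*%C).
  apply: eq_cint => t _; rewrite conjcM; congr (_ * _).
  by rewrite -cisN rmorphN opprK mulNr.
rewrite /cint; congr Complex.
  by apply: eq_Rintegral => t _; case: (_ * _).
have [_ i2] := ccont_on_int (@ccirc_on _ 0 twopi (ccircM H (ccirc_cis (- (- k)%:~R)))).
rewrite -mulN1r -RintegralZl//; apply: eq_Rintegral => t _; rewrite mulN1r.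
by case: (_ * _).
Qed.

Lemma holo_cdiff f z : holomorphic_on_disk f -> cabs z < 1 -> exists d : C, cdiff f z d.
Proof. by move=> hf z1; apply/derivable_cdiff/hf/unit_diskE. Qed.

Lemma holo_cst (c : C) : holomorphic_on_disk (fun=> c : C).
Proof. by move=> z _; apply/derivable_cdiff; exists 0; apply: cdiff_cst. Qed.

(** In the coordinate [w = log z] an annulus becomes a rectangle over a full period.
    The integrals over its horizontal sides cancel by periodicity, so Goursat's
    theorem equates those over the vertical ones. *)
Lemma circle_mean_const f k x1 x2 : holomorphic_on_disk f -> x1 <= x2 -> x2 < 0 ->
  let G x t := f (cexp (vert x t)) * cexp (- k%:~R * vert x t) in
  cint 0 twopi (G x1) = cint 0 twopi (G x2).
Proof.
move=> hf x12 x20 G.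
pose g w := f (cexp w) * cexp (- k%:~R * w).
have H z : rect x1 x2 0 twopi z -> exists d' : C, cdiff g z d'.
  move=> [/andP[_ z2] _].
  have [d1 D1] : exists d1 : C, cdiff f (cexp z) d1.
    by apply: holo_cdiff hf _; rewrite cabs_cexp expR_lt1 (le_lt_trans z2).
  have D2 : cdiff (fun w => - k%:~R * w) z (- k%:~R * 1) by apply: cdiffZ; apply: cdiff_id.
  have D3 := cdiff_comp D2 (cdiff_cexp _).
  by eexists; apply: cdiffM (cdiff_comp (cdiff_cexp z) D1) D3.
have := goursat x12 (ltW twopi_gt0) H; rewrite /rect_int.
have -> : cint x1 x2 (fun t => g (horiz twopi t)) = cint x1 x2 (fun t => g (horiz 0 t)).
  apply: eq_cint => t _.
  have -> : horiz twopi t = horiz 0 t + 'i%C * twopi%:C by rewrite /horiz rmorph0 mulr0 addr0.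
  rewrite /g mulrDr !cexpD; have -> : cexp ('i%C * twopi%:C) = 1 :> C.
    by have := cis2pi 1; rewrite mul1r.
  have -> : - k%:~R * ('i%C * twopi%:C) = 'i%C * ((- k)%:~R * twopi)%:C :> C.
    by rewrite rmorphM/= !rmorphN/= rmorph_int; ring.
  have -> : cexp ('i%C * ((- k)%:~R * twopi)%:C) = 1 :> C by exact: (cis2pi (- k)).
  by rewrite !mulr1.
set A := cint _ _ _; set B := cint _ _ _; set D := cint _ _ _ => E.
have i0 : 'i%C != 0 :> C by rewrite -cabs_eq0 cabs_i oner_eq0.
have /eqP : 'i%C * (B - D) = 0 by rewrite -E; ring.
by rewrite mulf_eq0 (negPf i0) subr_eq0 => /eqP/esym.
Qed.

Definition on_circle f r t : C := f (r%:C * cis t).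

Lemma on_circle_ccirc f r : holomorphic_on_disk f -> 0 <= r < 1 -> ccirc (on_circle f r).
Proof.
move=> hf /andP[r0 r1] t.
have [d D] : exists d : C, cdiff f (r%:C * cis t) d.
  by apply: holo_cdiff hf _; rewrite cabsM cabs_cis mulr1 cabsR ger0_norm.
apply: (ccont_cdiff D); apply: ccontM; first exact: ccont_cst.
exact: ccont_cis1.
Qed.

Lemma fc_circle_exp f : holomorphic_on_disk f ->
  exists A : int -> C, forall x k, x < 0 ->
    fc (on_circle f (expR x)) k = (expR (k%:~R * x))%:C * A k.
Proof.
move=> hf.
pose V x k := cint 0 twopi
  (fun t => f (cexp (vert x t)) * cexp (- k%:~R * vert x t)).
have VE x k : x < 0 -> V x k = V (-1) k.
  move=> x0; case: (leP x (-1)) => h.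
    by apply: circle_mean_const => //; rewrite ltrN10.
  by apply/esym/circle_mean_const => //; apply: ltW.
have cR y : cexp y%:C = (expR y)%:C :> C by rewrite /cexp/= sin0 cos0 mulr0 mulr1.
exists (fun k => (twopi^-1)%:C * V (-1) k) => x k x0.
rewrite -(VE x k x0) /fc mulrCA; congr (_ * _).
have H : ccont_on 0 twopi
    (fun t => f (cexp (vert x t)) * cexp (- k%:~R * vert x t)).
  move=> t _; have [d D] : exists d : C, cdiff f (cexp (vert x t)) d.
    by apply: holo_cdiff hf _; rewrite cabs_cexp Re_vert expR_lt1.
  apply: ccontM.
    apply: (ccont_cdiff D); apply: (ccont_cdiff (cdiff_cexp _)); exact: ccont_vert.
  apply: (ccont_cdiff (cdiff_cexp _)); apply: ccontM; first exact: ccont_cst.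
  exact: ccont_vert.
rewrite /V -(cintZ _ H); apply: eq_cint => t _.
rewrite /on_circle /vert cexpD cR -/(cis t) mulrCA; congr (_ * _).
rewrite mulrDr cexpD.
have -> : - k%:~R * x%:C = (- (k%:~R * x))%:C :> C.
  by rewrite rmorphN rmorphM/= rmorph_int mulNr.
have -> : - k%:~R * ('i%C * t%:C) = 'i%C * (- k%:~R * t)%:C :> C.
  by rewrite rmorphM/= !rmorphN/= rmorph_int; ring.
by rewrite cR mulrA -rmorphM/= -expRD subrr expR0 mul1r.
Qed.

(** The [k]-th coefficient on the circle of radius [r] is [A k * r ^ k] with [A k]
    independent of [r]. As [r] tends to [0] it stays bounded, which excludes
    negative [k], and for [k = 0] it tends to [f 0]. *)
Lemma fc_circle f : holomorphic_on_disk f ->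
  exists a : nat -> C, [/\ a 0%N = f 0,
   forall r (n : nat), 0 < r < 1 -> fc (on_circle f r) n = a n * r%:C ^+ n &
   forall r (n : nat), 0 < r < 1 -> fc (on_circle f r) (Negz n) = 0].
Proof.
move=> hf; have [A HA] := fc_circle_exp hf.
have HR r k : 0 < r < 1 -> fc (on_circle f r) k = (expR (k%:~R * ln r))%:C * A k.
  move=> /andP[r0 r1]; have {1}-> : r = expR (ln r) by rewrite lnK.
  by apply: HA; rewrite -expR_lt1 lnK.
have HP r n : 0 < r -> expR (n%:R * ln r) = r ^+ n.
  by move=> r0; rewrite expRM_natl lnK.

exists (fun n => A n%:Z); split.
- have [d /cdiff_cont D] := @holo_cdiff f 0 hf ltac:(by rewrite cabs0).
  pose h z := f z + - f 0.
  have hh : holomorphic_on_disk h.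
    move=> z /unit_diskE/(holo_cdiff hf)[d' D']; apply/derivable_cdiff.
    by exists (d' + 0); apply: cdiffD D' (cdiff_cst _ _).
  apply/eqP; rewrite -subr_eq0 -cabs_eq0 eq_le cabs_ge0 andbT.
  apply/ler_addgt0Pr => e e0; rewrite add0r.
  have [dl dl0 Dl] := D (e / 2) ltac:(by rewrite divr_gt0).
  pose r := Num.min (dl / 2) (1 / 2).
  have r0 : 0 < r by rewrite lt_min !divr_gt0.
  have rd : r < dl by rewrite /r gt_min; apply/orP; left; lra.
  have r1 : 0 < r < 1 by rewrite r0 /r gt_min; apply/orP; right; lra.
  have r1' : 0 <= r < 1 by case/andP: r1 => /ltW -> ->.
  have E : A 0 - f 0 = fc (on_circle h r) 0.
    have -> : fc (on_circle h r) 0 = fc (fun t => on_circle f r t + - f 0) 0 by [].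
    rewrite fcD; [|exact: on_circle_ccirc|exact: ccirc_cst].
    rewrite HR// mul0r expR0 mul1r; congr (_ + _).
    rewrite /fc (_ : (fun t => _) = fun=> - f 0); last first.
      by apply/funext => t; rewrite oppr0 mul0r cis0 mulr1.
    rewrite cint_cst ?(ltW twopi_gt0)// subr0 mulrA -rmorphM/= mulVf ?mul1r//.
    by rewrite gt_eqF// twopi_gt0.
  rewrite E; apply: le_trans (fc_bound 0 (on_circle_ccirc hh r1') (M := e / 2) _) _.
    move=> t; apply/ltW/Dl; rewrite subr0 cabsM cabs_cis mulr1 cabsR ger0_norm//.
    exact: ltW.
  by lra.
- move=> r n r01; have /andP[r0 _] := r01.
  by rewrite HR// -pmulrn HP// rmorphXn mulrC.
- move=> r n r01; rewrite HR//; suff -> : A (Negz n) = 0 by rewrite mulr0.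
  have [d /cdiff_cont/(_ 1 ltr01) [dl dl0 D]] := @holo_cdiff f 0 hf ltac:(by rewrite cabs0).
  have M0 : 0 <= cabs (f 0) + 1 by rewrite addr_ge0 ?cabs_ge0.
  have B s : 0 < s < 1 -> s < dl -> cabs (A (Negz n)) <= s * (2 * (cabs (f 0) + 1)).
    move=> s01 sdl; have /andP[s0 s1] := s01.
    have := HR s (Negz n) s01; rewrite NegzE mulrNz mulNr expRN -pmulrn HP// => E.
    have -> : A (- (n.+1%:Z)) = (s ^+ n.+1)%:C * fc (on_circle f s) (- (n.+1)%:Z).
      by rewrite E mulrA -rmorphM/= mulfV ?mul1r// expf_neq0// gt_eqF.
    rewrite cabsM cabsR ger0_norm ?exprn_ge0 ?(ltW s0)// ler_pM ?cabs_ge0 ?exprn_ge0 ?(ltW s0)//.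
      by rewrite exprS ger_pMr// exprn_ile1 ?(ltW s0)// ltW.
    apply: fc_bound; first by apply: on_circle_ccirc => //; rewrite (ltW s0).
    move=> t; have ft : cabs (on_circle f s t - f 0) <= 1.
      apply/ltW/D; rewrite subr0 cabsM cabs_cis mulr1 cabsR ger0_norm//.
      exact: ltW.
    have := cabsD (on_circle f s t - f 0) (f 0); rewrite subrK => h.
    by apply: le_trans h _; rewrite addrC lerD2l.
  apply/eqP; rewrite -cabs_eq0 eq_le cabs_ge0 andbT; apply/ler_addgt0Pr => e e0.
  set M := 2 * (cabs (f 0) + 1) in B.
  have MM : 0 < M + 1 by rewrite ltr_wpDl// mulr_ge0.
  pose s := Num.min (e / (M + 1)) (Num.min (dl / 2) (1 / 2)).
  have s0 : 0 < s by rewrite !lt_min !divr_gt0.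
  rewrite add0r; apply: le_trans (B s _ _) _.
  + by rewrite s0 /s !gt_min; apply/orP; right; apply/orP; right; lra.
  + by rewrite /s !gt_min; apply/orP; right; apply/orP; left; lra.
  + have : s <= e / (M + 1) by rewrite /s ge_min lexx.
    rewrite ler_pdivlMr// => h; apply: le_trans h.
    by rewrite ler_pM2l// lerDl.
Qed.

End FourierCoefficients.

(** * Taylor expansion of holomorphic functions *)

Section DeriveInverse.
Variable K : numFieldType.
Lemma is_derive_inv (f : K^o -> K^o) (z d : K) : (f z : K) != 0 ->
  is_derive (z : K^o) (1 : K^o) f d ->
  is_derive (z : K^o) (1 : K^o) (fun x => (f x : K)^-1) (- (f z : K) ^- 2 * d).
Proof.
move=> h1 [h2 <-]; split; first exact: derivableV.
by rewrite deriveV.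
Qed.
End DeriveInverse.

Section TaylorExpansion.
Variable R : realType.
Local Notation C := (R[i]).
Implicit Types (z w : C) (t x y r : R) (f g : C -> C) (k : int) (phi psi : R -> C).
Local Notation fc := (@fc R).

Lemma cdiffV f z d : f z != 0 -> cdiff f z d ->
  cdiff (fun w => (f w)^-1) z (- (f z) ^- 2 * d).
Proof. by move=> f0 /cdiffP h; apply/cdiffP; apply: (@is_derive_inv C). Qed.

Definition ccvg (u : nat -> C) (l : C) :=
  (fun n => cabs (u n - l)) @ \oo --> (0 : R).

Definition csum (a : nat -> C) (s : C) := ccvg (fun n => \sum_(k < n) a k) s.

(** Comparing two radii in [fc_circle] for the constant function avoids computing
    any integral. *)
Lemma fc_one k : fc (fun=> 1) k = (k == 0)%:R.
Proof.
have [a [a0 ap an]] := fc_circle (@holo_cst R 1).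
have E r : fc (on_circle (fun=> 1) r) k = fc (fun=> 1) k by [].
have h2 : 0 < (1 / 2 : R) < 1 by apply/andP; split; lra.
have h4 : 0 < (1 / 4 : R) < 1 by apply/andP; split; lra.
case: k E => [n|n] E; last by rewrite -(E (1 / 2)) an.
have E2 := ap _ n h2; have E4 := ap _ n h4; rewrite E in E2; rewrite E in E4.
case: n E E2 E4 => [|n] E E2 E4; first by rewrite E2 a0 expr0 mulr1.
have : a n.+1 * (((1 / 2 : R) ^+ n.+1) - ((1 / 4 : R) ^+ n.+1))%:C = 0.
  by rewrite rmorphB/= mulrBr !rmorphXn/= -E2 -E4 subrr.
move/eqP; rewrite mulf_eq0 => /orP[/eqP a1|]; first by rewrite E2 a1 mul0r.
rewrite eq_complex/= eqxx andbT subr_eq0 eqrXn2 ?divr_ge0//.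
by move=> /eqP H; exfalso; clear -H; lra.
Qed.

Definition fnorm2 phi : C := fc (fun t => phi t * (phi t)^*%C) 0.

Lemma fnorm2_ge0 phi : ccirc phi -> 0 <= Re (fnorm2 phi).
Proof.
move=> h; rewrite /fnorm2 /fc ReM/= mul0r subr0.
apply: mulr_ge0; first by rewrite invr_ge0 ltW// twopi_gt0.
apply: Rintegral_ge0 => t _.
by rewrite oppr0 mul0r cis0 mulr1 mulcJ exprn_ge0// cabs_ge0.
Qed.

(** Pythagoras: expanding the square, the cross terms and the last term are
    [|fc phi k| ^ 2] up to sign. *)
Lemma fnorm2_sub phi k : ccirc phi ->
  fnorm2 (fun t => phi t - fc phi k * cis (k%:~R * t)) =
  fnorm2 phi - (cabs (fc phi k) ^+ 2)%:C.
Proof.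
move=> h; set c := fc phi k.
have hc := ccirc_conj h.
have hk := @ccirc_cis R (k%:~R).
have hk' := @ccirc_cis R ((- k)%:~R).
have cc z := @ccirc_cst R z.
have E : (fun t => (phi t - c * cis (k%:~R * t)) * (phi t - c * cis (k%:~R * t))^*%C)
  =1 (fun t => (phi t * (phi t)^*%C + (- c) * (cis (k%:~R * t) * (phi t)^*%C)) +
     ((- c^*%C) * (cis ((- k)%:~R * t) * phi t) + (c * c^*%C) * 1)).
  move=> t; rewrite conjcD conjcN conjcM -cisN.
  have -> : - (k%:~R * t) = (- k)%:~R * t by rewrite rmorphN mulNr.
  have : cis (k%:~R * t) * cis ((- k)%:~R * t) = 1 :> C.
    by rewrite -cisD rmorphN mulNr subrr cis0.
  move: (cis _) (cis _) => u v uv.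
  by rewrite -uv; ring.
have h1 : ccirc (fun t => phi t * (phi t)^*%C) by apply: ccircM.
have h2' : ccirc (fun t => cis (k%:~R * t) * (phi t)^*%C) by apply: ccircM.
have h2 : ccirc (fun t => (- c) * (cis (k%:~R * t) * (phi t)^*%C)) by apply: ccircM.
have h3' : ccirc (fun t => cis ((- k)%:~R * t) * phi t) by apply: ccircM.
have h3 : ccirc (fun t => (- c^*%C) * (cis ((- k)%:~R * t) * phi t)) by apply: ccircM.
have h4 : ccirc (fun t : R => (c * c^*%C) * 1) by apply: cc.
rewrite /fnorm2 (eq_fc _ E) (fcD _ (ccircD h1 h2) (ccircD h3 h4)).
rewrite (fcD _ h1 h2) (fcD _ h3 h4) (fcZ _ _ h2') (fcZ _ _ h3') (fcZ _ _ (cc 1)).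
rewrite !fc_cis fc_one eqxx mulr1 !sub0r opprK (fc_conj _ h) opprK -/c.
by rewrite -mulcJ; ring.
Qed.

(** By induction, removing one mode at a time; the other coefficients do not
    change. *)
Lemma bessel phi (ka : nat -> int) N : injective ka -> ccirc phi ->
  \sum_(j < N) cabs (fc phi (ka j)) ^+ 2 <= Re (fnorm2 phi).
Proof.
elim: N phi ka => [|N IH] phi ka ki h; first by rewrite big_ord0 fnorm2_ge0.
pose psi t := phi t - fc phi (ka 0%N) * cis ((ka 0%N)%:~R * t).
have hm : ccirc (fun t => - (fc phi (ka 0%N) * cis ((ka 0%N)%:~R * t))).
  move=> t; rewrite -[X in ccont X](_ : (fun s => - fc phi (ka 0%N) * cis ((ka 0%N)%:~R * s)) = _).
    by apply: ccontM; [apply: ccont_cst|apply: ccont_cis].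
  by apply/funext => s; rewrite mulNr.
have hpsi : ccirc psi by apply: ccircD.
have ki' : injective (fun n => ka n.+1) by move=> i j /ki[].
have := IH psi _ ki' hpsi.
rewrite fnorm2_sub// ReD ReN/= lerBrDl; apply: le_trans.
rewrite big_ord_recl/= lerD2l; apply: ler_sum => i _.
have -> // : fc psi (ka (bump 0 i)) = fc phi (ka (bump 0 i)).
have -> : fc psi (ka (bump 0 i)) = fc phi (ka (bump 0 i)) +
    fc (fun t => - (fc phi (ka 0%N) * cis ((ka 0%N)%:~R * t))) (ka (bump 0 i)).
  by rewrite -fcD.
have -> : fc (fun t => - (fc phi (ka 0%N) * cis ((ka 0%N)%:~R * t))) (ka (bump 0 i)) =
    fc (fun t => - fc phi (ka 0%N) * (cis ((ka 0%N)%:~R * t) * 1)) (ka (bump 0 i)).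
  by apply: eq_fc => t; rewrite mulr1 mulNr.
rewrite fcZ; last by apply: ccircM; [apply: ccirc_cis|apply: ccirc_cst].
rewrite fc_cis fc_one subr_eq0 (inj_eq ki)/= mulr0 addr0//.
Qed.

Lemma riemann_lebesgue phi : ccirc phi ->
  (fun n : nat => cabs (fc phi n)) @ \oo --> (0 : R).
Proof.
move=> h; pose v n := cabs (fc phi (Posz n)) ^+ 2.
have cv : cvgn (series v).
  apply: nondecreasing_is_cvgn.
    by apply: nondecreasing_series => n _ _; apply: exprn_ge0; apply: cabs_ge0.
  exists (Re (fnorm2 phi)) => _ [n _ <-].
  rewrite /series/= big_mkord; apply: (@bessel phi Posz) => // i j [//].
have := cvg_series_cvg_0 cv => /cvgrPdist_lt H.
apply/cvgrPdist_lt => e e0; near=> n.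
rewrite sub0r normrN ger0_norm ?cabs_ge0//.
rewrite -(ltr_pXn2r (ltn0Sn 1)) ?nnegrE ?cabs_ge0 ?(ltW e0)//.
rewrite -[ltLHS]ger0_norm ?exprn_ge0 ?cabs_ge0// -normrN -sub0r.
near: n; apply: H; exact: exprn_gt0.
Unshelve. all: by end_near. Qed.

Definition pseries_on_disk (a : nat -> C) f :=
  forall z, cabs z < 1 -> csum (fun n => a n * z ^+ n) (f z).

(** With [d] the derivative of [f] at [w], this divided difference is continuous on
    the circle through [w]. *)
Definition slope f w d z := if z == w then d else (f z - f w) / (z - w).

Lemma slope_ccirc f w d r : holomorphic_on_disk f -> cdiff f w d -> 0 <= r < 1 ->
  ccirc (on_circle (slope f w d) r).
Proof.
move=> hf D r01 t; have r0 : 0 <= r by case/andP: r01.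
have cc : ccont (fun s => r%:C * cis s) t.
  apply: ccontM; first exact: ccont_cst.
  exact: ccont_cis1.
apply: (ccont_comp (g := slope f w d)) => // e e0.
set p := r%:C * cis t; have [pw|pw] := eqVneq p w.
  have [dl dl0 H] := D (e / 2) ltac:(by rewrite divr_gt0).
  exists dl => // z; rewrite pw => /H Hz; rewrite /slope eqxx; case: eqVneq => [_|zw].
    by rewrite subrr cabs0.
  have zw0 : z - w != 0 by rewrite subr_eq0.
  have -> : (f z - f w) / (z - w) - d = (f z - f w - d * (z - w)) / (z - w) by field.
  rewrite cabsM cabsV ltr_pdivrMr ?cabs_gt0//; apply: le_lt_trans Hz _.
  by rewrite ltr_pM2r ?cabs_gt0//; lra.
have p1 : cabs p < 1.
  by rewrite cabsM cabs_cis mulr1 cabsR ger0_norm//; case/andP: r01.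
have [d1 D1] := holo_cdiff hf p1.
have pw0 : p - w != 0 by rewrite subr_eq0.
have D2 := cdiffV (f := fun z => z - w) pw0 (cdiffD (cdiff_id p) (cdiff_cst (- w) p)).
have D3 := cdiffM (cdiffD D1 (cdiff_cst (- f w) p)) D2.
have /cdiff_cont -/(_ _ e0) // : cdiff (slope f w d) p ((f p - f w) * (- (p - w) ^- 2 * (1 + 0)) + (p - w)^-1 * (d1 + 0)).
  apply: cdiff_near D3; first by rewrite -cabs_gt0 in pw0; exact: pw0.
  move=> z zp; rewrite /slope; case: eqVneq => // zw.
  by move: zp; rewrite zw cabsB ltxx.
Qed.

Lemma slopeE f w d z : f z - f w = (z - w) * slope f w d z.
Proof.
rewrite /slope; case: eqVneq => [->|zw]; first by rewrite !subrr mul0r.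
by rewrite mulrC divfK// subr_eq0.
Qed.

(** Chernoff: multiplication of the divided difference by [z - w] turns the
    partial sums of the Fourier series of [f] at [w] into telescoping sums of
    Fourier coefficients of a continuous function, which tend to zero. *)
Theorem taylor f : holomorphic_on_disk f -> exists a, pseries_on_disk a f.
Proof.
move=> hf; have [a [a0 ap an]] := fc_circle hf; exists a => w w1.
have [->|w0] := eqVneq w 0.
  apply/cvgrPdist_lt => e e0; near=> n.
  have n0 : (0 < n)%N by near: n; exists 1%N.
  rewrite -(prednK n0) big_ord_recl expr0 mulr1 big1 ?addr0 => [|i _].
    by rewrite a0 subrr cabs0 subrr normr0.
  by rewrite expr0n mulr0.
set r := cabs w; have r0 : 0 < r by rewrite cabs_gt0.
have r01 : 0 < r < 1 by rewrite r0.
have r01' : 0 <= r < 1 by rewrite ltW.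
have rC0 : r%:C != 0 :> C by rewrite -cabs_eq0 cabsR normr_eq0 gt_eqF.
have [d D] := holo_cdiff hf w1.
set Q := on_circle (slope f w d) r; pose c k := fc Q k.
have hQ : ccirc Q by apply: slope_ccirc.
have hF : ccirc (on_circle f r) by apply: on_circle_ccirc.
have h1' : ccirc (fun t => cis (1%:~R * t) * Q t) by apply: ccircM hQ; exact: ccirc_cis.
have h1 : ccirc (fun t => r%:C * (cis (1%:~R * t) * Q t)).
  by apply: ccircM h1'; exact: ccirc_cst.
have h2 : ccirc (fun t => - w * Q t) by apply: ccircM hQ; exact: ccirc_cst.
have h3 : ccirc (fun=> - f w * 1) by apply: ccirc_cst.
have key k : r%:C * c (k - 1) - w * c k = fc (on_circle f r) k - f w * (k == 0)%:R.
  have := fcD k hF h3; rewrite fcZ ?fc_one; last exact: ccirc_cst.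
  move=> H; rewrite -(mulNr (f w)) -H /c -fc_cis -(fcZ _ _ h1') -mulNr -(fcZ _ _ hQ).
  rewrite -(fcD _ h1 h2); apply: eq_fc => t.
  by rewrite mulr1 mul1r (slopeE f w d) /Q /on_circle; ring.
have cN n : cabs (c (Negz n)) = cabs (c (Negz 0)).
  elim: n => [|n <-]; first by [].
  have := key (Negz n); rewrite (an _ n r01) mulr0 subr0.
  have -> : Negz n - 1 = Negz n.+1 by rewrite !NegzE -opprD -PoszD addn1.
  move/eqP; rewrite subr_eq0 => /eqP/(congr1 (@cabs R)).
  rewrite !cabsM cabsR (gtr0_norm r0).
  exact: mulfI (lt0r_neq0 r0) _ _.
have c10 : c (Negz 0) = 0.
  apply/eqP; rewrite -cabs_eq0 -sqrf_eq0 eq_le exprn_ge0 ?cabs_ge0// andbT leNgt.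
  apply/negP => p0; set V := cabs (c (Negz 0)) ^+ 2 in p0.
  pose N := (Num.truncn (Re (fnorm2 Q) / V)).+1.
  have : \sum_(j < N) cabs (fc Q (Negz j)) ^+ 2 <= Re (fnorm2 Q).
    by apply: (bessel (ka := Negz)) => // i j [].
  have -> : \sum_(j < N) cabs (fc Q (Negz j)) ^+ 2 = N%:R * V.
    rewrite (eq_bigr (fun=> V)) => [|i _]; last by rewrite -/(c _) cN.
    by rewrite sumr_const card_ord mulr_natl.
  rewrite -ler_pdivlMr// leNgt => /negP; apply; exact: Num.Theory.truncnS_gt.
have T n : \sum_(k < n.+1) a k * w ^+ k - f w = - (w * (w / r%:C) ^+ n * c n).
  elim: n => [|n IH].
    rewrite big_ord1 !expr0 !mulr1; have := key 0; rewrite (ap _ 0%N r01) expr0 !mulr1.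
    by rewrite (_ : 0 - 1 = Negz 0)// c10 mulr0 sub0r => <-.
  rewrite big_ord_recr/= addrAC IH; have := key n.+1; rewrite (ap _ _ r01) mulr0 subr0.
  rewrite (_ : n.+1%:Z - 1 = n); last by rewrite -addn1 PoszD addrK.
  move=> E; have -> : a n.+1 = (r%:C * c n - w * c n.+1) / r%:C ^+ n.+1.
    by rewrite E mulfK// expf_neq0.
  by rewrite !expr_div_n !exprS; field; rewrite expf_neq0// rC0.
have /cvgrPdist_lt RL := riemann_lebesgue hQ.
apply/cvgrPdist_lt => e e0.
have [N _ HN] := RL e e0.
exists N.+1 => // -[//|n] /= Nn.
have := HN n Nn; rewrite T -/(c n); move: (c n) => cn.
rewrite /= !sub0r !normrN !ger0_norm ?cabs_ge0//.
rewrite cabsN !cabsM cabsX cabsM cabsV cabsR (gtr0_norm r0) -/r divff ?gt_eqF//.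
rewrite expr1n mulr1 => h.
by apply: le_lt_trans h; rewrite ler_piMl ?cabs_ge0// ltW.
Unshelve. all: by end_near. Qed.

End TaylorExpansion.

(** * Power series on the unit disk *)

Section PowerSeries.
Variable R : realType.
Local Notation C := (R[i]).
Implicit Types (z w : C) (x y r : R) (f g : C -> C) (a b : nat -> C) (u v : nat -> C).

Lemma ccvg_eps u l : ccvg u l <-> forall e : R, 0 < e ->
  exists N : nat, forall n, (N <= n)%N -> cabs (u n - l) < e.
Proof.
split=> [/cvgrPdist_lt H e e0|H].
  have [N _ HN] := H e e0; exists N => n Nn; have := HN n Nn.
  by rewrite /= sub0r normrN ger0_norm ?cabs_ge0.
apply/cvgrPdist_lt => e /H[N HN]; exists N => // n Nn /=.
by rewrite sub0r normrN ger0_norm ?cabs_ge0//; apply: HN.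
Qed.

Lemma ccvg_cst (l : C) : ccvg (fun=> l) l.
Proof. by apply/ccvg_eps => e e0; exists 0%N => n _; rewrite subrr cabs0. Qed.

Lemma ccvgD u v l m : ccvg u l -> ccvg v m -> ccvg (fun n => u n + v n) (l + m).
Proof.
move=> /ccvg_eps hu /ccvg_eps hv; apply/ccvg_eps => e e0.
have e2 : 0 < e / 2 by rewrite divr_gt0.
have [N HN] := hu _ e2; have [M HM] := hv _ e2.
exists (maxn N M) => n; rewrite geq_max => /andP[/HN h1 /HM h2].
rewrite opprD addrACA; apply: le_lt_trans (cabsD _ _) _.
by rewrite (splitr e) ltrD.
Qed.

Lemma ccvgZ z u l : ccvg u l -> ccvg (fun n => z * u n) (z * l).
Proof.
move=> /ccvg_eps hu; apply/ccvg_eps => e e0.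
have M0 : 0 < cabs z + 1 by rewrite ltr_wpDl ?cabs_ge0.
have [N HN] := hu (e / (cabs z + 1)) ltac:(by rewrite divr_gt0).
exists N => n /HN; rewrite ltr_pdivlMr// => h; rewrite -mulrBr cabsM.
by apply: le_lt_trans h; rewrite mulrC ler_wpM2l ?cabs_ge0// lerDl.
Qed.

Lemma ccvgN u l : ccvg u l -> ccvg (fun n => - u n) (- l).
Proof.
by move=> /ccvg_eps hu; apply/ccvg_eps => e /hu[N HN]; exists N => n /HN;
  rewrite -opprD cabsN.
Qed.

Lemma ccvg_near u v l N : (forall n, (N <= n)%N -> u n = v n) -> ccvg u l -> ccvg v l.
Proof.
move=> uv /ccvg_eps hu; apply/ccvg_eps => e /hu[M HM]; exists (maxn N M) => n.
by rewrite geq_max => /andP[/uv <- /HM].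
Qed.

Lemma ccvgS u l : ccvg u l <-> ccvg (fun n => u n.+1) l.
Proof.
split=> /ccvg_eps hu; apply/ccvg_eps => e /hu[N HN].
  by exists N => n Nn; apply: HN; apply: leqW.
by exists N.+1 => -[//|n]; apply: HN.
Qed.

Lemma ccvg_le u l (B : R) N : (forall n, (N <= n)%N -> cabs (u n) <= B) ->
  ccvg u l -> cabs l <= B.
Proof.
move=> uB /ccvg_eps hu; apply/ler_addgt0Pr => e e0; have [M HM] := hu e e0.
have h := HM _ (leq_maxr N M); rewrite cabsB in h.
rewrite -(subrK (u (maxn N M)) l); apply: le_trans (cabsD _ _) _.
by rewrite addrC lerD ?uB ?leq_maxl// ltW.
Qed.

Lemma ccvg_unique u l m : ccvg u l -> ccvg u m -> l = m.
Proof.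
move=> hu /ccvgN hm; have h := ccvgD hu hm.
apply/eqP; rewrite -subr_eq0 -cabs_eq0 eq_le cabs_ge0 andbT.
apply: (ccvg_le (N := 0%N)) h => n _ /=.
by rewrite subrr cabs0.
Qed.

Lemma ccvg_bounded u l : ccvg u l -> exists B : R, forall n, cabs (u n) <= B.
Proof.
move=> /ccvg_eps hu; have [N HN] := hu 1 ltr01.
exists (\sum_(k < N) cabs (u k) + (1 + cabs l)) => n.
have [nN|Nn] := ltnP n N.
  apply: (@le_trans _ _ (\sum_(k < N) cabs (u k))); last first.
    by rewrite lerDl addr_ge0 ?cabs_ge0.
  by rewrite (bigD1 (Ordinal nN))//= lerDl sumr_ge0// => *; apply: cabs_ge0.
apply: (@le_trans _ _ (1 + cabs l)).
  rewrite -(subrK l (u n)); apply: le_trans (cabsD _ _) _.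
  by rewrite lerD2r ltW// HN.
by rewrite lerDr sumr_ge0// => *; apply: cabs_ge0.
Qed.

(** The radius of convergence is at least [1]. *)
Definition tame a := forall x : R, 0 <= x < 1 ->
  exists M : R, forall n, cabs (a n) * x ^+ n <= M.

Lemma pseries_tame a f : pseries_on_disk a f -> tame a.
Proof.
move=> H x /andP[x0 x1].
have [|B HB] := ccvg_bounded (H x%:C _); first by rewrite cabsR ger0_norm.
exists (B + B) => n; have -> : cabs (a n) * x ^+ n = cabs (a n * x%:C ^+ n).
  by rewrite cabsM cabsX cabsR ger0_norm.
have -> : a n * x%:C ^+ n = \sum_(k < n.+1) a k * x%:C ^+ k - \sum_(k < n) a k * x%:C ^+ k.
  by rewrite big_ord_recr/= addrAC subrr add0r.
by apply: le_trans (cabsD _ _) _; rewrite cabsN lerD.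
Qed.

Lemma geom_le y n : 0 <= y < 1 -> \sum_(k < n) y ^+ k <= (1 - y)^-1.
Proof.
move=> /andP[y0 y1]; have y10 : 0 < 1 - y by rewrite subr_gt0.
rewrite -(ler_pM2l y10) mulfV ?gt_eqF// -[1 - y]opprB mulNr -subrX1.
by rewrite opprB gerBl exprn_ge0.
Qed.

Lemma geom_tail y n m : 0 <= y < 1 -> \sum_(n <= k < m) y ^+ k <= y ^+ n / (1 - y).
Proof.
move=> y01; have /andP[y0 y1] := y01.
rewrite -{1}[n]add0n big_addn big_mkord.
under eq_bigr do rewrite exprD mulrC.
by rewrite -mulr_sumr ler_wpM2l ?exprn_ge0// geom_le.
Qed.

Lemma natr_geom_le y n : 0 <= y < 1 -> n%:R * y ^+ n <= (1 - y)^-1.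
Proof.
move=> y01; apply: le_trans (geom_le n y01); have /andP[y0 y1] := y01.
rewrite mulr_natl -[X in _ *+ X](card_ord n) -sumr_const; apply: ler_sum => i _.
by rewrite ler_wiXn2l//; [exact: ltW|exact/ltnW/ltn_ord].
Qed.

(** Boundedness at [sqrt x] gives geometric decay at [x] with ratio [sqrt x]. *)
Lemma tame_geom a x : tame a -> 0 <= x < 1 -> exists M y : R,
  [/\ 0 <= y < 1, 0 <= M & forall n, cabs (a n) * x ^+ n <= M * y ^+ n].
Proof.
move=> ta /andP[x0 x1]; set y := Num.sqrt x.
have y0 : 0 <= y by apply: sqrtr_ge0.
have y1 : y < 1 by rewrite -sqrtr1 ltr_sqrt.
have [|M HM] := ta y; first by rewrite y0.
exists M, y; split; first by rewrite y0.
  by apply: le_trans (HM 0%N); rewrite expr0 mulr1 cabs_ge0.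
move=> n; rewrite -(sqr_sqrtr x0) -/y -exprM mulnC exprM expr2 mulrA.
by rewrite ler_wpM2r// exprn_ge0.
Qed.

Lemma sum_geom_tail a z (M y : R) n m : 0 <= y < 1 -> 0 <= M ->
  (forall n, cabs (a n) * cabs z ^+ n <= M * y ^+ n) -> (n <= m)%N ->
  cabs (\sum_(k < m) a k * z ^+ k - \sum_(k < n) a k * z ^+ k) <= M * y ^+ n / (1 - y).
Proof.
move=> y01 M0 HM nm.
rewrite -!(big_mkord xpredT (fun k => a k * z ^+ k)).
rewrite [X in cabs (X - _)](big_cat_nat (n := n))//= addrAC subrr add0r.
apply: le_trans (cabs_sum _ _ _) _.
rewrite -mulrA; apply: le_trans (ler_wpM2l M0 (geom_tail n m y01)).
rewrite mulr_sumr; apply: ler_sum => k _.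
by rewrite cabsM cabsX.
Qed.

Lemma pseries_tail a f x : pseries_on_disk a f -> 0 <= x < 1 -> exists M y : R,
  [/\ 0 <= y < 1, 0 <= M & forall n z, cabs z <= x ->
    cabs (f z - \sum_(k < n) a k * z ^+ k) <= M * y ^+ n].
Proof.
move=> H x01; have [M [y [y01 M0 HM]]] := tame_geom (pseries_tame H) x01.
have /andP[y0 y1] := y01; have /andP[x0 x1] := x01.
exists (M / (1 - y)), y; split => //; first by rewrite divr_ge0// subr_ge0 ltW.
move=> n z zx; have z1 := le_lt_trans zx x1.
have H1 := ccvgD (H z z1) (ccvg_cst (- \sum_(k < n) a k * z ^+ k)).
apply: (ccvg_le (N := n)) H1 => m nm /=.
rewrite mulrAC; apply: sum_geom_tail => // k.
apply: le_trans (HM k); rewrite ler_wpM2l ?cabs_ge0// lerXn2r ?nnegrE ?cabs_ge0//.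
Qed.

Lemma tame_pseries a : tame a -> exists f, pseries_on_disk a f.
Proof.
move=> ta; suff H z : exists s, cabs z < 1 -> csum (fun n => a n * z ^+ n) s.
  by exists (fun z => projT1 (cid (H z))) => z; case: (cid (H z)).
have [z1|z1] := ltP (cabs z) 1; last by exists 0.
have [|M [y [y01 M0 HM]]] := tame_geom ta (x := cabs z); first by rewrite cabs_ge0.
pose u n := a n * z ^+ n.
have cvR (h : C -> R) : (forall w, `|h w| <= cabs w) -> cvgn (series (fun n => h (u n))).
  move=> hle; apply: normed_cvg.
  apply: (series_le_cvg (v_ := geometric M y)).
  - by move=> n; apply: normr_ge0.
  - by move=> n /=; rewrite mulr_ge0// exprn_ge0//; case/andP: y01.
  - move=> n /=; apply: le_trans (hle _) _.
    by rewrite cabsM cabsX.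
  apply: is_cvg_geometric_series; rewrite ger0_norm; by case/andP: y01.
have c1 := cvR (@complex.Re R) (@cabs_Re R); have c2 := cvR (@complex.Im R) (@cabs_Im R).
exists (limn (series (fun n => Re (u n))) +i* limn (series (fun n => Im (u n)))) => _.
apply/ccvg_eps => e e0; have e2 : 0 < e / 2 by rewrite divr_gt0.
have /cvgrPdist_lt/(_ _ e2)[N1 _ H1] := c1.
have /cvgrPdist_lt/(_ _ e2)[N2 _ H2] := c2.
exists (maxn N1 N2) => n; rewrite geq_max => /andP[/H1 n1 /H2 n2].
apply: le_lt_trans (cabs_le _) _; rewrite (splitr e).
have sR : Re (\sum_(k < n) a k * z ^+ k) = series (fun n => Re (u n)) n.
  rewrite /series/= big_mkord; elim/big_ind2 : _ => // x1 x2 y1 y2 <- <-.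
  by rewrite ReD.
have sI : Im (\sum_(k < n) a k * z ^+ k) = series (fun n => Im (u n)) n.
  rewrite /series/= big_mkord; elim/big_ind2 : _ => // x1 x2 y1 y2 <- <-.
  by rewrite ImD.
by rewrite ReD ImD ReN ImN sR sI/= ltrD// distrC.
Qed.

Definition dcoef a n : C := n.+1%:R * a n.+1.

Lemma tame_natmul a : tame a -> tame (fun n => n%:R * a n).
Proof.
move=> ta x x01; have [M [y [y01 M0 HM]]] := tame_geom ta x01.
exists (M / (1 - y)) => n; rewrite cabsM cabs_nat -mulrA.
apply: le_trans (ler_wpM2l (ler0n _ _) (HM n)) _.
by rewrite mulrCA ler_wpM2l// natr_geom_le.
Qed.

Lemma tame_shift a : tame a -> tame (fun n => a n.+1).
Proof.
move=> ta x /andP[x0 x1]; pose t := (x + 1) / 2.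
have t01 : 0 <= t < 1 by apply/andP; split; rewrite /t; lra.
have [M HM] := ta t t01; have t0 : 0 < t by rewrite /t; lra.
have xt : x <= t by rewrite /t; lra.
exists (M / t) => n; rewrite ler_pdivlMr// -mulrA.
apply: le_trans (HM n.+1); rewrite ler_wpM2l ?cabs_ge0// exprSr ler_wpM2r ?(ltW t0)//.
by rewrite lerXn2r ?nnegrE// ltW.
Qed.

Lemma tame_dcoef a : tame a -> tame (dcoef a).
Proof. by move=> /tame_natmul/tame_shift. Qed.

(** The factor [rho ^+ 2] on the left stands for the exponent [k - 2] on the right,
    which would be truncated for small [k]. *)
Lemma quadratic_remainder z h (rho : R) k : cabs z <= rho -> cabs (z + h) <= rho ->
  rho ^+ 2 * cabs ((z + h) ^+ k - z ^+ k - k%:R * z ^+ k.-1 * h) <=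
  (k%:R ^+ 2 * rho ^+ k) * cabs h ^+ 2.
Proof.
move=> zr zhr; have r0 : 0 <= rho := le_trans (cabs_ge0 z) zr.
elim: k => [|k IH].
  by rewrite !expr0 subrr mul0r mul0r subr0 cabs0 mulr0 expr0n mul0r mul0r.
have -> : (z + h) ^+ k.+1 - z ^+ k.+1 - k.+1%:R * z ^+ k.+1.-1 * h =
  (z + h) * ((z + h) ^+ k - z ^+ k - k%:R * z ^+ k.-1 * h) + k%:R * z ^+ k.-1 * h ^+ 2.
  case: k {IH} => [|k] /=; first by rewrite !expr0 !expr1; ring.
  by rewrite !exprS; ring.
set E := _ - _ - _ in IH *.
apply: (@le_trans _ _ (rho * (rho ^+ 2 * cabs E) + rho ^+ 2 * (k%:R * cabs z ^+ k.-1 * cabs h ^+ 2))).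
  rewrite [rho * (_ * _)]mulrCA -mulrDr ler_wpM2l ?exprn_ge0//; apply: le_trans (cabsD _ _) _.
  rewrite !cabsM !cabsX cabs_nat lerD2r ler_wpM2r ?cabs_ge0//.
apply: (@le_trans _ _ (rho * (k%:R ^+ 2 * rho ^+ k * cabs h ^+ 2) + k%:R * rho ^+ k.+1 * cabs h ^+ 2)).
  apply: lerD; first by rewrite ler_wpM2l.
  rewrite mulrA ler_wpM2r ?exprn_ge0 ?cabs_ge0// mulrCA.
  case: k {IH E} => [|k]; first by rewrite !mul0r.
  rewrite ler_wpM2l//= !exprS expr0 mulr1 -mulrA ler_wpM2l// ler_wpM2l//.
  by rewrite lerXn2r ?nnegrE ?cabs_ge0.
have -> : rho * (k%:R ^+ 2 * rho ^+ k * cabs h ^+ 2) + k%:R * rho ^+ k.+1 * cabs h ^+ 2 =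
   (k%:R ^+ 2 + k%:R) * rho ^+ k.+1 * cabs h ^+ 2 by rewrite !(exprS rho); ring.
rewrite ler_wpM2r ?exprn_ge0 ?cabs_ge0// ler_wpM2r ?exprn_ge0//.
rewrite -natr1 sqrrD1 -addrA lerD2l mulr2n -addrA lerDl addr_ge0//.
Qed.

(** Termwise differentiation: the quadratic remainders sum to a bound
    [B * |w - z|^2] that does not depend on the truncation. *)
Lemma pseries_cdiff a f g z : pseries_on_disk a f -> pseries_on_disk (dcoef a) g ->
  cabs z < 1 -> cdiff f z (g z).
Proof.
move=> Hf Hg z1; have z0 := cabs_ge0 z.
pose rho := (cabs z + 1) / 2.
have r01 : 0 <= rho < 1 by apply/andP; split; rewrite /rho; lra.
have r1 : rho < 1 by case/andP: r01.
have zr : cabs z < rho by rewrite /rho; lra.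
have r0 : 0 < rho by apply: le_lt_trans zr.
have [M [y [y01 M0 HM]]] :=
  tame_geom (tame_natmul (tame_natmul (pseries_tame Hf))) r01.
pose B := M / (1 - y) / rho ^+ 2.
have B0 : 0 <= B.
  by case/andP: y01 => y0 y1; rewrite !divr_ge0 ?exprn_ge0 ?(ltW r0)// subr_ge0 ltW.
have rem h : cabs (z + h) <= rho -> cabs (f (z + h) - f z - g z * h) <= B * cabs h ^+ 2.
  move=> zh; have zh1 := le_lt_trans zh r1.
  have c1 := Hf _ zh1; have c2 := Hf _ z1.
  have c3 : csum (fun n => a n * (n%:R * z ^+ n.-1)) (g z).
    apply/ccvgS; apply: (ccvg_near (N := 0%N)) (Hg _ z1) => n _.
    rewrite big_ord_recl mul0r mulr0 add0r; apply: eq_bigr => i _.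
    by rewrite /dcoef mulrCA mulrA.
  have := ccvgD (ccvgD c1 (ccvgN c2)) (ccvgZ (- h) c3).
  rewrite mulNr [h * g z]mulrC; apply: (ccvg_le (N := 0%N)) => n _ /=.
  rewrite mulr_sumr -!sumrN -!big_split/=.
  rewrite (eq_bigr (fun k : 'I_n =>
    a k * ((z + h) ^+ k - z ^+ k - k%:R * z ^+ k.-1 * h))); last by move=> k _; ring.
  apply: le_trans (cabs_sum _ _ _) _.
  rewrite /B mulrAC ler_pdivlMr ?exprn_gt0// mulrC mulr_sumr.
  apply: (@le_trans _ _ (\sum_(k < n) (M * y ^+ k) * cabs h ^+ 2)).
    apply: ler_sum => k _; rewrite cabsM mulrCA.
    have q := quadratic_remainder k (ltW zr) zh.
    apply: le_trans (ler_wpM2l (cabs_ge0 _) q) _.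
    rewrite mulrA ler_wpM2r ?exprn_ge0 ?cabs_ge0//; apply: le_trans (HM k).
    rewrite !cabsM !cabs_nat le_eqVlt; apply/orP; left; apply/eqP; ring.
  rewrite -mulr_suml ler_wpM2r ?exprn_ge0 ?cabs_ge0// -mulr_sumr ler_wpM2l//.
  exact: geom_le.
move=> e e0; exists (Num.min (rho - cabs z) (e / (B + 1))).
  by rewrite lt_min subr_gt0 zr divr_gt0// ltr_wpDl.
move=> w; rewrite lt_min => /andP[w1 w2].
have := rem (w - z); rewrite [z + _]addrC subrK => rw.
apply: le_trans (rw _) _.
  rewrite -(subrK z w); apply: le_trans (cabsD _ _) _; lra.
rewrite expr2 mulrA ler_wpM2r ?cabs_ge0//; move: w2.
rewrite ltr_pdivlMr ?ltr_wpDl// => /ltW; apply: le_trans.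
by rewrite mulrC ler_wpM2l ?cabs_ge0// lerDl.
Qed.

Lemma pseries_holo a f : pseries_on_disk a f -> holomorphic_on_disk f.
Proof.
move=> Hf z /unit_diskE z1; have [g Hg] := tame_pseries (tame_dcoef (pseries_tame Hf)).
by apply/derivable_cdiff; exists (g z); apply: pseries_cdiff Hf Hg z1.
Qed.

Lemma eq_pseries a f g : (forall z, cabs z < 1 -> f z = g z) ->
  pseries_on_disk a f -> pseries_on_disk a g.
Proof. by move=> fg H z z1; rewrite -fg//; apply: H. Qed.

Lemma pseries_derive1 a f : pseries_on_disk a f ->
  pseries_on_disk (dcoef a) (derive1 (f : C^o -> C^o)).
Proof.
move=> Hf; have [g Hg] := tame_pseries (tame_dcoef (pseries_tame Hf)).
apply: (eq_pseries _ Hg) => z z1.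
exact/esym/cdiff_derive1/(pseries_cdiff Hf Hg z1).
Qed.

Lemma pseries0 a f : pseries_on_disk a f -> f 0 = a 0%N.
Proof.
move=> H; have h0 : cabs (0 : C) < 1 by rewrite cabs0.
apply: ccvg_unique (H 0 h0) _; apply: (ccvg_near (N := 1%N)) (ccvg_cst (a 0%N)).
case=> // n _; rewrite big_ord_recl expr0 mulr1 big1 ?addr0// => i _.
by rewrite expr0n mulr0.
Qed.

Lemma pseries1 a f : pseries_on_disk a f -> cdiff f 0 (a 1%N).
Proof.
move=> Hf; have [g Hg] := tame_pseries (tame_dcoef (pseries_tame Hf)).
have := pseries_cdiff Hf Hg (z := 0); rewrite (pseries0 Hg) /dcoef mul1r.
by apply; rewrite cabs0.
Qed.

Lemma pseriesD a b f g : pseries_on_disk a f -> pseries_on_disk b g ->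
  pseries_on_disk (fun n => a n + b n) (fun z => f z + g z).
Proof.
move=> Hf Hg z z1; apply: (ccvg_near (N := 0%N)) (ccvgD (Hf z z1) (Hg z z1)) => n _.
by rewrite -big_split; apply: eq_bigr => i _; rewrite mulrDl.
Qed.

Lemma pseriesZ c a f : pseries_on_disk a f ->
  pseries_on_disk (fun n => c * a n) (fun z => c * f z).
Proof.
move=> Hf z z1; apply: (ccvg_near (N := 0%N)) (ccvgZ c (Hf z z1)) => n _.
by rewrite mulr_sumr; apply: eq_bigr => i _; rewrite mulrA.
Qed.

Lemma pseries_fun_unique a f g z : pseries_on_disk a f -> pseries_on_disk a g ->
  cabs z < 1 -> f z = g z.
Proof. by move=> Hf Hg z1; apply: ccvg_unique (Hf z z1) (Hg z z1). Qed.

Lemma pseries_eq0 a f : pseries_on_disk a f -> (forall z, cabs z < 1 -> f z = 0) ->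
  forall n, a n = 0.
Proof.
move=> + + n; elim: n a f => [|n IH] a f Hf f0.
  by rewrite -(pseries0 Hf) f0// cabs0.
have : dcoef a n = 0.
  apply: IH (pseries_derive1 Hf) _ => z z1; apply: cdiff_derive1.
  apply: (cdiff_near (dl := 1 - cabs z)) (cdiff_cst 0 z); first by rewrite subr_gt0.
  move=> w wz; rewrite f0// -(subrK z w); apply: le_lt_trans (cabsD _ _) _.
  by rewrite -ltrBrDr.
by move/eqP; rewrite mulf_eq0 pnatr_eq0/= => /eqP.
Qed.

Lemma pseries_unique a b f g : pseries_on_disk a f -> pseries_on_disk b g ->
  (forall z, cabs z < 1 -> f z = g z) -> a =1 b.
Proof.
move=> Hf Hg fg n; have := pseriesD Hf (pseriesZ (-1) Hg).
move=> /pseries_eq0 -/(_ _ n) H; apply/eqP; rewrite -subr_eq0 -mulN1r; apply/eqP/H.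
by move=> z /fg ->; rewrite mulN1r subrr.
Qed.

Lemma pseries_mulX a f : pseries_on_disk a f ->
  pseries_on_disk (fun n => if n is m.+1 then a m else 0) (fun z => z * f z).
Proof.
move=> Hf z z1; apply/ccvgS; apply: (ccvg_near (N := 0%N)) (ccvgZ z (Hf z z1)) => n _.
rewrite big_ord_recl mul0r add0r mulr_sumr; apply: eq_bigr => i _ /=.
by rewrite exprS mulrCA.
Qed.

Lemma pseries_mulXn a f n : pseries_on_disk a f ->
  pseries_on_disk (fun k => if (n <= k)%N then a (k - n)%N else 0) (fun z => z ^+ n * f z).
Proof.
move=> Hf; elim: n => [|n IH].
  by move=> z z1; rewrite expr0 mul1r; apply: (ccvg_near (N := 0%N)) (Hf z z1) => n _;
    apply: eq_bigr => i _; rewrite subn0.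
apply: (eq_pseries (f := fun z => z * (z ^+ n * f z))) => [z z1|].
  by rewrite exprS mulrA.
by move=> z z1; apply: (ccvg_near (N := 0%N)) (pseries_mulX IH z1) => m _;
  apply: eq_bigr => -[[|i] ?] _.
Qed.

(** Shifting a coefficient sequence does not change the radius of convergence, so
    the quotient is defined by its own power series. *)
Lemma pseries_divXn a f n : pseries_on_disk a f -> (forall k, (k < n)%N -> a k = 0) ->
  exists2 g, pseries_on_disk (fun k => a (n + k)%N) g &
    forall z, cabs z < 1 -> f z = z ^+ n * g z.
Proof.
move=> Hf a0; have ts : tame (fun k => a (n + k)%N).
  elim: n {a0} => [|n IH]; first exact: pseries_tame Hf.
  by have := tame_shift IH; congr tame; apply/funext => k; rewrite addnS.
have [g Hg] := tame_pseries ts; exists g => // z z1.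
apply: pseries_fun_unique (pseries_mulXn n Hg) z1.
move=> w w1; apply: (ccvg_near (N := 0%N)) (Hf w w1) => m _.
apply: eq_bigr => i _; case: leqP => [ni|/a0 ->//].
by rewrite subnKC.
Qed.

Definition poly_fun a N z : C := \sum_(k < N) a k * z ^+ k.

Lemma poly_fun0 a : poly_fun a 0 = fun=> 0.
Proof. by apply/funext => z; rewrite /poly_fun big_ord0. Qed.

Lemma poly_funS a N : poly_fun a N.+1 = fun z => poly_fun a N z + a N * z ^+ N.
Proof. by apply/funext => z; rewrite /poly_fun big_ord_recr. Qed.

Lemma pseries_poly a N :
  pseries_on_disk (fun k => if (k < N)%N then a k else 0) (poly_fun a N).
Proof.
move=> z z1; apply: (ccvg_near (N := N)) (ccvg_cst (poly_fun a N z)) => n Nn.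
rewrite /poly_fun (big_ord_widen _ (fun k => a k * z ^+ k) Nn) big_mkcond/=.
by apply: eq_bigr => i _; case: ifP => // _; rewrite mul0r.
Qed.

Lemma pseries_monom n : pseries_on_disk (fun k => (k == n)%:R) (fun z => z ^+ n).
Proof.
move=> z z1; apply: (ccvg_near (N := n.+1)) (ccvg_cst (z ^+ n)) => m nm.
rewrite (bigD1 (Ordinal nm))//= eqxx mul1r big1 ?addr0// => i.
by rewrite -val_eqE/= => /negPf ->; rewrite mul0r.
Qed.

Definition dncoef m a n : C := ((n + m) ^_ m)%:R * a (n + m)%N.

Lemma pseries_derive1n a f m : pseries_on_disk a f ->
  pseries_on_disk (dncoef m a) (derive1n m (f : C^o -> C^o)).
Proof.
move=> Hf; elim: m => [|m IH].
  by move=> z z1; apply: (ccvg_near (N := 0%N)) (Hf z z1) => n _;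
    apply: eq_bigr => i _; rewrite /dncoef addn0 ffactn0 mul1r.
move=> z z1; apply: (ccvg_near (N := 0%N)) (pseries_derive1 IH z1) => n _.
apply: eq_bigr => i _; congr (_ * _).
rewrite /dcoef /dncoef mulrA -natrM addSnnS; congr (_%:R * _).
by rewrite ffactnSr -addSnnS addnK mulnC.
Qed.

End PowerSeries.

(** * Rotations and dilations of planar Lebesgue measure *)

(** An image measure is a measure only in the presence of the measurability proof
    of the map; packaging both once keeps that proof out of later terms. *)
Lemma push_measure (R : realType) d1 d2 (T1 : measurableType d1)
    (T2 : measurableType d2) (m : {measure set T1 -> \bar R}) (f : T1 -> T2) :
  measurable_fun setT f ->
  exists2 nu : {measure set T2 -> \bar R}, (forall A, nu A = m (f @^-1` A)) &
    forall D (h : T2 -> \bar R), measurable D -> measurable_fun D h ->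
    {in D, forall y, (0 <= h y)%E} ->
    (\int[nu]_(y in D) h y = \int[m]_(x in f @^-1` D) h (f x))%E.
Proof.
move=> mf; unshelve eexists.
- by refine (pushforward m f : {measure set T2 -> \bar R}); exact: mf.
- by [].
- by move=> D h mD mh h0; exact: ge0_integral_pushforward.
Qed.

Section PlaneMeasure.
Variable R : realType.
Local Notation leb := (@lebesgue_measure R).
Local Notation mu2 := (@lebesgue_measure R \x @lebesgue_measure R)%E.
Local Notation RR := (measurableTypeR R).
Implicit Types (c s t : R) (A : set RR) (B : set (plane (R := R))).

Lemma lebesgue_shift c A : measurable A ->
  leb ((fun y : RR => (y + c : RR)) @^-1` A) = leb A.
Proof.
move=> mA; have mf : measurable_fun setT (fun y : RR => (y + c : RR)).
  by apply: measurable_funD.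
have [nu nuE _] := push_measure leb mf; rewrite -nuE.
apply/esym/lebesgue_measure_unique => //= _ [[a b]] _ <-.
rewrite nuE (_ : _ @^-1` _ = `]a - c, b - c]%classic); last first.
  by apply/seteqP; split=> x /=; rewrite !in_itv/= ltrBlDr lerBrDr.
rewrite lebesgue_measure_itv [RHS](lebesgue_measure_itv `]a - c, b - c])/=.
rewrite !lte_fin ltrD2r; case: ifP => // _.
by rewrite -!EFinB; congr (_%:E); ring.
Qed.

Lemma lebesgue_scale c A : 0 < c -> measurable A ->
  leb ((fun y : RR => (c * y : RR)) @^-1` A) = (c^-1%:E * leb A)%E.
Proof.
move=> c0 mA; have mf : measurable_fun setT (fun y : RR => (c * y : RR)).
  by apply: measurable_funM.
have [nu0 nu0E _] := push_measure leb mf.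
pose nu := mscale (NngNum (ltW c0)) nu0.
have -> : leb A = nu A.
  apply: lebesgue_measure_unique => //= _ [[a b]] _ <-.
  rewrite /nu /mscale/= nu0E (_ : _ @^-1` _ = `](c^-1 * a : R), (c^-1 * b : R)]%classic); last first.
    by apply/seteqP; split=> x /=; rewrite !in_itv/= ltr_pdivrMl// ler_pdivlMl.
  rewrite lebesgue_measure_itv [X in (_ * X)%E](lebesgue_measure_itv `](c^-1 * a : R), (c^-1 * b : R)])/=.
  rewrite !lte_fin ltr_pM2l ?invr_gt0//; case: ifP => // _.
    by rewrite -!EFinB -EFinM; congr (_%:E); field; rewrite gt_eqF.
  by rewrite mule0.
by rewrite /nu /mscale/= nu0E muleA -EFinM mulVf ?gt_eqF// mul1e.
Qed.

Definition sheary c (p : plane (R := R)) : plane (R := R) := (p.1, p.2 + c * p.1).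
Definition shearx c (p : plane (R := R)) : plane (R := R) := (p.1 + c * p.2, p.2).
Definition dilate c (p : plane (R := R)) : plane (R := R) := (c * p.1, c * p.2).

Lemma measurable_sheary c : measurable_fun setT (sheary c).
Proof.
apply: measurable_fun_pair; first exact: measurable_fst.
by apply: measurable_funD; [exact: measurable_snd|apply: measurable_funM => //; exact: measurable_fst].
Qed.

Lemma measurable_shearx c : measurable_fun setT (shearx c).
Proof.
apply: measurable_fun_pair; last exact: measurable_snd.
by apply: measurable_funD; [exact: measurable_fst|apply: measurable_funM => //; exact: measurable_snd].
Qed.

Lemma measurable_dilate c : measurable_fun setT (dilate c).
Proof.
by apply: measurable_fun_pair; apply: measurable_funM.
Qed.

(** Fubini: a shear translates each section. *)
Lemma mu2_sheary c B : measurable B -> mu2 (sheary c @^-1` B) = mu2 B.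
Proof.
move=> mB; apply: eq_integral => x _ /=.
rewrite (_ : xsection _ x = (fun y : RR => (y + c * x : RR)) @^-1` (xsection B x)).
  by apply: lebesgue_shift; exact: measurable_xsection.
by rewrite !xsectionE.
Qed.

Lemma mu2_shearx c B : measurable B -> mu2 (shearx c @^-1` B) = mu2 B.
Proof.
move=> mB.
have sw X : measurable X -> mu2 X = (leb \x^ leb)%E X.
  by apply: product_measure_unique => *; exact: product_measure2E.
rewrite !sw//; last by rewrite -[_ @^-1` _]setTI; exact: measurable_shearx.
apply: eq_integral => y _ /=.
rewrite (_ : ysection _ y = (fun x : RR => (x + c * y : RR)) @^-1` (ysection B y)).
  by apply: lebesgue_shift; exact: measurable_ysection.
by rewrite !ysectionE.
Qed.

Lemma mu2_dilate c B : 0 < c -> measurable B ->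
  mu2 (dilate c @^-1` B) = ((c^-1 ^+ 2)%:E * mu2 B)%E.
Proof.
move=> c0 mB.
have [nu0 nu0E _] := push_measure mu2 (measurable_dilate c).
have c20 : 0 <= c ^+ 2 by apply: sqr_ge0.
pose nu := mscale (NngNum c20) nu0.
have nuE B0 : nu B0 = ((c ^+ 2)%:E * mu2 (dilate c @^-1` B0))%E by rewrite -nu0E.
have -> : mu2 B = nu B.
  apply: product_measure_unique mB => A1 A2 mA1 mA2.
  rewrite [LHS]nuE (_ : _ @^-1` _ = ((fun y : RR => (c * y : RR)) @^-1` A1) `*`
     ((fun y : RR => (c * y : RR)) @^-1` A2))//.
  have m1 (A : set RR) : measurable A -> measurable ((fun y : RR => (c * y : RR)) @^-1` A).
    by move=> mA; rewrite -[_ @^-1` _]setTI; apply: measurable_funM.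
  rewrite product_measure1E; try exact: m1.
  rewrite [X in (_ * (X * _))%E](lebesgue_scale c0 mA1).
  rewrite [X in (_ * (_ * X))%E](lebesgue_scale c0 mA2).
  rewrite muleACA [LHS]muleA -!EFinM (_ : c ^+ 2 * _ = 1) ?mul1e//.
  by field; rewrite gt_eqF.
rewrite [X in (_ * X)%E]nuE muleA -EFinM (_ : _ * _ = 1) ?mul1e//.
by field; rewrite gt_eqF.
Qed.

Definition rotate c s (p : plane (R := R)) : plane (R := R) :=
  (c * p.1 - s * p.2, s * p.1 + c * p.2).

(** Shears are area preserving by Fubini's theorem, hence so is the rotation. The
    factor [s / (1 + c)] degenerates at the half turn. *)
Lemma rotate_shear c s : c ^+ 2 + s ^+ 2 = 1 -> c != -1 ->
  rotate c s = shearx (- (s / (1 + c))) \o sheary s \o shearx (- (s / (1 + c))).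
Proof.
move=> cs c1; have c10 : 1 + c != 0 by rewrite addrC -[1]opprK subr_eq0.
set t := s / (1 + c).
have st : s * t = 1 - c.
  have s2 : s ^+ 2 = 1 - c ^+ 2 by rewrite -cs; ring.
  by rewrite /t mulrA -expr2 s2; field.
have ts : t * (1 + c) = s by rewrite /t divfK.
apply/funext => -[x y]; rewrite /rotate /shearx /sheary/=.
congr pair.
  have -> : x + - t * y + - t * (y + s * (x + - t * y)) =
    (1 - s * t) * x - (t * (1 + (1 - s * t))) * y by ring.
  by rewrite st (_ : 1 - (1 - c) = c) ?ts//; ring.
have -> : y + s * (x + - t * y) = s * x + (1 - s * t) * y by ring.
by rewrite st; congr (_ + _ * _); ring.
Qed.

Lemma measurable_rotate c s : measurable_fun setT (rotate c s).
Proof.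
apply: measurable_fun_pair.
  by apply: measurable_funB; apply: measurable_funM.
by apply: measurable_funD; apply: measurable_funM.
Qed.

Lemma mu2_rotate c s B : c ^+ 2 + s ^+ 2 = 1 -> c != -1 -> measurable B ->
  mu2 (rotate c s @^-1` B) = mu2 B.
Proof.
move=> cs c1 mB; rewrite (rotate_shear cs c1) !comp_preimage.
set X := shearx _; set Y := sheary _.
have mX Z : measurable Z -> measurable (X @^-1` Z).
  by move=> mZ; rewrite -[_ @^-1` _]setTI; exact: measurable_shearx.
have mY Z : measurable Z -> measurable (Y @^-1` Z).
  by move=> mZ; rewrite -[_ @^-1` _]setTI; exact: measurable_sheary.
by rewrite mu2_shearx ?mu2_sheary ?mu2_shearx//; [exact: mX|apply: mY; exact: mX].
Qed.

Definition sqnorm (p : plane (R := R)) : R := p.1 ^+ 2 + p.2 ^+ 2.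

Lemma sqnorm_ge0 p : 0 <= sqnorm p.
Proof. by rewrite addr_ge0// sqr_ge0. Qed.

Lemma measurable_sqnorm : measurable_fun setT sqnorm.
Proof.
by apply: measurable_funD; apply: measurable_funX.
Qed.

Lemma sqnormE p : cabs (to_complex p) ^+ 2 = sqnorm p.
Proof. by rewrite cabs_sqr. Qed.

Lemma disk2E : @disk2 R = sqnorm @^-1` `]-oo, 1[.
Proof.
apply/seteqP; split=> p /=; rewrite in_itv/= -sqnormE.
  by move/unit_diskE => h; rewrite exprn_ilt1// cabs_ge0.
by move=> h; apply/unit_diskE; rewrite -(@expr_lt1 _ 2)// cabs_ge0.
Qed.

Lemma measurable_sqnorm_lt t : measurable (sqnorm @^-1` `]-oo, t[).
Proof.
by rewrite -[_ @^-1` _]setTI; apply: measurable_sqnorm => //; exact: measurable_itv.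
Qed.

Lemma measurable_disk2 : measurable (@disk2 R).
Proof. by rewrite disk2E; exact: measurable_sqnorm_lt. Qed.

Lemma leb_cc (a b : R) : a < b -> leb `[a, b]%classic = (b - a)%:E.
Proof. by move=> ab; rewrite lebesgue_measure_itv/= lte_fin ab -EFinB. Qed.

Lemma mu2_disk_lty : (mu2 (@disk2 R) < +oo)%E.
Proof.
apply: (@le_lt_trans _ _ (mu2 (`[-1, 1]%classic `*` `[-1, 1]%classic))).
  apply: le_measure; rewrite ?inE//=.
  - exact: measurable_disk2.
  - by apply: measurableX.
  rewrite disk2E => -[x y]; rewrite /sqnorm/= !in_itv/= => h.
  by split; rewrite -ler_norml -(@expr_le1 _ 2)// real_normK ?num_real//;
    apply: le_trans (ltW h); rewrite ?lerDl ?lerDr sqr_ge0.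
rewrite product_measure1E//.
rewrite [X in (X * _)%E]leb_cc; last by lra.
rewrite [X in (_ * X)%E]leb_cc; last by lra.
by rewrite -EFinM ltry.
Qed.

Lemma mu2_disk_gt0 : (0 < mu2 (@disk2 R))%E.
Proof.
apply: (@lt_le_trans _ _ (mu2 (`[0, 1 / 2]%classic `*` `[0, 1 / 2]%classic))).
  rewrite product_measure1E//.
  rewrite [X in (X * _)%E]leb_cc; last by lra.
  rewrite [X in (_ * X)%E]leb_cc -?EFinM; last by lra.
  by rewrite lte_fin mulr_gt0//; lra.
apply: le_measure; rewrite ?inE//=.
- by apply: measurableX.
- exact: measurable_disk2.
rewrite disk2E => -[x y]; rewrite /sqnorm/= !in_itv/= => -[/andP[x0 x1] /andP[y0 y1]].
have : x ^+ 2 <= (1 / 2) ^+ 2 by rewrite lerXn2r ?nnegrE//; lra.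
have : y ^+ 2 <= (1 / 2) ^+ 2 by rewrite lerXn2r ?nnegrE//; lra.
by lra.
Qed.

(** The disk of radius [sqrt t] is a dilate of the unit disk. *)
Lemma mu2_sqnorm_lt t : 0 < t ->
  mu2 (sqnorm @^-1` `]-oo, t[) = (t%:E * mu2 (@disk2 R))%E.
Proof.
move=> t0; set r := Num.sqrt t; have r0 : 0 < r by rewrite sqrtr_gt0.
have -> : sqnorm @^-1` `]-oo, t[ = dilate r^-1 @^-1` (@disk2 R).
  rewrite disk2E; apply/seteqP; split=> p /=; rewrite !in_itv/= /sqnorm/= !exprMn -mulrDr;
    by rewrite exprVn sqr_sqrtr ?(ltW t0)// ltr_pdivrMl// mulr1.
rewrite mu2_dilate ?invr_gt0//; last exact: measurable_disk2.
by rewrite invrK sqr_sqrtr// ltW.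
Qed.

End PlaneMeasure.

(** * Integration of radial functions *)

Section RadialIntegration.
Variable R : realType.
Local Notation leb := (@lebesgue_measure R).
Local Notation mu2 := (@lebesgue_measure R \x @lebesgue_measure R)%E.
Local Notation RR := (measurableTypeR R).
Local Notation sqn := (@sqnorm R).

Definition disk_area : R := fine (mu2 (@disk2 R)).

Lemma disk_areaE : mu2 (@disk2 R) = disk_area%:E.
Proof. by rewrite fineK// ge0_fin_numE ?mu2_disk_lty// measure_ge0. Qed.

Lemma disk_area_gt0 : 0 < disk_area.
Proof. by rewrite -lte_fin -disk_areaE mu2_disk_gt0. Qed.

(** Dilations show that the image of the area measure of the disk under the
    squared modulus is a multiple of the length. *)
Lemma push_sqnorm (A : set RR) : measurable A -> A `<=` `[0, 1[%classic ->
  mu2 (sqn @^-1` A) = (disk_area%:E * leb A)%E.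
Proof.
move=> mA A01; have a0 := ltW disk_area_gt0.
have [nu1 nu1E _] := push_measure (T2 := RR) mu2 (@measurable_sqnorm R).
have mD : measurable (`[0, +oo[%classic : set RR) by exact: measurable_itv.
pose nu2 := mscale (NngNum a0) (mrestr leb mD).
have nu2E (B : set RR) : nu2 B = (disk_area%:E * leb (B `&` `[0%R, +oo[%classic))%E by [].
have mus : forall B, measurable B -> nu1 B = nu2 B.
  apply: (@measure_unique _ R RR (@RGenInftyO.G R) (fun n => `]-oo, n%:R[%classic)
    _ _ _ _ nu1 (nu2 : {measure set RR -> \bar R})).
  - exact: RGenInftyO.measurableE.
  - move=> _ _ [x ->] [y ->]; exists (Num.min x y).
    by apply/seteqP; split=> z /=; rewrite !in_itv/= lt_min => /andP.
  - by move=> n; exists n%:R.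
  - apply/seteqP; split=> // x _; exists (Num.truncn x).+1 => //=.
    by rewrite in_itv/=; exact: Num.Theory.truncnS_gt.
  - move=> _ [t ->]; rewrite nu1E [RHS]nu2E.
    have [t0|t0] := ltP 0 t.
      rewrite [LHS](mu2_sqnorm_lt t0) disk_areaE muleC; congr (_ * _)%E.
      rewrite (_ : _ `&` _ = `[(0 : R), (t : R)[%classic).
        by rewrite (lebesgue_measure_itv `[0, t[)/= lte_fin t0 -EFinB subr0.
      apply/seteqP; split=> x /=; rewrite !in_itv/= andbT.
        by move=> [-> ->].
      by move=> /andP[-> ->].
    rewrite (_ : _ @^-1` _ = set0); last first.
      apply/seteqP; split=> p //=; rewrite in_itv/= => h.
      by have := sqnorm_ge0 p; rewrite leNgt (lt_le_trans h).
    rewrite (_ : _ `&` _ = set0) ?measure0 ?mule0//.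
    apply/seteqP; split=> x //=; rewrite !in_itv/= andbT => -[h1 h2].
    by have := lt_le_trans h1 (le_trans t0 h2); rewrite ltxx.
  - move=> n; rewrite nu1E; case: n => [|n].
      rewrite (_ : _ @^-1` _ = set0) ?measure0//; apply/seteqP; split=> p //=.
      by rewrite in_itv/= ltNge sqnorm_ge0.
    have n0 : 0 < n.+1%:R :> R by rewrite ltr0Sn.
    by rewrite [X in (X < _)%E](mu2_sqnorm_lt n0) disk_areaE -EFinM ltry.
rewrite -nu1E mus// nu2E setIidl//.
by move=> x /A01 /=; rewrite !in_itv/= andbT => /andP[].
Qed.

(** Polar coordinates for radial functions, in the variable [|z| ^ 2]. *)
Lemma radial_integral (h : RR -> \bar R) : measurable_fun (`[0, 1[%classic : set RR) h ->
  (forall s, 0 <= s < 1 -> (0 <= h s)%E) ->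
  (\int[mu2]_(p in @disk2 R) h (sqn p) =
   disk_area%:E * \int[leb]_(s in `[0%R, 1%R[) h s)%E.
Proof.
move=> mh h0; have h0' s : (`[0, 1[%classic : set R) s -> (0 <= h s)%E.
  by rewrite /= in_itv; exact: h0.
have mD : measurable (`[0, 1[%classic : set RR) by exact: measurable_itv.
rewrite -(@ge0_integral_mscale _ _ _ leb _ mD (NngNum (ltW disk_area_gt0)) h mh h0').
have -> : @disk2 R = sqn @^-1` `[0, 1[%classic.
  by rewrite disk2E; apply/seteqP; split=> p /=; rewrite !in_itv/= ?sqnorm_ge0// => /andP[].
have h0'' : {in (`[0, 1[%classic : set RR), forall s, (0 <= h s)%E}.
  by move=> s; rewrite inE => /h0'.
have [nu nuE nuI] := push_measure (T2 := RR) mu2 (@measurable_sqnorm R).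
rewrite -[LHS](nuI _ _ mD mh h0'').
by apply: eq_measure_integral => A mA A01; rewrite nuE; exact: push_sqnorm.
Qed.

End RadialIntegration.

(** * Moments of the radial density *)

Section BetaMoments.
Variable R : realType.
Variable beta : R.
Hypothesis hbeta : -1 < beta.
Local Notation leb := (@lebesgue_measure R).
Local Notation RR := (measurableTypeR R).

Definition bdens k (s : R) : R := s ^+ k * (1 - s) `^ beta.

Let b1 : 0 < beta + 1. Proof. by rewrite -ltrBlDr sub0r. Qed.

Lemma is_derive_powR1m a (s : R) : s < 1 ->
  is_derive s 1 (fun x : R => (1 - x) `^ a) (- (a * (1 - s) `^ (a - 1))).
Proof.
move=> s1; have h : 0 < 1 - s by rewrite subr_gt0.
have d1 : is_derive s 1 (fun x : R => 1 - x) (-1).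
  by apply: (is_derive_eq (is_deriveB (is_derive_cst (1 : R) s 1) (is_derive_id s 1))); rewrite sub0r.
have := is_derive1_comp (f := fun x : R => x `^ a) (g := fun x : R => 1 - x) (is_derive1_powR a h) d1.
by rewrite mulrN1.
Qed.

Lemma bdens_continuous k (s : R) : s < 1 -> {for s, continuous (bdens k)}.
Proof.
move=> s1; apply: cvgM; first exact: exprn_continuous.
have [d _] := is_derive_powR1m beta s1.
have H : {for s, continuous (fun x : R => (1 - x) `^ beta)}.
  by apply: differentiable_continuous; apply/derivable1_diffP.
exact: H.
Qed.

Lemma bdens_integrable k (b : R) : b < 1 ->
  leb.-integrable `[0, b] (EFin \o bdens k).
Proof.
move=> b1'; apply: continuous_compact_integrable; first exact: segment_compact.
apply: continuous_in_subspaceT => s; rewrite inE/= in_itv/= => /andP[_ sb].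
exact/bdens_continuous/(le_lt_trans sb).
Qed.

Lemma bdens_FTC (F f : R -> R) (b : R) : 0 <= b < 1 ->
  (forall s : R, s < 1 -> is_derive s 1 F (f s)) -> (forall s : R, s < 1 -> {for s, continuous f}) ->
  \int[leb]_(s in `[0, b]) f s = F b - F 0.
Proof.
move=> /andP[b0 b1'] dF cf; move: b0; rewrite le_eqVlt => /predU1P[<-|b0].
  by rewrite set_itv1 Rintegral_set1 subrr.
have cF (s : R) : s < 1 -> {for s, continuous F}.
  move=> /dF[d _]; apply: differentiable_continuous; exact/derivable1_diffP.
rewrite /Rintegral (@continuous_FTC2 _ _ F)//.
- apply: continuous_in_subspaceT => s; rewrite inE/= in_itv/= => /andP[_ sb].
  exact/cf/(le_lt_trans sb).
- split.
  + move=> s; rewrite in_itv/= => /andP[_ sb].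
    by have [] := dF s (lt_trans sb b1').
  + by apply: cvg_at_right_filter; apply: cF.
  + by apply: cvg_at_left_filter; apply: cF.
- move=> s; rewrite in_itv/= => /andP[_ sb]; rewrite derive1E.
  by have [_ ->] := dF s (lt_trans sb b1').
Qed.

Definition bpart k b : R := \int[leb]_(s in `[0, b]) bdens k s.

Lemma powR1mS (s : R) : s < 1 -> (1 - s) `^ (beta + 1) = (1 - s) * (1 - s) `^ beta.
Proof.
move=> s1; have h : 0 < 1 - s by rewrite subr_gt0.
rewrite powRD ?powRr1 ?(ltW h) 1?mulrC//.
by rewrite (gt_eqF h) implybT.
Qed.

Lemma bpart0 b : 0 <= b < 1 -> (beta + 1) * bpart 0 b = 1 - (1 - b) `^ (beta + 1).
Proof.
move=> b01; have /andP[b0 b1'] := b01.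
rewrite /bpart -RintegralZl//; last exact: bdens_integrable.
have dF (s : R) : s < 1 -> is_derive s 1 (fun s => - (1 - s) `^ (beta + 1))
    ((beta + 1) * bdens 0 s).
  move=> s1; have := is_derive_powR1m (beta + 1) s1; rewrite addrK => d.
  by have := is_deriveN d; rewrite opprK /bdens expr0 mul1r.
have cf (s : R) : s < 1 -> {for s, continuous (fun s => (beta + 1) * bdens 0 s)}.
  by move=> s1; apply: cvgM; [exact: cvg_cst|exact: bdens_continuous].
by rewrite (bdens_FTC b01 dF cf) subr0 powR1 opprK addrC.
Qed.

(** Integration by parts: the right-hand side is the primitive
    [s ^ (k + 1) * (1 - s) ^ (beta + 1)] at [b]; it vanishes as [b] tends to [1]. *)
Lemma bpartS k b : 0 <= b < 1 ->
  k.+1%:R * bpart k b - (k%:R + beta + 2) * bpart k.+1 b =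
  b ^+ k.+1 * (1 - b) `^ (beta + 1).
Proof.
move=> b01; have /andP[b0 b1'] := b01.
have iZ (c : R) j : leb.-integrable `[0, b] (EFin \o (fun s => c * bdens j s)).
  by apply: eq_integrable (integrableZl _ c (bdens_integrable j b1')).
rewrite /bpart -!RintegralZl//; try exact: bdens_integrable.
rewrite -RintegralB//; try exact: iZ.
have dF (s : R) : s < 1 -> is_derive s 1 (fun s => s ^+ k.+1 * (1 - s) `^ (beta + 1))
    (k.+1%:R * bdens k s - (k%:R + beta + 2) * bdens k.+1 s).
  move=> s1; have d := is_derive_powR1m (beta + 1) s1; rewrite addrK in d.
  have d2 : is_derive s 1 (fun x : R => x ^+ k.+1) (k.+1%:R * s ^+ k).
    have E : (fun x : R => x ^+ k.+1) = (@idfun R) ^+ k.+1.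
      by apply/funext => x; rewrite fctE.
    by rewrite E; apply: is_derive_eq; rewrite /GRing.scale/= mulr1.
  apply: (is_derive_eq (is_deriveM d2 d)).
  by rewrite /GRing.scale/= powR1mS// /bdens !(exprS s) -natr1; ring.
have cf (s : R) : s < 1 ->
    {for s, continuous (fun s => k.+1%:R * bdens k s - (k%:R + beta + 2) * bdens k.+1 s)}.
  by move=> s1; apply: cvgB; apply: cvgM; try exact: cvg_cst; exact: bdens_continuous.
by rewrite (bdens_FTC b01 dF cf) expr0n/= mul0r subr0.
Qed.

Definition bmom k : \bar R := (\int[leb]_(s in `[0%R, 1%R[) (bdens k s)%:E)%E.

Lemma bdens_ge0 k s : 0 <= s -> 0 <= bdens k s.
Proof. by move=> s0; rewrite mulr_ge0 ?exprn_ge0 ?powR_ge0. Qed.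

Lemma measurable_bdens k : measurable_fun setT (bdens k : RR -> RR).
Proof.
apply: measurable_funM; first exact: exprn_measurable.
apply: (measurableT_comp (measurable_powR _)).
by apply: measurable_funB.
Qed.

Definition bn (n : nat) : R := 1 - n.+1%:R^-1.

Lemma bn01 n : 0 <= bn n < 1.
Proof.
apply/andP; split; first by rewrite subr_ge0 invf_le1// ler1n.
by rewrite gtrBl invr_gt0.
Qed.

Lemma bmom_lim k : (fun n => (bpart k (bn n))%:E) @ \oo --> bmom k.
Proof.
have U : (`[0, 1[%classic : set RR) = \bigcup_n `[0, bn n]%classic.
  apply/seteqP; split=> s /=; rewrite !in_itv/=.
    move=> /andP[s0 s1]; exists (Num.truncn (1 - s)^-1) => //=.
    rewrite in_itv/= s0/= /bn lerBrDr addrC -lerBrDr.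
    rewrite -[leRHS]invrK lef_pV2 ?posrE ?invr_gt0 ?subr_gt0//.
    exact/ltW/Num.Theory.truncnS_gt.
  move=> [n _]; rewrite /= in_itv/= => /andP[-> /le_lt_trans]; apply.
  by case/andP: (bn01 n).
rewrite /bmom U.
rewrite (_ : (fun n => _) = (fun n => \int[leb]_(s in `[0%R, bn n]) (bdens k s)%:E)%E); last first.
  apply/funext => n; rewrite /bpart /Rintegral fineK//.
  have /andP[_ h] := bn01 n.
  exact: (integrable_fin_num _ (bdens_integrable k h)).
apply: ge0_nondecreasing_set_cvg_integral.
- move=> i j ij; apply/subsetPset; apply: subset_itvl; rewrite bnd_simp /bn.
  by rewrite lerD2l lerN2 lef_pV2 ?posrE// ler_nat ltnS.
- by move=> i; exact: measurable_itv.
- by move=> i; apply/measurable_EFinP; apply: measurable_funTS; exact: measurable_bdens.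
- by move=> i s /=; rewrite in_itv/= => /andP[s0 _]; rewrite lee_fin bdens_ge0.
Qed.

Definition bmomr k := fine (bmom k).

Lemma bpart_le k n : bpart k (bn n) <= (beta + 1)^-1.
Proof.
have h := bn01 n; have /andP[b0 b1'] := h.
apply: (@le_trans _ _ (bpart 0 (bn n))).
  apply: le_Rintegral => //; try exact: bdens_integrable.
  move=> s /=; rewrite in_itv/= => /andP[s0 sb].
  rewrite /bdens expr0 ler_wpM2r ?powR_ge0// exprn_ile1//.
  exact/ltW/(le_lt_trans sb).
rewrite -[leRHS]mulr1 ler_pdivlMl// bpart0// gerBl; exact: powR_ge0.
Qed.

Lemma bmomE k : bmom k = (bmomr k)%:E.
Proof.
rewrite /bmomr fineK// ge0_fin_numE; last first.
  by apply: integral_ge0 => s /=; rewrite in_itv/= => /andP[s0 _]; rewrite lee_fin bdens_ge0.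
apply: (@le_lt_trans _ _ ((beta + 1)^-1)%:E); last exact: ltry.
apply: (cvge_to_le (@bmom_lim k)); near=> n.
by rewrite lee_fin bpart_le.
Unshelve. all: by end_near. Qed.

Lemma bmomr_lim k : (fun n => bpart k (bn n)) @ \oo --> bmomr k.
Proof.
by have := @bmom_lim k; rewrite bmomE => /fine_cvgP[].
Qed.

Lemma bn_powR_lim : (fun n => (1 - bn n) `^ (beta + 1)) @ \oo --> (0 : R).
Proof.
have b0 : 0 < beta + 1 := b1.
have /cvg_at_rightP/(_ (fun n => 1 - bn n)) := powR_cvg0 b0.
apply; split=> [n|]; first by rewrite /bn opprB addrC subrK invr_gt0.
rewrite (_ : (fun n => 1 - bn n) = harmonic); first exact: cvg_harmonic.
by apply/funext => n; rewrite /bn opprB addrC subrK.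
Qed.

Lemma bmomr0 : (beta + 1) * bmomr 0 = 1.
Proof.
have h1 : (fun n => (beta + 1) * bpart 0 (bn n)) @ \oo --> (beta + 1) * bmomr 0.
  by apply: cvgM (@bmomr_lim 0); exact: cvg_cst.
apply/esym; apply: (cvg_unique _ _ h1) => //.
rewrite (_ : (fun n => _) = (fun n => 1 - (1 - bn n) `^ (beta + 1))); last first.
  by apply/funext => n; rewrite bpart0 ?bn01.
have H : (fun n => 1 - (1 - bn n) `^ (beta + 1)) @ \oo --> (1 - 0 : R).
  by apply: cvgB; [exact: cvg_cst|exact: bn_powR_lim].
by rewrite subr0 in H.
Qed.

Lemma bmomrS k : (k%:R + beta + 2) * bmomr k.+1 = k.+1%:R * bmomr k.
Proof.
have h1 : (fun n => k.+1%:R * bpart k (bn n) - (k%:R + beta + 2) * bpart k.+1 (bn n))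
    @ \oo --> k.+1%:R * bmomr k - (k%:R + beta + 2) * bmomr k.+1.
  by apply: cvgB; apply: cvgM (@bmomr_lim _); exact: cvg_cst.
apply/eqP; rewrite eq_sym -subr_eq0; apply/eqP.
apply/esym; apply: (cvg_unique _ _ h1) => //.
rewrite (_ : (fun n => _) = (fun n => bn n ^+ k.+1 * (1 - bn n) `^ (beta + 1))); last first.
  by apply/funext => n; rewrite bpartS ?bn01.
apply: (@squeeze_cvgr _ _ _ _ (fun=> 0) (fun n => (1 - bn n) `^ (beta + 1))).
- near=> n; have /andP[h0 h2] := bn01 n.
  rewrite mulr_ge0 ?exprn_ge0 ?powR_ge0//= ler_piMl ?powR_ge0// exprn_ile1//.
  exact: ltW.
- exact: cvg_cst.
- exact: bn_powR_lim.
Unshelve. all: by end_near. Qed.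

Lemma bmomr_gt0 k : 0 < bmomr k.
Proof.
elim: k => [|k IH].
  by rewrite -(pmulr_rgt0 _ b1) bmomr0.
have h : 0 < k%:R + beta + 2.
  have := ler0n R k; have := b1; lra.
by rewrite -(pmulr_rgt0 _ h) bmomrS mulr_gt0.
Qed.

End BetaMoments.

(** * Weighted integrals over the disk *)

Section DiskIntegral.
Variable R : realType.
Variable beta : R.
Hypothesis hbeta : -1 < beta.
Local Notation C := (R[i]).
Local Notation mu2 := (@lebesgue_measure R \x @lebesgue_measure R)%E.
Local Notation toC := (@to_complex R).
Local Notation D2 := (@disk2 R).
Local Notation W := (bergman_weight beta).
Implicit Types (h f g : C -> C) (z : C) (p : plane (R := R)).

Let b1 : 0 < beta + 1. Proof. by rewrite -ltrBlDr sub0r. Qed.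
Let pi0 : 0 < pi :> R. Proof. exact: pi_gt0. Qed.

Lemma weightE p : W p = (beta + 1) / pi * bdens beta 0 (sqnorm p).
Proof. by rewrite /bergman_weight /bdens sqnormE expr0 mul1r mulrAC. Qed.

Lemma weight_ge0 p : 0 <= W p.
Proof.
by rewrite weightE mulr_ge0 ?divr_ge0 ?(ltW b1) ?(ltW pi0)// bdens_ge0 ?sqnorm_ge0.
Qed.

Lemma measurable_weight (D : set (plane (R := R))) : measurable_fun D W.
Proof.
apply: measurable_funTS.
rewrite (_ : W = (fun p => (beta + 1) / pi * bdens beta 0 (sqnorm p))); last first.
  by apply/funext => p; rewrite weightE.
apply: measurable_funM => //.
exact: (measurableT_comp (measurable_bdens beta 0) (@measurable_sqnorm R)).
Qed.

(** The squared norm of [z ^+ k], see [normsq_monom]. *)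
Definition omega k : R := (beta + 1) / pi * disk_area R * bmomr beta k.

Lemma omega_gt0 k : 0 < omega k.
Proof.
apply: mulr_gt0; last exact: bmomr_gt0.
by apply: mulr_gt0; [exact: divr_gt0|exact: disk_area_gt0].
Qed.

Lemma omegaS k : (k%:R + beta + 2) * omega k.+1 = k.+1%:R * omega k.
Proof. by rewrite /omega mulrCA bmomrS// mulrCA. Qed.

Lemma normsq_monom k : bergman_normsq beta (fun z => z ^+ k) = (omega k)%:E.
Proof.
rewrite /bergman_normsq.
have c0 : 0 <= (beta + 1) / pi by rewrite divr_ge0 ?(ltW b1) ?(ltW pi0).
rewrite (eq_integral (fun p => ((beta + 1) / pi * bdens beta k (sqnorm p))%:E)); last first.
  move=> p _; congr (_%:E); rewrite weightE /bdens cabsX -exprM mulnC exprM sqnormE.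
  by rewrite expr0 mul1r mulrCA.
rewrite (radial_integral (h := fun s => ((beta + 1) / pi * bdens beta k s)%:E)); last 2 first.
- apply/measurable_EFinP; apply: measurable_funTS; apply: measurable_funM => //.
  exact: measurable_bdens.
- by move=> s /andP[s0 _]; rewrite lee_fin mulr_ge0// bdens_ge0.
under eq_integral do rewrite EFinM.
rewrite ge0_integralZl//; last 2 first.
- by apply/measurable_EFinP; apply: measurable_funTS; exact: measurable_bdens.
- by move=> s /=; rewrite in_itv/= => /andP[s0 _]; rewrite lee_fin bdens_ge0.
have := bmomE hbeta k; rewrite /bmom => ->.
by rewrite -!EFinM; congr (_%:E); rewrite /omega; ring.
Qed.

Definition dmeas h := measurable_fun D2 (fun p => Re (h (toC p))) /\
  measurable_fun D2 (fun p => Im (h (toC p))).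

Lemma dmeas_cst z : dmeas (fun=> z). Proof. by split. Qed.

Lemma dmeas_id : dmeas (fun z => z).
Proof. by split; apply: measurable_funTS; [exact: measurable_fst|exact: measurable_snd]. Qed.

Lemma dmeasD f g : dmeas f -> dmeas g -> dmeas (fun z => f z + g z).
Proof.
move=> [f1 f2] [g1 g2]; split.
  by under eq_fun do rewrite ReD; exact: measurable_funD.
by under eq_fun do rewrite ImD; exact: measurable_funD.
Qed.

Lemma dmeasM f g : dmeas f -> dmeas g -> dmeas (fun z => f z * g z).
Proof.
move=> [f1 f2] [g1 g2]; split.
  by under eq_fun do rewrite ReM; apply: measurable_funB; exact: measurable_funM.
by under eq_fun do rewrite ImM; apply: measurable_funD; exact: measurable_funM.
Qed.

Lemma dmeas_conj f : dmeas f -> dmeas (fun z => (f z)^*%C).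
Proof.
move=> [f1 f2]; split.
  rewrite (_ : (fun p => _) = (fun p => Re (f (toC p))))//.
  by apply/funext => p; case: (f _).
rewrite (_ : (fun p => _) = (fun p => - Im (f (toC p)))); first exact: measurable_funN.
by apply/funext => p; case: (f _).
Qed.

Lemma dmeasX n : dmeas (fun z => z ^+ n).
Proof.
elim: n => [|n IH]; first exact: dmeas_cst.
by have := dmeasM dmeas_id IH; under eq_fun do rewrite -exprS.
Qed.

Lemma dmeas_poly a N : dmeas (poly_fun a N).
Proof.
elim: N => [|N IH]; first by rewrite poly_fun0; exact: dmeas_cst.
by rewrite poly_funS; apply: dmeasD IH _; apply: dmeasM (dmeas_cst _) (dmeasX _).
Qed.

Lemma ccvg_ReIm (u : nat -> C) l : ccvg u l ->
  (fun n => Re (u n)) @ \oo --> Re l /\ (fun n => Im (u n)) @ \oo --> Im l.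
Proof.
move=> /ccvg_eps H; split; apply/cvgrPdist_lt => e /H[N HN]; exists N => // n /= Nn;
  rewrite distrC; apply: le_lt_trans (HN n Nn).
  by rewrite -ReN -ReD; exact: cabs_Re.
by rewrite -ImN -ImD; exact: cabs_Im.
Qed.

(** A holomorphic function is a pointwise limit of polynomials. *)
Lemma dmeas_pseries a f : pseries_on_disk a f -> dmeas f.
Proof.
move=> H.
have cv p : D2 p -> ccvg (fun n => poly_fun a n (toC p)) (f (toC p)).
  by move=> /unit_diskE p1; exact: H p1.
split.
  apply: (measurable_fun_cvg (h := fun n p => Re (poly_fun a n (toC p)))).
    by move=> n; have [] := dmeas_poly a n.
  by move=> p /cv/ccvg_ReIm[].
apply: (measurable_fun_cvg (h := fun n p => Im (poly_fun a n (toC p)))).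
  by move=> n; have [] := dmeas_poly a n.
by move=> p /cv/ccvg_ReIm[].
Qed.

Lemma dmeas_holo f : holomorphic_on_disk f -> dmeas f.
Proof. by move=> /taylor[a /dmeas_pseries]. Qed.

Definition dintegrable h :=
  mu2.-integrable D2 (fun p => (Re (h (toC p)) * W p)%:E) /\
  mu2.-integrable D2 (fun p => (Im (h (toC p)) * W p)%:E).

Definition dint h : C :=
  (\int[mu2]_(p in D2) (Re (h (toC p)) * W p)) +i*
  (\int[mu2]_(p in D2) (Im (h (toC p)) * W p)).

Lemma bergman_innerE f g : bergman_inner beta f g = dint (fun z => f z * (g z)^*%C).
Proof. by []. Qed.

Lemma eq_dint f g : (forall z, cabs z < 1 -> f z = g z) -> dint f = dint g.
Proof.
move=> fg; congr Complex; apply: eq_Rintegral => p; rewrite inE => /unit_diskE p1;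
  by rewrite fg.
Qed.

Lemma dintegrable_le h (G : plane (R := R) -> R) : dmeas h ->
  mu2.-integrable D2 (EFin \o G) ->
  (forall p, D2 p -> cabs (h (toC p)) * W p <= G p) -> dintegrable h.
Proof.
move=> [h1 h2] iG hG.
have mW := measurable_weight (D := D2).
have md := @measurable_disk2 R.
have K (q : C -> R) : (forall z, `|q z| <= cabs z) ->
    measurable_fun D2 (fun p => q (h (toC p))) ->
    mu2.-integrable D2 (fun p => (q (h (toC p)) * W p)%:E).
  move=> qle mq; apply: le_integrable iG => //.
    by apply/measurable_EFinP; apply: measurable_funM.
  move=> p Dp; rewrite /= lee_fin normrM (ger0_norm (weight_ge0 p)).
  apply: le_trans (ler_norm _); apply: le_trans (hG p Dp).
  by rewrite ler_wpM2r ?weight_ge0.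
by split; apply: K => //; [exact: cabs_Re|exact: cabs_Im].
Qed.

Lemma disk_integrableZ (r : R) (q : plane (R := R) -> R) :
  mu2.-integrable D2 (EFin \o q) -> mu2.-integrable D2 (fun p => (r * q p)%:E).
Proof.
by move=> ih; apply: eq_integrable (integrableZl (@measurable_disk2 R) r ih);
  [exact: measurable_disk2|].
Qed.

Lemma disk_integrableD (q r : plane (R := R) -> R) :
  mu2.-integrable D2 (EFin \o q) -> mu2.-integrable D2 (EFin \o r) ->
  mu2.-integrable D2 (fun p => (q p + r p)%:E).
Proof.
by move=> iq ir; apply: eq_integrable (integrableD (@measurable_disk2 R) iq ir);
  [exact: measurable_disk2|].
Qed.

Lemma disk_integrableB (q r : plane (R := R) -> R) :
  mu2.-integrable D2 (EFin \o q) -> mu2.-integrable D2 (EFin \o r) ->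
  mu2.-integrable D2 (fun p => (q p - r p)%:E).
Proof.
by move=> iq ir; apply: eq_integrable (integrableB (@measurable_disk2 R) iq ir);
  [exact: measurable_disk2|].
Qed.

Lemma dintegrableZ z f : dintegrable f -> dintegrable (fun w => z * f w).
Proof.
have md := @measurable_disk2 R.
move=> [f1 f2].
split.
  apply: (eq_integrable _ (fun p => ((Re z * (Re (f (toC p)) * W p)) - (Im z * (Im (f (toC p)) * W p)))%:E)) => //.
    by move=> p _; congr (_%:E); rewrite ReM; ring.
  by apply: disk_integrableB; apply: disk_integrableZ.
apply: (eq_integrable _ (fun p => ((Re z * (Im (f (toC p)) * W p)) + (Im z * (Re (f (toC p)) * W p)))%:E)) => //.
  by move=> p _; congr (_%:E); rewrite ImM; ring.
by apply: disk_integrableD; apply: disk_integrableZ.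
Qed.

Lemma dintegrableD f g : dintegrable f -> dintegrable g -> dintegrable (fun w => f w + g w).
Proof.
have md := @measurable_disk2 R.
move=> [f1 f2] [g1 g2]; split.
  apply: (eq_integrable _ (fun p => (Re (f (toC p)) * W p + Re (g (toC p)) * W p)%:E)) => //.
    by move=> p _; congr (_%:E); rewrite ReD mulrDl.
  exact: disk_integrableD.
apply: (eq_integrable _ (fun p => (Im (f (toC p)) * W p + Im (g (toC p)) * W p)%:E)) => //.
  by move=> p _; congr (_%:E); rewrite ImD mulrDl.
exact: disk_integrableD.
Qed.

Lemma dintD f g : dintegrable f -> dintegrable g ->
  dint (fun w => f w + g w) = dint f + dint g.
Proof.
have md := @measurable_disk2 R.
move=> [f1 f2] [g1 g2]; apply/eqP; rewrite eq_complex/=; apply/andP; split; apply/eqP.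
  by rewrite -RintegralD//; apply: eq_Rintegral => p _; rewrite ReD mulrDl.
by rewrite -RintegralD//; apply: eq_Rintegral => p _; rewrite ImD mulrDl.
Qed.

Lemma dintZ z f : dintegrable f -> dint (fun w => z * f w) = z * dint f.
Proof.
have md := @measurable_disk2 R.
move=> [f1 f2]; case: z => x y.
apply/eqP; rewrite eq_complex/=; apply/andP; split; apply/eqP.
  rewrite -!RintegralZl// -RintegralB//; try by apply: disk_integrableZ.
  by apply: eq_Rintegral => p _; rewrite ReM/=; ring.
rewrite -!RintegralZl// -RintegralD//; try by apply: disk_integrableZ.
by apply: eq_Rintegral => p _; rewrite ImM/=; ring.
Qed.

Lemma dint_bound h (G : plane (R := R) -> R) : dintegrable h ->
  mu2.-integrable D2 (EFin \o G) ->
  (forall p, D2 p -> cabs (h (toC p)) * W p <= G p) ->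
  cabs (dint h) <= 2 * \int[mu2]_(p in D2) G p.
Proof.
have md := @measurable_disk2 R.
move=> [h1 h2] iG hG.
have K (q : C -> R) : (forall z, `|q z| <= cabs z) ->
    mu2.-integrable D2 (fun p => (q (h (toC p)) * W p)%:E) ->
    `|\int[mu2]_(p in D2) (q (h (toC p)) * W p)| <= \int[mu2]_(p in D2) G p.
  move=> qle iq; apply: le_trans (le_normr_Rintegral md iq) _.
  apply: le_Rintegral => //; first exact: integrable_norm.
  move=> p Dp; rewrite normrM (ger0_norm (weight_ge0 p)).
  by apply: le_trans (hG p Dp); rewrite ler_wpM2r ?weight_ge0.
apply: le_trans (cabs_le _) _; rewrite mulr_natl mulr2n /dint/=.
by apply: lerD; apply: K => //; [exact: cabs_Re|exact: cabs_Im].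
Qed.

Lemma dint_conj h : dintegrable h -> dint (fun z => (h z)^*%C) = (dint h)^*%C.
Proof.
have md := @measurable_disk2 R.
move=> [h1 h2]; rewrite /dint/=; congr Complex.
  by apply: eq_Rintegral => p _; case: (h _).
by rewrite -mulN1r -RintegralZl//; apply: eq_Rintegral => p _; case: (h _) => x y /=; ring.
Qed.

End DiskIntegral.

(** * Inner products with monomials *)

Section BergmanCoefficients.
Variable R : realType.
Variable beta : R.
Hypothesis hbeta : -1 < beta.
Local Notation C := (R[i]).
Local Notation mu2 := (@lebesgue_measure R \x @lebesgue_measure R)%E.
Local Notation P := (plane (R := R)).
Local Notation toC := (@to_complex R).
Local Notation D2 := (@disk2 R).
Local Notation W := (bergman_weight beta).
Local Notation dint := (dint beta).
Local Notation dintegrable := (dintegrable beta).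
Implicit Types (h f g : C -> C) (z : C) (p : P) (t c s : R).

Lemma ge0_rotate_integral c s (F : P -> \bar R) : c ^+ 2 + s ^+ 2 = 1 -> c != -1 ->
  measurable_fun setT F -> (forall p, (0 <= F p)%E) ->
  (\int[mu2]_p F (rotate c s p) = \int[mu2]_p F p)%E.
Proof.
move=> cs c1 mF F0.
have F0' : {in setT, forall p, (0 <= F p)%E} by move=> p _; exact: F0.
have [nu nuE nuI] := push_measure mu2 (@measurable_rotate R c s).
rewrite -[LHS](nuI _ _ measurableT mF F0').
by apply: eq_measure_integral => A mA _; rewrite nuE; exact: mu2_rotate.
Qed.

Lemma sqnorm_rotate c s p : c ^+ 2 + s ^+ 2 = 1 -> sqnorm (rotate c s p) = sqnorm p.
Proof.
move=> cs; rewrite /sqnorm/=.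
have -> : (c * p.1 - s * p.2) ^+ 2 + (s * p.1 + c * p.2) ^+ 2 =
  (c ^+ 2 + s ^+ 2) * (p.1 ^+ 2 + p.2 ^+ 2) by ring.
by rewrite cs mul1r.
Qed.

Lemma rotate_disk2 c s p : c ^+ 2 + s ^+ 2 = 1 -> (rotate c s p \in D2) = (p \in D2).
Proof.
move=> cs; rewrite disk2E; apply/idP/idP; rewrite !inE /= !in_itv/= sqnorm_rotate//.
Qed.

Lemma rotate_integral c s (F : P -> \bar R) : c ^+ 2 + s ^+ 2 = 1 -> c != -1 ->
  mu2.-integrable D2 F ->
  (\int[mu2]_(p in D2) F (rotate c s p) = \int[mu2]_(p in D2) F p)%E.
Proof.
move=> cs c1 iF; have md := @measurable_disk2 R.
have [mF _] := integrableP _ _ _ iF.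
have K (G : P -> \bar R) : measurable_fun D2 G -> (forall p, (0 <= G p)%E) ->
    (\int[mu2]_(p in D2) G (rotate c s p) = \int[mu2]_(p in D2) G p)%E.
  move=> mG G0; rewrite integral_mkcond [RHS]integral_mkcond.
  rewrite -[RHS](ge0_rotate_integral cs c1).
  - apply: eq_integral => p _; rewrite /patch rotate_disk2//.
  - by apply/(measurable_restrictT G md).
  - by move=> p; rewrite /patch; case: ifP.
rewrite integralE [RHS]integralE.
under eq_integral do rewrite -[(fun p => F (rotate c s p))]/(F \o rotate c s) funepos_comp.
rewrite (K _ (measurable_funepos mF)) ?(fun p => funepos_ge0 F p)//.
congr (_ - _)%E.
under eq_integral do rewrite -[(fun p => F (rotate c s p))]/(F \o rotate c s) funeneg_comp.
by rewrite (K _ (measurable_funeneg mF)).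
Qed.

Lemma to_complex_rotate c s p : toC (rotate c s p) = (c +i* s) * toC p.
Proof. by rewrite /to_complex/=; apply/eqP; rewrite eq_complex/= [s * _ + _]addrC !eqxx. Qed.

Lemma dint_rotate c s h : c ^+ 2 + s ^+ 2 = 1 -> c != -1 -> dintegrable h ->
  dint (fun z => h ((c +i* s) * z)) = dint h.
Proof.
move=> cs c1 [h1 h2].
have Wr p : W (rotate c s p) = W p.
  by rewrite /bergman_weight !sqnormE sqnorm_rotate.
rewrite /dint/=; congr Complex; rewrite /Rintegral; congr fine.
  rewrite -[RHS](rotate_integral cs c1 h1); apply: eq_integral => p _.
  by rewrite Wr to_complex_rotate.
rewrite -[RHS](rotate_integral cs c1 h2); apply: eq_integral => p _.
by rewrite Wr to_complex_rotate.
Qed.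

Lemma weight_integrable : mu2.-integrable D2 (EFin \o W).
Proof.
apply/integrableP; split; first by apply/measurable_EFinP; exact: measurable_weight.
rewrite (eq_integral (fun p => (cabs (toC p ^+ 0) ^+ 2 * W p)%:E)).
  by have := normsq_monom hbeta 0; rewrite /bergman_normsq => ->; rewrite ltry.
move=> p _; rewrite /= expr0 cabs1 expr1n mul1r ger0_norm// weight_ge0//.
Qed.

(** Truncation to a smaller disk, where power series converge uniformly. *)
Definition chi t z : C := if cabs z ^+ 2 < t then 1 else 0.

Lemma dmeas_chi t : dmeas (chi t).
Proof.
rewrite /chi; split.
  rewrite (_ : (fun p => _) = (\1_(@sqnorm R @^-1` `]-oo, t[) : P -> R)).
    by apply: measurable_funTS; apply: measurable_indic; exact: measurable_sqnorm_lt.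
  apply/funext => p; rewrite indicE sqnormE; case: ltP => h /=.
    by rewrite mem_set//= in_itv.
  by rewrite memNset//= in_itv/= ltNge h.
rewrite (_ : (fun p => _) = fun=> 0)//.
by apply/funext => p; case: ifP.
Qed.

Lemma chi_le1 t z : cabs (chi t z) <= 1.
Proof. by rewrite /chi; case: ifP; rewrite ?cabs1 ?cabs0. Qed.

Lemma dintegrable_bounded h (M : R) : dmeas h -> (forall z, cabs z < 1 -> cabs (h z) <= M) ->
  dintegrable h.
Proof.
move=> mh hM; apply: (dintegrable_le hbeta (G := fun p => M * W p)) => //.
  exact: disk_integrableZ weight_integrable.
by move=> p /unit_diskE p1; rewrite ler_wpM2r ?weight_ge0// hM.
Qed.

Lemma cabs_expr_le1 z k : cabs z < 1 -> cabs (z ^+ k) <= 1.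
Proof. by move=> z1; rewrite cabsX exprn_ile1 ?cabs_ge0// ltW. Qed.

Definition cmonom t j k z : C := chi t z * (z ^+ j * (z ^+ k)^*%C).

Lemma dmeas_cmonom t j k : dmeas (cmonom t j k).
Proof.
apply: dmeasM (dmeas_chi t) _; apply: dmeasM (dmeasX _ j) _.
exact: dmeas_conj (dmeasX _ k).
Qed.

Lemma dintegrable_cmonom t j k : dintegrable (cmonom t j k).
Proof.
apply: (@dintegrable_bounded _ 1); first exact: dmeas_cmonom.
move=> z z1; rewrite /cmonom !cabsM cabs_conj.
rewrite mulr_ile1 ?mulr_ge0 ?cabs_ge0 ?chi_le1//.
by rewrite mulr_ile1 ?cabs_ge0 ?cabs_expr_le1.
Qed.

(** For [m = |j - k|], the rotation by [pi / (2 m)] multiplies the integrand by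
    [i] or [- i] and preserves its integral. *)
Lemma cmonom_ortho t j k : j != k -> dint (cmonom t j k) = 0.
Proof.
move=> jk; pose m := ((j - k) + (k - j))%N.
have m0 : (0 < m)%N by rewrite /m addn_gt0 !subn_gt0 orbC -neq_ltn.
pose al : R := pi / 2 / m%:R.
have mR : 0 < m%:R :> R by rewrite ltr0n.
have al0 : 0 < al by rewrite !divr_gt0// pi_gt0.
have alle : al <= pi / 2.
  by rewrite ler_pdivrMr// ler_peMr ?divr_ge0 ?pi_ge0// ler1n.
have ca : 0 <= cos al.
  by apply: cos_ge0_pihalf; rewrite alle andbT (le_trans _ (ltW al0))// oppr_le0 divr_ge0 ?pi_ge0.
have cs : cos al ^+ 2 + sin al ^+ 2 = 1 by exact: cos2Dsin2.
have c1 : cos al != -1 by rewrite gt_eqF// (lt_le_trans _ ca)// ltrN10.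
have := dint_rotate cs c1 (dintegrable_cmonom t j k).
set u := cos al +i* sin al.
have uc : u = cis al by rewrite cisE.
have um : u ^+ m = 'i%C.
  have -> : u ^+ m = cis (al *+ m).
    by rewrite uc; elim: (m) => [|n IH]; rewrite ?expr0 ?mulr0n ?cis0// exprS IH mulrS cisD.
  have -> : al *+ m = pi / 2 by rewrite -[al *+ m]mulr_natr /al divfK// gt_eqF.
  by rewrite cisE cos_pihalf sin_pihalf.
have uu : u * u^*%C = 1 by rewrite mulcJ uc cabs_cis expr1n.
set v := u ^+ j * (u ^+ k)^*%C.
have E z : cmonom t j k (u * z) = v * cmonom t j k z.
  rewrite /cmonom /chi cabsM {1}uc cabs_cis mul1r !exprMn conjcM /v; ring.
have uun n : u ^+ n * (u ^+ n)^*%C = 1 by rewrite conjcX -exprMn uu expr1n.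
have v1 : v != 1.
  have [jk'|kj] := ltnP j k.
    have -> : v = ('i%C)^*%C.
      have kE : k = (j + m)%N.
        by rewrite /m (eqP (ltnW jk' : (j - k)%N == 0%N)) add0n subnKC// ltnW.
      by rewrite /v kE exprD conjcM mulrA uun mul1r um.
    by rewrite eq_complex/= eq_sym oner_eq0.
  have -> : v = 'i%C.
    have jE : j = (k + m)%N by rewrite /m (eqP (kj : (k - j)%N == 0%N)) addn0 subnKC.
    by rewrite /v jE exprD mulrAC uun mul1r um.
  by rewrite eq_complex/= eq_sym oner_eq0.
rewrite (_ : (fun z => _) = (fun z => v * cmonom t j k z)); last by apply/funext => z; exact: E.
rewrite dintZ; last exact: dintegrable_cmonom.
move/eqP; rewrite -subr_eq0 -{2}[dint _]mul1r -mulrBl mulf_eq0 subr_eq0 (negPf v1).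
by move=> /eqP.
Qed.

Lemma chi_small t z : 0 <= t -> chi t z != 0 -> cabs z <= Num.sqrt t.
Proof.
move=> t0; rewrite /chi; case: ifP => [h _|]; last by rewrite eqxx.
by rewrite -ler_sqr ?nnegrE ?cabs_ge0 ?sqrtr_ge0// sqr_sqrtr// ltW.
Qed.

(** On a smaller disk the Taylor series converges uniformly and can be
    integrated term by term. *)
Lemma trunc_coef a f t k : pseries_on_disk a f -> 0 <= t < 1 ->
  dintegrable (fun z => chi t z * (f z * (z ^+ k)^*%C)) /\
  dint (fun z => chi t z * (f z * (z ^+ k)^*%C)) = a k * dint (cmonom t k k).
Proof.
move=> Hf /andP[t0 t1]; set x := Num.sqrt t.
have x01 : 0 <= x < 1 by rewrite sqrtr_ge0 -sqrtr1 ltr_sqrt.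
have [M [y [y01 M0 HM]]] := pseries_tail Hf x01.
have /andP[y0 y1] := y01.
have bd g (B : R) : (forall z, cabs z <= x -> cabs (g z) <= B) -> 0 <= B ->
    forall z, cabs z < 1 -> cabs (chi t z * (g z * (z ^+ k)^*%C)) <= B.
  move=> gB B0 z z1; have [c0|c0] := eqVneq (chi t z) 0; first by rewrite c0 mul0r cabs0.
  have zx := chi_small t0 c0; rewrite !cabsM cabs_conj.
  apply: le_trans (ler_wpM2r _ (chi_le1 t z)) _; first by rewrite mulr_ge0 ?cabs_ge0.
  rewrite mul1r; apply: le_trans (ler_wpM2l (cabs_ge0 _) (cabs_expr_le1 k z1)) _.
  by rewrite mulr1 gB.
have md g : dmeas g -> dmeas (fun z => chi t z * (g z * (z ^+ k)^*%C)).
  by move=> mg; apply: dmeasM (dmeas_chi t) _; apply: dmeasM mg (dmeas_conj (dmeasX _ k)).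
have mf := dmeas_pseries Hf.
have i1 : dintegrable (fun z => chi t z * (f z * (z ^+ k)^*%C)).
  apply: (@dintegrable_bounded _ M); first exact: md.
  apply: bd => // z zx; have := HM 0%N z zx.
  by rewrite big_ord0 subr0 expr0 mulr1.
split => //.
have poly N : dintegrable (fun z => chi t z * (poly_fun a N z * (z ^+ k)^*%C)) /\
    dint (fun z => chi t z * (poly_fun a N z * (z ^+ k)^*%C)) =
    \sum_(j < N) a j * dint (cmonom t j k).
  elim: N => [|N [IH1 IH2]].
    have E0 : (fun z => chi t z * (poly_fun a 0 z * (z ^+ k)^*%C)) = (fun z => 0 * cmonom t 0 0 z).
      by rewrite poly_fun0; apply/funext => z; rewrite mul0r mulr0 mul0r.
    rewrite E0 big_ord0; split; first exact: dintegrableZ (dintegrable_cmonom _ _ _).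
    by rewrite dintZ ?mul0r//; exact: dintegrable_cmonom.
  have E1 : (fun z => chi t z * (poly_fun a N.+1 z * (z ^+ k)^*%C)) =
      (fun z => chi t z * (poly_fun a N z * (z ^+ k)^*%C) + a N * cmonom t N k z).
    by rewrite poly_funS; apply/funext => z; rewrite /cmonom; ring.
  have iN := dintegrableZ (a N) (dintegrable_cmonom t N k).
  rewrite E1; split; first exact: dintegrableD.
  by rewrite dintD// dintZ ?IH2 ?big_ord_recr//; exact: dintegrable_cmonom.
have est N : (k < N)%N ->
    cabs (dint (fun z => chi t z * (f z * (z ^+ k)^*%C)) - a k * dint (cmonom t k k)) <=
    2 * (M * y ^+ N * \int[mu2]_(p in D2) W p).
  move=> kN; have [p1 p2] := poly N.
  have -> : a k * dint (cmonom t k k) = dint (fun z => chi t z * (poly_fun a N z * (z ^+ k)^*%C)).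
    rewrite p2 (bigD1 (Ordinal kN))//= big1 ?addr0// => i ik.
    by rewrite cmonom_ortho ?mulr0.
  have -> : dint (fun z => chi t z * (f z * (z ^+ k)^*%C)) -
      dint (fun z => chi t z * (poly_fun a N z * (z ^+ k)^*%C)) =
      dint (fun z => chi t z * ((f z - poly_fun a N z) * (z ^+ k)^*%C)).
    rewrite -[X in _ - X]mul1r -mulNr -dintZ// -dintD//; last exact: dintegrableZ.
    by apply: (@eq_dint _ beta) => z _; ring.
  have B0 : 0 <= M * y ^+ N by rewrite mulr_ge0// exprn_ge0.
  have mr : dmeas (fun z => chi t z * ((f z - poly_fun a N z) * (z ^+ k)^*%C)).
    have := dmeasD mf (dmeasM (dmeas_cst (-1)) (dmeas_poly a N)).
    by under eq_fun do rewrite mulN1r; exact: md.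
  have br := bd _ _ (HM N) B0.
  rewrite -RintegralZl//; [|exact: measurable_disk2|exact: weight_integrable].
  apply: (dint_bound hbeta (G := fun p => M * y ^+ N * W p)).
  - by apply: (@dintegrable_bounded _ (M * y ^+ N)).
  - exact: disk_integrableZ weight_integrable.
  - by move=> p /unit_diskE p1'; rewrite ler_wpM2r ?weight_ge0// br.
apply/eqP; rewrite -subr_eq0 -cabs_eq0 eq_le cabs_ge0 andbT.
have cy : (fun N => 2 * (M * y ^+ N * \int[mu2]_(p in D2) W p)) @ \oo --> (0 : R).
  rewrite (_ : (fun N => _) = geometric (2 * (M * \int[mu2]_(p in D2) W p)) y).
    by apply: cvg_geometric; rewrite ger0_norm.
  by apply/funext => N; rewrite /geometric/=; ring.
apply: (cvgr_to_ge cy); near=> N; apply: est; near: N; exact: nbhs_infty_gt.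
Unshelve. all: by end_near. Qed.

(** Dominated convergence: each point of the disk is eventually inside the smaller
    disks. *)
Lemma dint_chi_lim h : dintegrable h -> dmeas h ->
  ccvg (fun n => dint (fun z => chi (bn R n) z * h z)) (dint h).
Proof.
move=> [h1 h2] [m1 m2]; have md := @measurable_disk2 R.
have near1 p : D2 p -> exists N, forall n, (N <= n)%N -> chi (bn R n) (toC p) = 1.
  move=> /unit_diskE p1; set q := cabs (toC p) ^+ 2.
  have q1 : q < 1 by rewrite exprn_ilt1// cabs_ge0.
  exists (Num.truncn (1 - q)^-1).+1 => n Nn; rewrite /chi -/q ifT// /bn ltrBrDr addrC -ltrBrDr.
  rewrite -[ltRHS]invrK ltf_pV2 ?posrE ?invr_gt0 ?subr_gt0//.
  apply: lt_trans (Num.Theory.truncnS_gt _) _; by rewrite ltr_nat ltnS.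
have K (q : C -> R) : (forall n z, q (chi (bn R n) z * h z) = Re (chi (bn R n) z) * q (h z)) ->
    mu2.-integrable D2 (fun p => (q (h (toC p)) * W p)%:E) ->
    measurable_fun D2 (fun p => q (h (toC p))) ->
    (fun n => \int[mu2]_(p in D2) (q (chi (bn R n) (toC p) * h (toC p)) * W p)) @ \oo -->
    \int[mu2]_(p in D2) (q (h (toC p)) * W p).
  move=> qM iq mq.
  have mW : measurable_fun D2 W by exact: measurable_weight.
  have [|||||i1 _ cv] := @dominated_convergence _ _ _ mu2 _ md
    (fun n p => (q (chi (bn R n) (toC p) * h (toC p)) * W p)%:E)
    (fun p => (q (h (toC p)) * W p)%:E) (fun p => `|(q (h (toC p)) * W p)%:E|%E).
  - move=> n; apply/measurable_EFinP; apply: measurable_funM => //.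
    under eq_fun do rewrite qM; apply: measurable_funM => //.
    by have [] := dmeas_chi (bn R n).
  - by apply/measurable_EFinP; apply: measurable_funM.
  - apply: aeW => p Dp; have [N HN] := near1 p Dp.
    apply: cvg_near_cst; exists N => // n Nn.
    by rewrite HN// mul1r.
  - exact: integrable_abse.
  - apply: aeW => p n Dp; rewrite qM /= lee_fin !normrM.
    rewrite -!mulrA ler_piMl ?mulr_ge0//.
    by apply: le_trans (cabs_Re _) (chi_le1 _ _).
  move: cv; have -> : (\int[mu2]_(p in D2) (q (h (toC p)) * W p)%:E)%E =
      (\int[mu2]_(p in D2) (q (h (toC p)) * W p))%:E.
    by rewrite /Rintegral fineK//; exact: integrable_fin_num.
  by move=> /fine_cvgP[].
have ci n z : Im (chi (bn R n) z) = 0 by rewrite /chi; case: ifP.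
apply/ccvg_eps => e e0; have e2 : 0 < e / 2 by rewrite divr_gt0.
have /cvgrPdist_lt/(_ _ e2)[N1 _ H1] : (fun n => Re (dint (fun z => chi (bn R n) z * h z))) @ \oo --> Re (dint h).
  by apply: (K (@complex.Re R)) => // n z; rewrite ReM ci mul0r subr0.
have /cvgrPdist_lt/(_ _ e2)[N2 _ H2] : (fun n => Im (dint (fun z => chi (bn R n) z * h z))) @ \oo --> Im (dint h).
  by apply: (K (@complex.Im R)) => // n z; rewrite ImM ci mul0r addr0.
exists (maxn N1 N2) => n; rewrite geq_max => /andP[/H1 n1 /H2 n2].
apply: le_lt_trans (cabs_le _) _; rewrite (splitr e) ReD ImD ReN ImN.
by rewrite ltrD// distrC.
Qed.

Definition sq f p : R := cabs (f (toC p)) ^+ 2 * W p.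

Lemma sq_ge0 f p : 0 <= sq f p.
Proof. by rewrite mulr_ge0 ?exprn_ge0 ?cabs_ge0 ?weight_ge0. Qed.

Lemma measurable_sq f : dmeas f -> measurable_fun D2 (sq f).
Proof.
move=> [f1 f2]; apply: measurable_funM; last exact: measurable_weight.
under eq_fun do rewrite cabs_sqr.
by apply: measurable_funD; apply: measurable_funX.
Qed.

Definition nsq f : R := fine (bergman_normsq beta f).

Lemma bergmanP f : bergman beta f <->
  holomorphic_on_disk f /\ mu2.-integrable D2 (EFin \o sq f).
Proof.
split=> -[hf H]; split => //.
  have ms := measurable_sq (dmeas_holo hf).
  apply/integrableP; split; first by apply/measurable_EFinP.
  rewrite (eq_integral (fun p => (sq f p)%:E)) => // p _.
  by rewrite /= ger0_norm// sq_ge0.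
have /integrableP[_] := H; apply: le_lt_trans; rewrite /bergman_normsq.
rewrite (eq_integral (fun p => `|(EFin \o sq f) p|%E)) => // p _.
by rewrite /= ger0_norm// sq_ge0.
Qed.

Lemma nsq_int f : nsq f = \int[mu2]_(p in D2) sq f p. Proof. by []. Qed.

Lemma nsq_ge0 f : 0 <= nsq f.
Proof. by rewrite nsq_int; apply: Rintegral_ge0 => p _; exact: sq_ge0. Qed.

Lemma cabs_mul_le f g p (e : R) : 0 < e ->
  cabs (f (toC p) * (g (toC p))^*%C) * W p <= e^-1 * sq f p + e * sq g p.
Proof.
move=> e0; rewrite cabsM cabs_conj /sq.
have w0 := weight_ge0 hbeta p.
have a0 := cabs_ge0 (f (toC p)); have b0 := cabs_ge0 (g (toC p)).
move: (W p) (cabs (f (toC p))) (cabs (g (toC p))) w0 a0 b0 => w a b w0 a0 b0.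
have -> : e^-1 * (a ^+ 2 * w) + e * (b ^+ 2 * w) = (e^-1 * a ^+ 2 + e * b ^+ 2) * w by ring.
rewrite ler_wpM2r//.
rewrite -(ler_pM2l e0).
have -> : e * (e^-1 * a ^+ 2 + e * b ^+ 2) = a ^+ 2 + (e * b) ^+ 2.
  by field; rewrite gt_eqF.
have -> : e * (a * b) = a * (e * b) by ring.
have eb0 : 0 <= a * (e * b) by rewrite !mulr_ge0// ltW.
have h := sqr_ge0 (a - e * b); rewrite sqrrB -mulr_natl in h.
move: (a ^+ 2) ((e * b) ^+ 2) (a * (e * b)) eb0 h => A B D eb0 h.
by lra.
Qed.

Lemma bergman_dintegrable f g : bergman beta f -> bergman beta g ->
  dintegrable (fun z => f z * (g z)^*%C).
Proof.
move=> /bergmanP[hf i1] /bergmanP[hg i2].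
apply: (dintegrable_le hbeta (G := fun p => 1^-1 * sq f p + 1 * sq g p)).
- by apply: dmeasM; [exact: dmeas_holo|exact: dmeas_conj (dmeas_holo hg)].
- by apply: disk_integrableD; apply: disk_integrableZ.
- by move=> p _; apply: cabs_mul_le.
Qed.

(** A substitute for the Cauchy-Schwarz inequality: the arithmetic-geometric mean
    inequality under the integral, with a free parameter [e]. *)
Lemma inner_bound f g (e : R) : 0 < e -> bergman beta f -> bergman beta g ->
  cabs (bergman_inner beta f g) <= 2 * (e^-1 * nsq f + e * nsq g).
Proof.
move=> e0 bf bg; have [_ i1] := (bergmanP f).1 bf; have [_ i2] := (bergmanP g).1 bg.
have md := @measurable_disk2 R.
rewrite !nsq_int -!RintegralZl// -RintegralD//; try exact: disk_integrableZ.
rewrite bergman_innerE; apply: dint_bound => //.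
- exact: bergman_dintegrable.
- by apply: disk_integrableD; apply: disk_integrableZ.
- by move=> p _; exact: cabs_mul_le.
Qed.

Lemma holoD f g : holomorphic_on_disk f -> holomorphic_on_disk g ->
  holomorphic_on_disk (fun z => f z + g z).
Proof.
by move=> /taylor[a Ha] /taylor[b Hb]; exact: pseries_holo (pseriesD Ha Hb).
Qed.

Lemma holoZ (c : C) f : holomorphic_on_disk f -> holomorphic_on_disk (fun z => c * f z).
Proof. by move=> /taylor[a Ha]; exact: pseries_holo (pseriesZ c Ha). Qed.

Lemma bergmanZ (c : C) f : bergman beta f -> bergman beta (fun z => c * f z).
Proof.
move=> /bergmanP[hf i1]; apply/bergmanP; split; first exact: holoZ.
have := disk_integrableZ (cabs c ^+ 2) i1; apply: eq_integrable; first exact: measurable_disk2.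
move=> p _; rewrite /= /sq cabsM exprMn; congr (_%:E).
by move: (W p) => w; ring.
Qed.

Lemma bergmanD f g : bergman beta f -> bergman beta g -> bergman beta (fun z => f z + g z).
Proof.
move=> /bergmanP[hf i1] /bergmanP[hg i2]; apply/bergmanP; split; first exact: holoD.
have i3 : mu2.-integrable D2 (fun p => (2 * sq f p + 2 * sq g p)%:E).
  by apply: disk_integrableD; apply: disk_integrableZ.
apply: le_integrable i3; first exact: measurable_disk2.
  have ms := measurable_sq (dmeas_holo (holoD hf hg)).
  by apply/measurable_EFinP.
move=> p _; rewrite /= lee_fin ger0_norm ?sq_ge0//; apply: le_trans (ler_norm _).
rewrite /sq; have := weight_ge0 hbeta p; move: (W p) => w w0.
rewrite [leRHS](_ : _ = (2 * cabs (f (toC p)) ^+ 2 + 2 * cabs (g (toC p)) ^+ 2) * w); last by ring.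
rewrite ler_wpM2r//.
apply: (@le_trans _ _ ((cabs (f (toC p)) + cabs (g (toC p))) ^+ 2)).
  by rewrite lerXn2r ?nnegrE ?addr_ge0 ?cabs_ge0// cabsD.
move: (cabs (f (toC p))) (cabs (g (toC p))) => A B.
by rewrite -subr_ge0 (_ : _ - _ = (A - B) ^+ 2) ?sqr_ge0//; ring.
Qed.

Lemma bergman_monom k : bergman beta (fun z => z ^+ k).
Proof.
split; first exact: pseries_holo (@pseries_monom R k).
by rewrite normsq_monom// ltry.
Qed.

Lemma eq_inner f1 f2 g1 g2 : (forall z, cabs z < 1 -> f1 z = f2 z) ->
  (forall z, cabs z < 1 -> g1 z = g2 z) ->
  bergman_inner beta f1 g1 = bergman_inner beta f2 g2.
Proof. by move=> e1 e2; rewrite !bergman_innerE; apply: (@eq_dint _ beta) => z z1; rewrite e1// e2. Qed.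

Lemma innerD f1 f2 g : bergman beta f1 -> bergman beta f2 -> bergman beta g ->
  bergman_inner beta (fun z => f1 z + f2 z) g =
  bergman_inner beta f1 g + bergman_inner beta f2 g.
Proof.
move=> b1 b2 bg; rewrite !bergman_innerE -dintD; try exact: bergman_dintegrable.
by apply: (@eq_dint _ beta) => z _; rewrite mulrDl.
Qed.

Lemma innerZ (c : C) f g : bergman beta f -> bergman beta g ->
  bergman_inner beta (fun z => c * f z) g = c * bergman_inner beta f g.
Proof.
move=> bf bg; rewrite !bergman_innerE -dintZ; last exact: bergman_dintegrable.
by apply: (@eq_dint _ beta) => z _; rewrite mulrA.
Qed.

Lemma innerC f g : bergman beta f -> bergman beta g ->
  bergman_inner beta g f = (bergman_inner beta f g)^*%C.
Proof.
move=> bf bg; rewrite !bergman_innerE -dint_conj; last exact: bergman_dintegrable.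
by apply: (@eq_dint _ beta) => z _; rewrite conjcM conjcK mulrC.
Qed.

Lemma inner_nsq f : bergman beta f -> bergman_inner beta f f = (nsq f)%:C.
Proof.
move=> bf; apply/eqP; rewrite eq_complex/=; apply/andP; split; apply/eqP.
  rewrite nsq_int; apply: eq_Rintegral => p _; rewrite /sq cabs_sqr.
  by case: (f _) => x y /=; ring.
have -> : 0 = \int[mu2]_(p in D2) (0 : R) by rewrite Rintegral_cst ?mul0r//; exact: measurable_disk2.
by apply: eq_Rintegral => p _; case: (f _) => x y /=; ring.
Qed.

(** On the truncated disks only the [k]-th Taylor coefficient survives, by
    [trunc_coef]. The same holds for [z ^+ k] itself, so the limit of the
    remaining factor is its squared norm. *)
Lemma inner_monom a f k : bergman beta f -> pseries_on_disk a f ->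
  bergman_inner beta f (fun z => z ^+ k) = a k * (omega beta k)%:C.
Proof.
move=> bf Hf; have bk := bergman_monom k; have Hk := @pseries_monom R k.
have L g b : bergman beta g -> pseries_on_disk b g ->
    ccvg (fun n => b k * dint (cmonom (bn R n) k k)) (bergman_inner beta g (fun z => z ^+ k)).
  move=> bg Hg; rewrite bergman_innerE.
  apply: (ccvg_near (N := 0%N)) (dint_chi_lim (bergman_dintegrable bg bk) _) => [n _|].
    by have [_ ->] := trunc_coef k Hg (bn01 R n).
  apply: dmeasM; first exact: dmeas_pseries Hg.
  exact: dmeas_conj (dmeasX _ k).
have Lf := L _ _ bf Hf; have := L _ _ bk Hk; rewrite eqxx.
rewrite inner_nsq//.
have -> : nsq (fun z => z ^+ k) = omega beta k by rewrite /nsq normsq_monom.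
move=> /(ccvgZ (a k)) Lk; apply: ccvg_unique Lf _.
by apply: (ccvg_near (N := 0%N)) Lk => n _; rewrite mul1r.
Qed.


End BergmanCoefficients.

(** * Density of polynomials *)

Section BergmanDensity.
Variable R : realType.
Variable beta : R.
Hypothesis hbeta : -1 < beta.
Local Notation C := (R[i]).
Local Notation mu2 := (@lebesgue_measure R \x @lebesgue_measure R)%E.
Local Notation D2 := (@disk2 R).
Local Notation nsq := (nsq beta).
Local Notation omega := (omega beta).
Implicit Types (h f g : C -> C) (z : C) (a b : nat -> C).

Lemma bergman_poly a N : bergman beta (poly_fun a N).
Proof.
elim: N => [|N IH].
  have -> : poly_fun a 0 = (fun z => 0 * z ^+ 0).
    by rewrite poly_fun0; apply/funext => z; rewrite mul0r.
  exact/bergmanZ/bergman_monom.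
by rewrite poly_funS; apply: bergmanD => //; apply/bergmanZ/bergman_monom.
Qed.

Definition taylor_rem a f N z : C := f z - poly_fun a N z.

Lemma pseries_rem a f N : pseries_on_disk a f ->
  pseries_on_disk (fun k => if (k < N)%N then 0 else a k) (taylor_rem a f N).
Proof.
move=> Hf; have := pseriesD Hf (pseriesZ (-1) (pseries_poly a N)).
rewrite (_ : (fun n => _) = (fun k => if (k < N)%N then 0 else a k)); last first.
  by apply/funext => k; case: ifP => _; rewrite ?mulr0 ?addr0// mulN1r subrr.
by apply: eq_pseries => z _; rewrite mulN1r.
Qed.

Lemma bergman_rem a f N : bergman beta f -> bergman beta (taylor_rem a f N).
Proof.
move=> bf; have -> : taylor_rem a f N = (fun z => f z + (-1) * poly_fun a N z).
  by apply/funext => z; rewrite mulN1r.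
by apply: bergmanD => //; apply/bergmanZ/bergman_poly.
Qed.

Lemma taylor_rem0 a f : taylor_rem a f 0 = f.
Proof. by apply/funext => z; rewrite /taylor_rem poly_fun0 subr0. Qed.

Lemma taylor_remS a f N :
  taylor_rem a f N.+1 = (fun z => taylor_rem a f N z + (- a N) * z ^+ N).
Proof.
by apply/funext => z; rewrite /taylor_rem poly_funS opprD addrA mulNr.
Qed.

(** Pythagoras: the difference is orthogonal to [z ^+ k]. *)
Lemma nsq_sub_monom b h k : bergman beta h -> pseries_on_disk b h ->
  nsq (fun z => h z + (- b k) * z ^+ k) = nsq h - cabs (b k) ^+ 2 * omega k.
Proof.
move=> bh Hh; have bk := bergman_monom hbeta k.
have bm := bergmanZ hbeta (- b k) bk; set g := (fun z => h z + _).
have bg : bergman beta g by exact: bergmanD.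
have gk : bergman_inner beta g (fun z => z ^+ k) = 0.
  have Hg := pseriesD Hh (pseriesZ (- b k) (@pseries_monom R k)).
  by rewrite (inner_monom hbeta k bg Hg) eqxx mulr1 subrr mul0r.
have gh : bergman_inner beta g h = (nsq h - cabs (b k) ^+ 2 * omega k)%:C.
  rewrite innerD// innerZ// inner_nsq//.
  rewrite [bergman_inner beta (fun z => z ^+ k) h](innerC hbeta bh bk).
  rewrite (inner_monom hbeta k bh Hh) conjcM conjcR mulrA mulNr mulcJ.
  by rewrite mulNr [RHS]rmorphB [X in _ = _ - X]rmorphM.
apply: (@complexI R); rewrite -gh -inner_nsq//.
rewrite {1}/g innerD// innerZ// [bergman_inner beta (fun z => z ^+ k) g](innerC hbeta bg bk).
by rewrite gk rmorph0 mulr0 addr0 (innerC hbeta bg bh) gh conjcR.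
Qed.

Lemma nsq_rem a f N : bergman beta f -> pseries_on_disk a f ->
  nsq (taylor_rem a f N) = nsq f - \sum_(k < N) cabs (a k) ^+ 2 * omega k.
Proof.
move=> bf Hf; elim: N => [|N IH]; first by rewrite taylor_rem0 big_ord0 subr0.
have := nsq_sub_monom N (bergman_rem a N bf) (pseries_rem N Hf).
rewrite ltnn -taylor_remS => ->; rewrite IH big_ord_recr/=.
by rewrite opprD addrA.
Qed.

Lemma nsq_eq f g : (forall z, cabs z < 1 -> f z = g z) -> nsq f = nsq g.
Proof.
move=> fg; rewrite !nsq_int; apply: eq_Rintegral => p; rewrite inE => /unit_diskE p1.
by rewrite /sq fg.
Qed.

Lemma nsq0 : nsq (fun=> 0 : C) = 0.
Proof.
rewrite nsq_int; have -> : 0 = \int[mu2]_(p in D2) (0 : R).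
  by rewrite Rintegral_cst ?mul0r//; exact: measurable_disk2.
by apply: eq_Rintegral => p _; rewrite /sq cabs0 expr0n mul0r.
Qed.

Lemma nsq_poly a N : nsq (poly_fun a N) = \sum_(k < N) cabs (a k) ^+ 2 * omega k.
Proof.
have := nsq_rem N (bergman_poly a N) (pseries_poly a N).
set b := (fun k => if _ then _ else _).
rewrite (@nsq_eq _ (fun=> 0 : C)).
  rewrite nsq0 => /eqP; rewrite eq_sym subr_eq0 => /eqP ->.
  by apply: eq_bigr => i _; rewrite /b ltn_ord.
move=> z _; rewrite /taylor_rem; apply/eqP; rewrite subr_eq0; apply/eqP.
by apply: eq_bigr => i _; rewrite /b ltn_ord.
Qed.

(** Fatou's lemma turns a Cauchy estimate on Taylor polynomials into an estimate on
    the remainder, in place of an appeal to completeness. *)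
Lemma nsq_fatou (G : nat -> C -> C) h (e : R) (N : nat) :
  (forall n, bergman beta (G n)) -> bergman beta h ->
  (forall z, cabs z < 1 -> ccvg (fun n => G n z) (h z)) ->
  (forall n, (N <= n)%N -> nsq (G n) <= e) -> nsq h <= e.
Proof.
move=> bG bh cv le; have md := @measurable_disk2 R.
have [_ ih] := (bergmanP hbeta h).1 bh.
have iG n := ((bergmanP hbeta (G n)).1 (bG n)).2.
have fE g : mu2.-integrable D2 (EFin \o sq beta g) ->
    (\int[mu2]_(p in D2) (sq beta g p)%:E)%E = (nsq g)%:E.
  by move=> ig; rewrite nsq_int /Rintegral fineK//; exact: integrable_fin_num.
have mG n : measurable_fun D2 (fun p => (sq beta (G (n + N)%N) p)%:E).
  by apply/measurable_EFinP; apply: measurable_sq; apply: dmeas_holo; exact: (bG _).1.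
have G0 n p : D2 p -> (0 <= (sq beta (G (n + N)%N) p)%:E)%E by rewrite lee_fin sq_ge0.
have := fatou mu2 md mG G0.
rewrite (eq_integral (fun p => (sq beta h p)%:E)); last first.
  move=> p; rewrite inE => /unit_diskE p1.
  have cp : (fun n => (sq beta (G (n + N)%N) p)%:E) @ \oo --> (sq beta h p)%:E.
    apply: cvg_EFin; first by near=> n.
    have [c1 c2] := ccvg_ReIm (cv _ p1).
    rewrite (_ : fine \o _ = (fun n => sq beta (G (n + N)%N) p)) //.
    rewrite (cvg_shiftn N (fun n => sq beta (G n) p) _).
    rewrite /sq; apply: cvgMl.
    rewrite cabs_sqr; under eq_fun do rewrite cabs_sqr !expr2.
    by rewrite !expr2; apply: cvgD; apply: cvgM.
  by have [-> _] := cvg_limn_einf_sup cp.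
rewrite (fE _ ih) => H; rewrite -lee_fin; apply: le_trans H _.
rewrite limn_einf_lim; apply: lime_le; first exact: is_cvg_einfs.
near=> n; apply: (@le_trans _ _ (\int[mu2]_(p in D2) (sq beta (G (n + N)%N) p)%:E)%E).
  by apply: ereal_inf_lbound; exists n => /=.
by rewrite (fE _ (iG _)) lee_fin le// leq_addl.
Unshelve. all: by end_near. Qed.

(** By Pythagoras the squared norm of a block of the Taylor series is a block of
    the series of the [|a_k| ^ 2 * omega k], whose partial sums are bounded by the
    squared norm of [f]. *)
Lemma nsq_rem_cvg a f : bergman beta f -> pseries_on_disk a f ->
  forall e : R, 0 < e -> exists N, forall n, (N <= n)%N -> nsq (taylor_rem a f n) <= e.
Proof.
move=> bf Hf e e0.
pose S N := \sum_(k < N) cabs (a k) ^+ 2 * omega k.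
have t0 k : 0 <= cabs (a k) ^+ 2 * omega k.
  by rewrite mulr_ge0 ?exprn_ge0 ?cabs_ge0// ltW// omega_gt0.
have SS N M : (N <= M)%N -> S N <= S M.
  move=> /subnKC <-; rewrite /S big_split_ord/= lerDl; apply: sumr_ge0 => i _; exact: t0.
have Sb N : S N <= nsq f.
  by rewrite -subr_ge0 -nsq_rem//; exact: nsq_ge0.
have [N HN] : exists N, forall n, (N <= n)%N -> S n - S N <= e.
  have cS : cvgn S.
    apply: nondecreasing_is_cvgn; first by move=> i j; exact: SS.
    by exists (nsq f) => _ [N _ <-]; exact: Sb.
  have /cvgrPdist_le/(_ _ e0)[N _ HN] := cS.
  exists N => n Nn; have := HN N (leqnn N); rewrite /=.
  have := nondecreasing_cvgn_le SS cS n; have := nondecreasing_cvgn_le SS cS N.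
  move: (limn S) => L A B; rewrite ger0_norm ?subr_ge0// => D.
  by lra.
exists N => n Nn.
pose b k := if (k < n)%N then 0 else a k.
apply: (@nsq_fatou (fun M => poly_fun b M) _ _ n) => [M||z z1|M nM].
- exact: bergman_poly.
- exact: bergman_rem.
- exact: (pseries_rem n Hf).
- rewrite nsq_poly; apply: le_trans (HN M (leq_trans Nn nM)).
  apply: (@le_trans _ _ (S M - S n)); last by rewrite lerB// SS.
  rewrite /S -(subnKC nM) !big_split_ord/= addrAC subrr add0r big1 ?add0r.
    by apply: ler_sum => i _; rewrite /b ltnNge leq_addr.
  by move=> i _; rewrite /b ltn_ord cabs0 expr0n mul0r.
Qed.

Lemma bounded_nsq L : bergman_bounded beta L -> exists2 K : R, 0 <= K &
  forall f, bergman beta f -> nsq (L f) <= K * nsq f.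
Proof.
move=> [bL [K HK]]; exists (K ^+ 2); first exact: sqr_ge0.
move=> f bf; have := HK f bf; rewrite /bergman_norm -!/(nsq _) => H.
have n1 := nsq_ge0 hbeta (L f); have n2 := nsq_ge0 hbeta f.
rewrite -[nsq (L f)]sqr_sqrtr// -[nsq f]sqr_sqrtr// -exprMn.
rewrite ler_sqr ?nnegrE ?sqrtr_ge0//.
by apply: le_trans H; exact: sqrtr_ge0.
Qed.

End BergmanDensity.

(** * Binomial series and principal powers *)

Section BinomialSeries.
Variable R : realType.
Local Notation C := (R[i]).
Implicit Types (f g : C -> C) (x z : C) (q : R) (m : nat).

(** The coefficient of [x ^ m] in [(1 - x) ^ (- q)]. *)
Definition bcoef q m : R := (\prod_(i < m) (q + i%:R)) / m`!%:R.

Lemma factR_neq0 m : m`!%:R != 0 :> R.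
Proof. by rewrite pnatr_eq0 -lt0n fact_gt0. Qed.

Lemma bcoef0 q : bcoef q 0 = 1.
Proof. by rewrite /bcoef big_ord0 divr1. Qed.

Lemma bcoefS q m : m.+1%:R * bcoef q m.+1 = (q + m%:R) * bcoef q m.
Proof.
rewrite /bcoef big_ord_recr/= factS natrM.
have := factR_neq0 m; have : m.+1%:R != 0 :> R by rewrite pnatr_eq0.
move: (\prod_(i < m) _) (m`!%:R : R) (m.+1%:R : R) (m%:R : R) => A B D E D0 B0.
by field; rewrite D0 B0.
Qed.

Lemma bcoef_shift q m : q * bcoef (q + 1) m = (q + m%:R) * bcoef q m.
Proof.
elim: m => [|m IH]; first by rewrite !bcoef0 addr0.
have m0 : m.+1%:R != 0 :> R by rewrite pnatr_eq0.
apply: (mulfI m0); rewrite mulrCA bcoefS mulrCA IH.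
rewrite [RHS]mulrCA bcoefS -natr1; ring.
Qed.

Lemma bcoefSS q m : bcoef (q + 1) m.+1 - bcoef (q + 1) m = bcoef q m.+1.
Proof.
have m0 : m.+1%:R != 0 :> R by rewrite pnatr_eq0.
apply: (mulfI m0); rewrite mulrBr !bcoefS -(bcoef_shift q) -[m.+1%:R]natr1; ring.
Qed.

Lemma bcoef_gt0 q m : 0 < q -> 0 < bcoef q m.
Proof.
move=> q0; apply: divr_gt0; last by rewrite ltr0n fact_gt0.
by apply: prodr_gt0 => i _; rewrite ltr_pwDl.
Qed.

Lemma bcoef1 m : bcoef 1 m = 1.
Proof.
elim: m => [|m IH]; first by rewrite bcoef0.
have m0 : m.+1%:R != 0 :> R by rewrite pnatr_eq0.
by apply: (mulfI m0); rewrite bcoefS IH [1 + _]addrC natr1.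
Qed.

Lemma bcoef_0 m : bcoef 0 m = (m == 0%N)%:R.
Proof.
case: m => [|m]; first by rewrite bcoef0.
by rewrite /bcoef big_ord_recl addr0 !mul0r.
Qed.

(** Ratio test: beyond [|q| / (1 - x)] the terms decrease. *)
Lemma tame_bcoef q : tame (fun m => (bcoef q m)%:C).
Proof.
move=> x /andP[x0 x1]; have x10 : 0 < 1 - x by rewrite subr_gt0.
pose N := (Num.truncn (`|q| / (1 - x))).+1.
pose t n := cabs (bcoef q n)%:C * x ^+ n.
have t0 n : 0 <= t n by rewrite mulr_ge0 ?cabs_ge0 ?exprn_ge0.
have dec n : (N <= n)%N -> t n.+1 <= t n.
  move=> Nn; have n0 : 0 < n.+1%:R :> R by rewrite ltr0n.
  rewrite -(ler_pM2l n0) /t !cabsR exprS.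
  have -> : n.+1%:R * (`|bcoef q n.+1| * (x * x ^+ n)) = `|q + n%:R| * x * (`|bcoef q n| * x ^+ n).
    have -> : `|q + n%:R| * x * (`|bcoef q n| * x ^+ n) = `|(q + n%:R) * bcoef q n| * (x * x ^+ n).
      by rewrite (normrM (q + n%:R) (bcoef q n)); ring.
    by rewrite -bcoefS (normrM n.+1%:R (bcoef q n.+1)) (ger0_norm (ltW n0)); ring.
  apply: ler_wpM2r; first by rewrite mulr_ge0 ?exprn_ge0.
  have h1 : `|q + n%:R| <= `|q| + n%:R by rewrite (le_trans (ler_normD _ _))// lerD2l ger0_norm.
  apply: le_trans (ler_wpM2r x0 h1) _.
  have h2 : `|q| / (1 - x) <= n%:R.
    apply: (le_trans (ltW (truncnS_gt _))); by rewrite ler_nat.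
  move: h2; rewrite ler_pdivrMr// -natr1 => h2.
  have q0 := normr_ge0 q; have qx : `|q| * x <= `|q| by rewrite ler_piMr// ltW.
  by move: (n%:R : R) `|q| (n%:R * x) h2 qx (mulrDl `|q| n%:R x) => A B D; lra.
exists (\sum_(k < N.+1) t k) => n; rewrite -/(t n).
have bN k : (k <= N)%N -> t k <= \sum_(k < N.+1) t k.
  by move=> kN; rewrite (bigD1 (Ordinal (kN : (k < N.+1)%N)))//= lerDl sumr_ge0.
have [nN|Nn] := leqP n N; first exact: bN.
rewrite -(subnKC (ltnW Nn)); elim: (n - N)%N => [|k IH]; first by rewrite addn0 bN.
by rewrite addnS; apply: le_trans IH; apply: dec; exact: leq_addr.
Qed.

Definition binser q : C -> C := projT1 (cid (tame_pseries (tame_bcoef q))).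

Lemma pseries_binser q : pseries_on_disk (fun m => (bcoef q m)%:C) (binser q).
Proof. by rewrite /binser; case: (cid _). Qed.

(** The coefficient identity [bcoefSS], of the Pascal type. *)
Lemma binser_mul q x : cabs x < 1 -> (1 - x) * binser (q + 1) x = binser q x.
Proof.
have H := pseries_binser (q + 1).
have := pseriesD H (pseriesZ (-1) (pseries_mulX H)).
rewrite (_ : (fun n => _) = (fun m => (bcoef q m)%:C)); last first.
  apply/funext => -[|m]; first by rewrite mulr0 addr0 !bcoef0.
  by rewrite mulN1r -rmorphB bcoefSS.
move=> H1 x1; rewrite -(pseries_fun_unique H1 (pseries_binser q) x1); ring.
Qed.

Lemma binser_mulX q k x : cabs x < 1 -> (1 - x) ^+ k * binser (q + k%:R) x = binser q x.
Proof.
move=> x1; elim: k => [|k IH]; first by rewrite expr0 mul1r addr0.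
by rewrite exprSr -mulrA -natr1 addrA binser_mul.
Qed.

Lemma binser_at0 q : binser q 0 = 1.
Proof. by rewrite (pseries0 (pseries_binser q)) bcoef0. Qed.

Lemma binser0 x : cabs x < 1 -> binser 0 x = 1.
Proof.
move=> x1; rewrite (pseries_fun_unique (pseries_binser 0) (g := fun z => z ^+ 0) _ x1)//.
have := @pseries_monom R 0; congr pseries_on_disk.
by apply/funext => m; rewrite bcoef_0; case: m.
Qed.

Lemma one_sub_neq0 x : cabs x < 1 -> 1 - x != 0.
Proof.
move=> x1; apply/eqP => /eqP; rewrite subr_eq0 => /eqP E.
by move: x1; rewrite -E cabs1 ltxx.
Qed.

Lemma binser_cdiff q x : cabs x < 1 -> cdiff (binser q) x (q%:C * binser (q + 1) x).
Proof.
move=> x1; apply: (pseries_cdiff (g := fun z => q%:C * binser (q + 1) z) (pseries_binser q)) => //.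
have := pseriesZ q%:C (pseries_binser (q + 1)); congr pseries_on_disk.
apply/funext => m; rewrite /dcoef -(rmorph_nat (real_complex R)) -!rmorphM.
by rewrite bcoefS bcoef_shift.
Qed.

Lemma zero_deriv_const f : (forall z, cabs z < 1 -> cdiff f z 0) ->
  forall z, cabs z < 1 -> f z = f 0.
Proof.
move=> H.
have hf : holomorphic_on_disk f.
  by move=> z /unit_diskE z1; apply/derivable_cdiff; exists 0; exact: H.
have [a Ha] := taylor hf.
have d0 z : cabs z < 1 -> derive1 (f : C^o -> C^o) z = 0 by move=> z1; apply/cdiff_derive1/H.
have a0 := pseries_eq0 (pseries_derive1 Ha) d0.
move=> z z1; have Hc : pseries_on_disk a (fun z => a 0%N * z ^+ 0).
  have := pseriesZ (a 0%N) (@pseries_monom R 0); congr pseries_on_disk.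
  apply/funext => -[|m] /=; first by rewrite mulr1.
  have := a0 m; rewrite /dcoef => /eqP; rewrite mulf_eq0 pnatr_eq0/= => /eqP ->.
  by rewrite mulr0.
by rewrite (pseries_fun_unique Ha Hc z1) (pseries0 Ha) mulr1.
Qed.

Lemma tame_logcoef : tame (fun m => (- m%:R^-1 : R)%:C).
Proof.
move=> x /andP[x0 x1]; exists 1 => -[|m]; first by rewrite invr0 oppr0 cabs0 mul0r.
rewrite cabsR normrN ger0_norm ?invr_ge0//; apply: mulr_ile1; rewrite ?invr_ge0 ?exprn_ge0//.
  by rewrite invf_le1 ?ler1n.
by rewrite exprn_ile1// ltW.
Qed.

(** The power series of [log (1 - x)]. The default value of [0^-1] makes its
    constant term [0]. *)
Definition logser : C -> C := projT1 (cid (tame_pseries tame_logcoef)).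

Lemma pseries_logser : pseries_on_disk (fun m => (- m%:R^-1 : R)%:C) logser.
Proof. by rewrite /logser; case: (cid _). Qed.

Lemma logser0 : logser 0 = 0.
Proof. by rewrite (pseries0 pseries_logser) invr0 oppr0. Qed.

Lemma logser_cdiff x : cabs x < 1 -> cdiff logser x (- binser 1 x).
Proof.
move=> x1; apply: (pseries_cdiff (g := fun z => - binser 1 z) pseries_logser) => //.
have := pseriesZ (-1) (pseries_binser 1).
rewrite (_ : (fun n => _) = dcoef (fun m => (- m%:R^-1 : R)%:C)).
  by apply: eq_pseries => z _; rewrite mulN1r.
apply/funext => m; rewrite /dcoef -(rmorph_nat (real_complex R)) -!rmorphM bcoef1.
by rewrite mulrN mulfV ?pnatr_eq0// rmorphN rmorph1 mulr1.
Qed.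

(** The derivative of the left-hand side vanishes. *)
Lemma binser_logser q x : cabs x < 1 -> binser q x * cexp (q%:C * logser x) = 1.
Proof.
move=> x1; rewrite (@zero_deriv_const (fun z => binser q z * cexp (q%:C * logser z))) //.
  by rewrite logser0 mulr0 cexp0 binser_at0 mulr1.
move=> z z1.
have d1 := cdiffZ q%:C (logser_cdiff z1).
have d2 := cdiff_comp (f := @cexp R) (g := fun w => q%:C * logser w) d1 (cdiff_cexp _).
have := cdiffM (binser_cdiff q z1) d2; congr cdiff.
have z1' := one_sub_neq0 z1.
apply: (mulfI z1'); rewrite mulr0.
have e1 : (1 - z) * binser 1 z = 1.
  by have := binser_mul 0 z1; rewrite add0r binser0.
have e2 := binser_mul q z1; set E := cexp _.
transitivity (q%:C * E * ((1 - z) * binser (q + 1) z - binser q z * ((1 - z) * binser 1 z))).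
  ring.
by rewrite e1 e2; ring.
Qed.

Lemma binser_neq0 q x : cabs x < 1 -> binser q x != 0.
Proof.
move=> x1; apply/eqP => E; have := binser_logser q x1.
by rewrite E mul0r => /eqP; rewrite eq_sym oner_eq0.
Qed.

Lemma cexp_logser x : cabs x < 1 -> cexp (logser x) = 1 - x.
Proof.
move=> x1; have h := binser_logser (-1) x1.
apply: (mulIf (binser_neq0 1 x1)).
have e1 : (1 - x) * binser 1 x = 1 by have := binser_mul 0 x1; rewrite add0r binser0.
rewrite e1 mulrC; have := binser_logser 1 x1.
by rewrite rmorph1 mul1r.
Qed.

Lemma Re_one_sub x : cabs x < 1 -> 0 < Re (1 - x).
Proof.
move=> x1; rewrite ReD ReN /= subr_gt0; apply: le_lt_trans x1.
by apply: le_trans (cabs_Re x); exact: ler_norm.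
Qed.

Lemma cos_Im_logser x : cabs x < 1 -> 0 < cos (Im (logser x)).
Proof.
move=> x1; have := Re_one_sub x1; rewrite -cexp_logser// /cexp/=.
by rewrite pmulr_rgt0// expR_gt0.
Qed.

(** The imaginary part starts at [0] and cannot cross [pi / 2] along a ray, since
    the real part of [1 - t x] stays positive. *)
Lemma Im_logser_bound x : cabs x < 1 -> `|Im (logser x)| < pi / 2.
Proof.
move=> x1; rewrite ltNge; apply/negP => H.
pose F (t : R) : R := `|Im (logser (t%:C * x))|.
have tx (t : R) : 0 <= t <= 1 -> cabs (t%:C * x) < 1.
  move=> /andP[t0 t1]; rewrite cabsM cabsR ger0_norm//; apply: le_lt_trans x1.
  by rewrite ler_piMl ?cabs_ge0.
have cF : {within `[0, 1], continuous F}.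
  apply: continuous_in_subspaceT => t; rewrite inE/= in_itv/= => t01.
  apply/cvgrPdist_lt => e e0.
  have [dl dl0 Hd] := cdiff_cont (logser_cdiff (tx t t01)) e0.
  near=> s.
  apply: le_lt_trans (ler_dist_dist _ _) _.
  rewrite -ImN -ImD; apply: le_lt_trans (cabs_Im _) _; rewrite cabsB; apply: Hd.
  rewrite -mulrBl -rmorphB cabsM cabsR.
  apply: (@le_lt_trans _ _ `|s - t|); first by rewrite ler_piMr// ltW.
  rewrite distrC; near: s; by exists dl.
have F0 : F 0 = 0 by rewrite /F rmorph0 mul0r logser0 /= normr0.
have F1 : F 1 = `|Im (logser x)| by rewrite /F rmorph1 mul1r.
have [|t] := IVT ler01 cF (v := pi / 2).
  by rewrite F0 F1 ge_min le_max H divr_ge0 ?pi_ge0 ?orbT.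
rewrite in_itv/= => t01 Ft.
have := cos_Im_logser (tx t t01).
have -> : cos (Im (logser (t%:C * x))) = cos (F t).
  by rewrite /F; have [_|_] := ger0P (Im (logser (t%:C * x))); rewrite ?cosN.
by rewrite Ft cos_pihalf ltxx.
Unshelve. all: by end_near. Qed.

(** The two logarithms have the same exponential, and both imaginary parts lie in
    the open interval between [- pi / 2] and [pi / 2]. *)
Lemma cLog_logser x : cabs x < 1 -> cLog (1 - x) = logser x.
Proof.
move=> x1; have E := cexp_logser x1.
have M : cabs (1 - x) = expR (Re (logser x)) by rewrite -E cabs_cexp.
have := Im_logser_bound x1; rewrite ltr_norml => /andP[l1 l2].
have p0 := @pi_gt0 R.
rewrite /cLog M expRK /carg M -E /cexp /= pmulr_rge0 ?expR_gt0//.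
rewrite mulrAC mulfV ?gt_eqF ?expR_gt0// mul1r.
case: (logser x) l1 l2 => a b /= l1 l2; congr Complex; case: ifP => s0.
  have [b0|b0] := leP 0 b; first by rewrite cosK// in_itv/= b0/=; lra.
  have : 0 < sin (- b) by apply: sin_gt0_pi; apply/andP; split; lra.
  by rewrite sinN; lra.
have [b0|b0] := leP b 0; first by rewrite -cosN cosK ?opprK// in_itv/= oppr_ge0 b0/=; lra.
have : 0 < sin b by apply: sin_gt0_pi; apply/andP; split; lra.
by lra.
Qed.

Lemma binser_cpow q x : cabs x < 1 -> binser q x = (cpow (1 - x) q)^-1.
Proof.
move=> x1; rewrite /cpow cLog_logser//; apply: (mulIf (cexp_neq0 (q%:C * logser x))).
by rewrite binser_logser// mulVf// cexp_neq0.
Qed.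

End BinomialSeries.

(** * Symmetry of an operator from its values on monomials *)

Section SymmetricOperators.
Variable R : realType.
Variable beta : R.
Hypothesis hbeta : -1 < beta.
Local Notation C := (R[i]).
Local Notation nsq := (nsq beta).
Local Notation inner := (bergman_inner beta).
Local Notation bergman := (bergman beta).
Implicit Types (f g : C -> C) (z c : C).

Lemma innerDr f g1 g2 : bergman f -> bergman g1 -> bergman g2 ->
  inner f (fun z => g1 z + g2 z) = inner f g1 + inner f g2.
Proof.
move=> bf b1 b2; have b12 := bergmanD hbeta b1 b2.
rewrite (innerC hbeta b12 bf) innerD// conjcD.
by rewrite -(innerC hbeta b1 bf) -(innerC hbeta b2 bf).
Qed.

Lemma innerZr c f g : bergman f -> bergman g ->
  inner f (fun z => c * g z) = c^*%C * inner f g.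
Proof.
move=> bf bg; have bc := bergmanZ hbeta c bg.
by rewrite (innerC hbeta bc bf) innerZ// conjcM -(innerC hbeta bg bf).
Qed.

Lemma inner_small f (d : R) : bergman f -> 0 < d ->
  exists2 e : R, 0 < e & forall g, bergman g -> nsq g <= e -> cabs (inner f g) <= d.
Proof.
move=> bf d0; have n0 := nsq_ge0 hbeta f.
(* The [+ 1] keeps [e] positive when [f] has norm zero. *)
pose e := 4 * (nsq f + 1) / d.
have e0 : 0 < e by rewrite divr_gt0// mulr_gt0// ltr_wpDl.
have e4 : 0 < 4 * e by apply: mulr_gt0.
exists (d / (4 * e)); first exact: divr_gt0.
move=> g bg; rewrite (ler_pdivlMr _ _ e4) => gd.
apply: le_trans (inner_bound hbeta e0 bf bg) _.
have h : e^-1 * nsq f <= d / 4.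
  rewrite mulrC ler_pdivrMr// /e mulrCA -mulrA.
  have -> : 4 * ((nsq f + 1) * (d / 4 / d)) = nsq f + 1.
    by field; rewrite gt_eqF.
  by rewrite lerDl.
move: h gd; have -> : nsq g * (4 * e) = 4 * (e * nsq g) by ring.
by move: (e^-1 * nsq f) (e * nsq g) => A B; lra.
Qed.

Variable L : (C -> C) -> (C -> C).
Hypothesis bL : bergman_bounded beta L.
Hypothesis LD : forall f g, bergman f -> bergman g -> forall z, cabs z < 1 ->
  L (fun w => f w + g w) z = L f z + L g z.
Hypothesis LZ : forall c f, bergman f -> forall z, cabs z < 1 ->
  L (fun w => c * f w) z = c * L f z.

Let bLf f : bergman f -> bergman (L f). Proof. by have [+ _] := bL; apply. Qed.

(** The difference of the two sides does not change when [g] is replaced by a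
    remainder of its Taylor series, and the remainders tend to [0] in norm. *)
Lemma sym_extend f : bergman f ->
  (forall k, inner (L f) (fun z => z ^+ k) = inner f (L (fun z => z ^+ k))) ->
  forall g, bergman g -> inner (L f) g = inner f (L g).
Proof.
move=> bf H g bg; have [a Ha] := taylor bg.1.
have bm := bergman_monom hbeta; have bp := bergman_poly hbeta a.
have conj0 : (0 : C)^*%C = 0 by rewrite /conjc/= oppr0.
have P N : inner (L f) (poly_fun a N) = inner f (L (poly_fun a N)).
  elim: N => [|N IH].
    have -> : poly_fun a 0 = (fun z => 0 * z ^+ 0).
      by rewrite poly_fun0; apply/funext => z; rewrite mul0r.
    rewrite (innerZr 0 (bLf bf) (bm 0%N)) conj0 mul0r.
    rewrite (eq_inner beta (f2 := f) (g2 := fun z => 0 * L (fun w => w ^+ 0) z)) //.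
      by rewrite (innerZr 0 bf (bLf (bm 0%N))) conj0 mul0r.
    by move=> z z1; exact: LZ.
  rewrite poly_funS; have bN := bergmanZ hbeta (a N) (bm N).
  rewrite (innerDr (bLf bf) (bp N) bN) (innerZr _ (bLf bf) (bm N)).
  rewrite (eq_inner beta (f1 := f) (f2 := f)
    (g1 := L (fun z => poly_fun a N z + a N * z ^+ N))
    (g2 := fun z => L (poly_fun a N) z + a N * L (fun w => w ^+ N) z)) //.
    have b1 := bLf (bp N); have b2 := bLf (bm N); have b3 := bergmanZ hbeta (a N) b2.
    by rewrite (innerDr bf b1 b3) (innerZr _ bf b2) IH H.
  by move=> z z1; rewrite (LD (bp N) bN)// LZ.
have E N : inner (L f) g - inner f (L g) =
    inner (L f) (taylor_rem a g N) - inner f (L (taylor_rem a g N)).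
  have bN := bergman_rem hbeta a N bg.
  have gE : g = (fun z => poly_fun a N z + taylor_rem a g N z).
    by apply/funext => z; rewrite /taylor_rem addrC subrK.
  rewrite {1}gE (innerDr (bLf bf) (bp N) bN).
  rewrite (eq_inner beta (f1 := f) (f2 := f) (g1 := L g)
    (g2 := fun z => L (poly_fun a N) z + L (taylor_rem a g N) z)) //.
    rewrite (innerDr bf (bLf (bp N)) (bLf bN)).
    by rewrite P opprD addrACA subrr add0r.
  by move=> z z1; rewrite {1}gE LD.
apply/eqP; rewrite -subr_eq0 -cabs_eq0 eq_le cabs_ge0 andbT.
apply/ler_addgt0Pr => d d0; rewrite add0r.
have d2 : 0 < d / 2 by rewrite divr_gt0.
have [e1 e10 H1] := inner_small (bLf bf) d2.
have [e2 e20 H2] := inner_small bf d2.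
have [K K0 HK] := bounded_nsq hbeta bL.
have e30 : 0 < e2 / (K + 1) by rewrite divr_gt0// ltr_wpDl.
have [N1 HN1] := nsq_rem_cvg hbeta bg Ha e10.
have [N2 HN2] := nsq_rem_cvg hbeta bg Ha e30.
have bN := bergman_rem hbeta a (maxn N1 N2) bg.
rewrite (E (maxn N1 N2)); apply: le_trans (cabsD _ _) _.
rewrite cabsN [leRHS](splitr d); apply: lerD.
  by apply: H1 => //; apply: HN1; exact: leq_maxl.
apply: H2; first exact: bLf.
apply: le_trans (HK _ bN) _.
have := HN2 _ (leq_maxr N1 N2); rewrite ler_pdivlMr ?ltr_wpDl// => h.
apply: le_trans h; rewrite mulrC ler_wpM2l ?nsq_ge0//.
by rewrite lerDl.
Qed.

(** Twice [sym_extend]: first with [f] a monomial, which yields its hypothesis for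
    arbitrary [f] by conjugation. *)
Lemma sym_of_monom :
  (forall j k, inner (L (fun z => z ^+ j)) (fun z => z ^+ k) =
               inner (fun z => z ^+ j) (L (fun z => z ^+ k))) ->
  forall f g, bergman f -> bergman g -> inner (L f) g = inner f (L g).
Proof.
move=> H f g bf bg; apply: sym_extend => // k.
have bm := bergman_monom hbeta k.
have := sym_extend bm (H k) bf.
rewrite (innerC hbeta bf (bLf bm)) (innerC hbeta (bLf bf) bm).
by move=> /(congr1 (@conjc R)); rewrite !conjcK.
Qed.

End SymmetricOperators.

(** * Symbols with a hermitian matrix *)

Section SymmetricSymbols.
Variable R : realType.
Local Notation C := (R[i]).
Implicit Types (f g : C -> C) (z w : C) (a b m k : nat).

Lemma pseries_scale (s : nat -> C) f w : cabs w <= 1 -> pseries_on_disk s f ->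
  pseries_on_disk (fun k => s k * w ^+ k) (fun z => f (w * z)).
Proof.
move=> w1 Hf z z1; have wz : cabs (w * z) < 1.
  by rewrite cabsM; apply: le_lt_trans z1; rewrite ler_piMl ?cabs_ge0.
apply: (ccvg_near (N := 0%N)) (Hf _ wz) => N _.
by apply: eq_bigr => i _; rewrite exprMn mulrA.
Qed.

Lemma pseries_sum (s : nat -> nat -> C) (F : nat -> C -> C) N :
  (forall i, pseries_on_disk (s i) (F i)) ->
  pseries_on_disk (fun k => \sum_(i < N) s i k) (fun z => \sum_(i < N) F i z).
Proof.
move=> H; elim: N => [|N IH].
  have := pseriesZ 0 (@pseries_monom R 0).
  rewrite (_ : (fun k => _) = (fun k => \sum_(i < 0) s i k)).
    by apply: eq_pseries => z _; rewrite big_ord0 mul0r.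
  by apply/funext => k; rewrite big_ord0 mul0r.
have := pseriesD IH (H N).
rewrite (_ : (fun k => _ + _) = (fun k => \sum_(i < N.+1) s i k)).
  by apply: eq_pseries => z _; rewrite big_ord_recr.
by apply/funext => k; rewrite big_ord_recr.
Qed.

Lemma holoM f g : holomorphic_on_disk f -> holomorphic_on_disk g ->
  holomorphic_on_disk (fun z => f z * g z).
Proof.
move=> hf hg z /unit_diskE z1; have [d1 D1] := holo_cdiff hf z1.
have [d2 D2] := holo_cdiff hg z1; apply/derivable_cdiff.
by exists (f z * d2 + g z * d1); exact: cdiffM.
Qed.

Lemma holoX f k : holomorphic_on_disk f -> holomorphic_on_disk (fun z => f z ^+ k).
Proof.
move=> hf; elim: k => [|k IH]; first exact: holo_cst.
have -> : (fun z => f z ^+ k.+1) = (fun z => f z * f z ^+ k).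
  by apply/funext => z; rewrite exprS.
exact: holoM.
Qed.

Variables (q : R) (v theta : C -> C) (T : nat -> nat -> C).
Hypothesis q0 : 0 < q.
Hypothesis holo_theta : holomorphic_on_disk theta.
Hypothesis HT : forall a, pseries_on_disk (T a) (fun z => v z * theta z ^+ a).

(** Hermitian symmetry of the matrix with entries [T a b / bcoef q b]: up to
    positive factors that are symmetric in [a] and [b], the matrix of the operator
    on the monomials of degree at least [n], see [sym_entry]. *)
Definition kernel_sym := forall a b,
  (bcoef q a)%:C * T a b = (bcoef q b)%:C * (T b a)^*%C.

Let lt01 : cabs (0 : C) < 1. Proof. by rewrite cabs0. Qed.

Lemma pseries_v : pseries_on_disk (T 0%N) v.
Proof. by have := HT 0%N; apply: eq_pseries => z _; rewrite expr0 mulr1. Qed.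

Lemma T_0 a : T a 0%N = v 0 * theta 0 ^+ a.
Proof. by rewrite -(pseries0 (HT a)). Qed.

Lemma real_of_conj z : z^*%C = z -> exists x : R, z = x%:C.
Proof.
case: z => x y [h]; exists x; congr Complex.
lra.
Qed.

Lemma bcoefSl m : m.+1%:R * bcoef q m.+1 = q * bcoef (q + 1) m.
Proof. by rewrite bcoefS bcoef_shift. Qed.

Lemma bcoef_1 : bcoef q 1 = q.
Proof. by have := bcoefSl 0; rewrite bcoef0 mulr1 mul1r. Qed.

Lemma bcoefC_neq0 m : (bcoef q m)%:C != 0.
Proof. by rewrite (inj_eq (@complexI R)) gt_eqF ?bcoef_gt0. Qed.

(** Row [0] of the symmetry determines the coefficients of [v] from [v 0] and
    [theta 0], row [1] those of [v * theta] from these and the derivative of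
    [theta] at [0]. The diagonal entries make [v 0] and that derivative real. Since
    [binser] has no zero, dividing the two series gives [theta]. *)
Lemma form_of_sym : kernel_sym -> (exists2 z, cabs z < 1 & v z != 0) -> cabs (theta 0) < 1 ->
  exists c0 c2 : R, c0 != 0 /\ forall z, cabs z < 1 ->
    v z = c0%:C * binser q ((theta 0)^*%C * z) /\
    theta z = theta 0 + c2%:C * z / (1 - (theta 0)^*%C * z).
Proof.
move=> S [z0 z01 vz0] c1lt; set c1 := theta 0.
have c11 : cabs c1^*%C <= 1 by rewrite cabs_conj ltW.
have cz z : cabs z < 1 -> cabs (c1^*%C * z) < 1.
  by move=> z1; rewrite cabsM; apply: le_lt_trans z1; rewrite ler_piMl ?cabs_ge0.
have [c0 c0E] : exists x : R, v 0 = x%:C.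
  apply: real_of_conj; have := S 0%N 0%N; rewrite T_0 expr0 mulr1.
  by move/(mulfI (bcoefC_neq0 0)).
have T0 b : T 0%N b = c0%:C * ((bcoef q b)%:C * c1^*%C ^+ b).
  have := S 0%N b; rewrite T_0 bcoef0 mul1r c0E => ->.
  by rewrite conjcM conjcX conjcR mulrCA.
have vE z : cabs z < 1 -> v z = c0%:C * binser q (c1^*%C * z).
  have := pseriesZ c0%:C (pseries_scale c11 (pseries_binser q)).
  rewrite (_ : (fun k => _) = T 0%N); last by apply/funext => b; rewrite T0.
  by move=> H z1; exact: (pseries_fun_unique pseries_v H).
have c0n : c0 != 0.
  by apply: contraNneq vz0 => E; rewrite vE// E mul0r.
have c0Cn : c0%:C != 0 by rewrite (inj_eq (@complexI R)).
have [t Dt] := holo_cdiff holo_theta lt01.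
have T1 b : T b 1%N = v 0 * (b%:R * c1 ^+ b.-1 * t) + c1 ^+ b * T 0%N 1%N.
  apply: cdiff_unique (pseries1 (HT b)) _.
  apply: (cdiffM (f := v) (g := fun z => theta z ^+ b)); first exact: pseries1 pseries_v.
  exact: (cdiff_comp (f := fun w => w ^+ b) Dt (cdiffX b _)).
have T01 : T 0%N 1%N = c0%:C * (q%:C * c1^*%C) by rewrite T0 bcoef_1 expr1.
have [c2 c2E] : exists x : R, t = x%:C.
  apply: real_of_conj; have := S 1%N 1%N => /(mulfI (bcoefC_neq0 1)).
  rewrite T1 T01 c0E mul1r expr0 mul1r expr1 !conjcD !conjcM !conjcR conjcK.
  have -> : c1 * (c0%:C * (q%:C * c1^*%C)) = c1^*%C * (c0%:C * (q%:C * c1)) by ring.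
  by move/addIr/(mulfI c0Cn).
exists c0, c2; split => // z z1; split; first exact: vE.
have T1E b : T 1%N b = c0%:C * c1 * ((bcoef q b)%:C * c1^*%C ^+ b) +
    c0%:C * c2%:C * (if b is m.+1 then (bcoef (q + 1) m)%:C * c1^*%C ^+ m else 0).
  apply: (mulfI (bcoefC_neq0 1)); rewrite S T1 T01 c0E c2E bcoef_1.
  have cn m : (m%:R : C)^*%C = m%:R by rewrite -(rmorph_nat (real_complex R)) conjcR.
  rewrite !conjcD !conjcM !conjcX !conjcR conjcK cn.
  case: b => [|m].
    by rewrite !expr0 !mul0r !mulr0 bcoef0; ring.
  have e : (bcoef q m.+1)%:C * m.+1%:R = q%:C * (bcoef (q + 1) m)%:C.
    by rewrite -(rmorph_nat (real_complex R)) -!rmorphM mulrC bcoefSl.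
  rewrite /= [LHS](_ : _ = (bcoef q m.+1)%:C * m.+1%:R * (c0%:C * c1^*%C ^+ m * c2%:C) +
    (bcoef q m.+1)%:C * c1^*%C ^+ m.+1 * c0%:C * q%:C * c1); last by ring.
  by rewrite e; ring.
have Hb := pseriesZ (c0%:C * c1) (pseries_scale c11 (pseries_binser q)).
have Hc := pseriesZ (c0%:C * c2%:C) (pseries_mulX (pseries_scale c11 (pseries_binser (q + 1)))).
have := pseriesD Hb Hc.
rewrite (_ : (fun k => _) = T 1%N); last by apply/funext => b; rewrite T1E.
move=> H; have := pseries_fun_unique (HT 1) H z1.
have n1 := one_sub_neq0 (cz z z1); have n2 := binser_neq0 (q + 1) (cz z z1).
have n3 := binser_mul q (cz z z1).
rewrite expr1 vE// -n3; move: (binser (q + 1) _) n2 => B n2 E.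
apply: (mulfI (mulf_neq0 c0Cn (mulf_neq0 n1 n2))).
rewrite mulrA in E *; rewrite [LHS]E.
by field.
Qed.

Lemma sum_ord_add_zero (F : nat -> C) a b : (forall i, (a < i)%N -> F i = 0) ->
  \sum_(i < a.+1) F i = \sum_(i < (a + b).+1) F i.
Proof.
move=> F0; rewrite -addSn big_split_ord/= [X in _ = _ + X]big1 ?addr0// => i _.
by rewrite F0// ltnS leq_addr.
Qed.

Definition rfact m : R := \prod_(i < m) (q + i%:R).

Lemma bcoef_rfact m : m`!%:R * bcoef q m = rfact m.
Proof. by rewrite /bcoef mulrC divfK// factR_neq0. Qed.

Lemma bcoef_mul a m : a`!%:R * bcoef q a * (m`!%:R * bcoef (q + a%:R) m) = rfact (a + m).
Proof.
rewrite bcoef_rfact /rfact /bcoef big_split_ord/= [m`!%:R * _]mulrC divfK ?factR_neq0//.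
by congr (_ * _); apply: eq_bigr => i _; rewrite natrD addrA.
Qed.

(** The right-hand side is symmetric in [a] and [b], which is not apparent on the
    left. *)
Lemma bcoef_sym a b i : (i <= a)%N -> (i <= b)%N ->
  bcoef q a * (bcoef (q + a%:R) (b - i) * 'C(a, i)%:R) =
  rfact (a + b - i) / (i`!%:R * (a - i)`!%:R * (b - i)`!%:R).
Proof.
move=> ia ib; rewrite -addnBA// -bcoef_mul -(bin_fact ia) !natrM.
have h1 := factR_neq0 R i; have h2 := factR_neq0 R (a - i); have h3 := factR_neq0 R (b - i).
move: (bcoef q a) (bcoef (q + a%:R) (b - i)) => A B; field.
by rewrite h1 h2 h3.
Qed.

(** With [d = c2 - |c1| ^ 2] one has [theta z = (c1 + d z) / (1 - c1^* z)]. The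
    powers of the denominator only shift the parameter of the binomial series, so
    [v z * theta z ^ a] is [c0 * binser (q + a) (c1^* z) * (c1 + d z) ^ a], whose
    coefficients are finite sums with visible symmetry. *)
Lemma sym_of_form (c0 c2 : R) c1 : cabs c1 < 1 ->
  (forall z, cabs z < 1 -> v z = c0%:C * binser q (c1^*%C * z) /\
    theta z = c1 + c2%:C * z / (1 - c1^*%C * z)) -> kernel_sym.
Proof.
move=> c1lt H.
have c11 : cabs c1^*%C <= 1 by rewrite cabs_conj ltW.
have cz z : cabs z < 1 -> cabs (c1^*%C * z) < 1.
  by move=> z1; rewrite cabsM; apply: le_lt_trans z1; rewrite ler_piMl ?cabs_ge0.
have [d dE] : exists d : R, d%:C = c2%:C - c1 * c1^*%C.
  by exists (c2 - cabs c1 ^+ 2); rewrite mulcJ rmorphB.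
(* The [z ^ b] coefficient of the [i]-th binomial term of [v * theta ^ a]. *)
pose t a i b := c0%:C * ('C(a, i)%:R * c1 ^+ (a - i) * d%:C ^+ i) *
  (if (i <= b)%N then (bcoef (q + a%:R) (b - i))%:C * c1^*%C ^+ (b - i) else 0).
have TE a b : T a b = \sum_(i < a.+1) t a i b.
  pose F i z := c0%:C * ('C(a, i)%:R * c1 ^+ (a - i) * d%:C ^+ i) *
    (z ^+ i * binser (q + a%:R) (c1^*%C * z)).
  have HF i : pseries_on_disk (t a i) (F i).
    exact: pseriesZ (pseries_mulXn i (pseries_scale c11 (pseries_binser _))).
  apply: (pseries_unique (HT a) (pseries_sum a.+1 HF)) => z z1.
  have [-> ->] := H z z1; have n1 := one_sub_neq0 (cz z z1).
  rewrite -(binser_mulX q a (cz z z1)).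
  have -> : c1 + c2%:C * z / (1 - c1^*%C * z) = (c1 + d%:C * z) / (1 - c1^*%C * z).
    by rewrite dE; field.
  rewrite expr_div_n (exprDn c1); set B := binser _ _; set D := _ ^+ a.
  have nD : D != 0 by rewrite expf_neq0.
  rewrite [LHS](_ : _ = c0%:C * B * \sum_(i < a.+1) (c1 ^+ (a - i) * (d%:C * z) ^+ i) *+ 'C(a, i)).
    rewrite mulr_sumr; apply: eq_bigr => i _; rewrite /F -/B -mulr_natl exprMn; ring.
  move: (\sum_(i < a.+1) _) => X; field; exact: nD.
(* The terms of [bcoef q a * T a b], extended by zero to a range symmetric in [a] and [b]. *)
pose s a b i : C := if (i <= a)%N && (i <= b)%N then
  c0%:C * d%:C ^+ i * (c1 ^+ (a - i) * c1^*%C ^+ (b - i)) *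
  (rfact (a + b - i) / (i`!%:R * (a - i)`!%:R * (b - i)`!%:R))%:C else 0.
have sE a b : (bcoef q a)%:C * T a b = \sum_(i < (a + b).+1) s a b i.
  rewrite -(@sum_ord_add_zero (s a b)); last first.
    by move=> i ai; rewrite /s [(i <= a)%N]leqNgt ai /=.
  rewrite TE mulr_sumr; apply: eq_bigr => i _; rewrite /s /t.
  have ia : (i <= a)%N by rewrite -ltnS.
  rewrite ia /=; case: ifP => ib; last by rewrite !mulr0.
  rewrite -bcoef_sym// !rmorphM (rmorph_nat (real_complex R)); ring.
move=> a b; rewrite sE -[(bcoef q b)%:C]conjcR -conjcM sE (addnC b a).
have conj_sum N (F : 'I_N -> C) : (\sum_(i < N) F i)^*%C = \sum_(i < N) (F i)^*%C.
  exact: (rmorph_sum (@conjc R)).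
rewrite conj_sum; apply: eq_bigr => i _.
rewrite /s andbC; case: ifP => _; last by rewrite /conjc/= oppr0.
rewrite (addnC b a) !conjcM !conjcX !conjcR conjcK.
have -> : i`!%:R * (b - i)`!%:R * (a - i)`!%:R = i`!%:R * (a - i)`!%:R * (b - i)`!%:R :> R by ring.
ring.
Qed.

End SymmetricSymbols.

(** * Weighted composition-differentiation operators *)

Section CompositionDifferentiation.
Variable R : realType.
Variable beta : R.
Hypothesis hbeta : -1 < beta.
Local Notation C := (R[i]).
Local Notation inner := (bergman_inner beta).
Local Notation bergman := (bergman beta).
Local Notation omega := (omega beta).
Implicit Types (f g : C -> C) (z w c : C) (a b m k j : nat).
Variables (n : nat) (u theta : C -> C).
Hypothesis theta_disk : forall z, cabs z < 1 -> cabs (theta z) < 1.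
Hypothesis bW : bergman_bounded beta (wcomp_diff n u theta).
Local Notation W := (wcomp_diff n u theta).
Local Notation p := (beta + n%:R + 2).

Let bWf f : bergman f -> bergman (W f). Proof. by have [+ _] := bW; apply. Qed.
Let bm k : bergman (fun z => z ^+ k). Proof. exact: bergman_monom. Qed.

Lemma wcompD f g : bergman f -> bergman g -> forall z, cabs z < 1 ->
  W (fun w => f w + g w) z = W f z + W g z.
Proof.
move=> [/taylor[s Hs] _] [/taylor[t Ht] _] z z1; rewrite /wcomp_diff -mulrDr; congr (_ * _).
have H1 := pseries_derive1n n (pseriesD Hs Ht).
have H2 := pseriesD (pseries_derive1n n Hs) (pseries_derive1n n Ht).
move: H1; rewrite (_ : dncoef n _ = fun k => dncoef n s k + dncoef n t k); last first.
  by apply/funext => k; rewrite /dncoef mulrDr.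
by move=> H1; exact: (pseries_fun_unique H1 H2 (theta_disk z1)).
Qed.

Lemma wcompZ c f : bergman f -> forall z, cabs z < 1 ->
  W (fun w => c * f w) z = c * W f z.
Proof.
move=> [/taylor[s Hs] _] z z1; rewrite /wcomp_diff mulrCA; congr (_ * _).
have H1 := pseries_derive1n n (pseriesZ c Hs).
have H2 := pseriesZ c (pseries_derive1n n Hs).
move: H1; rewrite (_ : dncoef n _ = fun k => c * dncoef n s k); last first.
  by apply/funext => k; rewrite /dncoef mulrCA.
by move=> H1; exact: (pseries_fun_unique H1 H2 (theta_disk z1)).
Qed.

Lemma wcomp_monom j z : cabs z < 1 ->
  W (fun w => w ^+ j) z = u z * ((j ^_ n)%:R * theta z ^+ (j - n)).
Proof.
move=> z1; rewrite /wcomp_diff; congr (_ * _).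
have H1 := pseries_derive1n n (@pseries_monom R j).
have H2 := pseriesZ (j ^_ n)%:R (@pseries_monom R (j - n)%N).
move: H1; rewrite (_ : dncoef n _ = fun k => (j ^_ n)%:R * (k == (j - n)%N)%:R); last first.
  apply/funext => k; rewrite /dncoef; have [nj|jn] := leqP n j.
    by rewrite -(eqn_add2r n k) subnK//; case: eqP => [->|]; rewrite ?mulr0.
  by rewrite (ffact_small jn) mul0r gtn_eqF ?mulr0// ltn_addl.
by move=> H1; exact: (pseries_fun_unique H1 H2 (theta_disk z1)).
Qed.

(** The recursions [omegaS] and [bcoefS] have the same factors. This is where the
    exponent [beta + n + 2] in the formula for [u] comes from. *)
Lemma omega_bcoef m :
  n`!%:R * bcoef p m * omega (n + m) = ((n + m) ^_ n)%:R * omega n.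
Proof.
elim: m => [|m IH]; first by rewrite bcoef0 mulr1 addn0 ffactnn.
have m0 : m.+1%:R != 0 :> R by rewrite pnatr_eq0.
apply: (mulfI m0).
have -> : m.+1%:R * (n`!%:R * bcoef p m.+1 * omega (n + m.+1)) =
    n`!%:R * (m.+1%:R * bcoef p m.+1) * omega (n + m).+1 by rewrite addnS; ring.
rewrite bcoefS; have h := omegaS hbeta (n + m).
have -> : n`!%:R * ((p + m%:R) * bcoef p m) * omega (n + m).+1 =
    n`!%:R * bcoef p m * (((n + m)%:R + beta + 2) * omega (n + m).+1).
  by rewrite natrD; ring.
rewrite h mulrCA IH.
have -> : (n + m.+1)%N = (n + m).+1 by rewrite addnS.
have e : ((n + m).+1 * (n + m) ^_ n = m.+1 * (n + m).+1 ^_ n)%N.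
  by rewrite -ffactSS ffactnSr mulnC subSn ?leq_addr// addKn.
rewrite (mulrA (n + m).+1%:R) (mulrA m.+1%:R); congr (_ * _).
by rewrite -[LHS]natrM -[RHS]natrM e.
Qed.

Lemma inner0l g : bergman g -> forall f, (forall z, cabs z < 1 -> f z = 0) -> inner f g = 0.
Proof.
move=> bg f f0; rewrite (eq_inner beta (f2 := fun z => 0 * g z) (g2 := g)) //.
  by rewrite innerZ// mul0r.
by move=> z z1; rewrite f0// mul0r.
Qed.

Lemma wcomp_small k : (k < n)%N -> forall z, cabs z < 1 -> W (fun w => w ^+ k) z = 0.
Proof. by move=> kn z z1; rewrite wcomp_monom// ffact_small// mul0r mulr0. Qed.

Section Entries.
Variables (v : C -> C) (T : nat -> nat -> C).
Hypothesis uE : forall z, cabs z < 1 -> u z = z ^+ n * v z.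
Hypothesis HT : forall a, pseries_on_disk (T a) (fun z => v z * theta z ^+ a).

Lemma inner_wcomp a k : inner (W (fun z => z ^+ (n + a))) (fun z => z ^+ k) =
  ((n + a) ^_ n)%:R * (if (n <= k)%N then T a (k - n)%N else 0) * (omega k)%:C.
Proof.
have H := pseriesZ ((n + a) ^_ n)%:R (pseries_mulXn n (HT a)).
have HW : pseries_on_disk (fun k => ((n + a) ^_ n)%:R * (if (n <= k)%N then T a (k - n)%N else 0))
    (W (fun z => z ^+ (n + a))).
  move: H; apply: eq_pseries => z z1.
  by rewrite wcomp_monom// uE// addKn; ring.
exact: (inner_monom hbeta k (bWf (bm _)) HW).
Qed.

Lemma sym_entry a b :
  inner (W (fun z => z ^+ (n + a))) (fun z => z ^+ (n + b)) =
  inner (fun z => z ^+ (n + a)) (W (fun z => z ^+ (n + b))) <->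
  (bcoef p a)%:C * T a b = (bcoef p b)%:C * (T b a)^*%C.
Proof.
rewrite (innerC hbeta (bWf (bm (n + b))) (bm (n + a))) !inner_wcomp.
rewrite !leq_addr !addKn !conjcM conjcR.
have natc k : (k%:R : C) = (k%:R : R)%:C by rewrite (rmorph_nat (real_complex R)).
rewrite !natc conjcR.
have on : (omega n)%:C != 0 by rewrite (inj_eq (@complexI R)) gt_eqF// omega_gt0.
have oE m : (omega n)%:C * (((n + m) ^_ n)%:R)%:C =
    (n`!%:R)%:C * (bcoef p m)%:C * (omega (n + m))%:C.
  by rewrite -!rmorphM omega_bcoef mulrC.
have k0 : (n`!%:R)%:C * (omega (n + a))%:C * (omega (n + b))%:C != 0.
  by rewrite !mulf_neq0// (inj_eq (@complexI R)) ?factR_neq0// gt_eqF// omega_gt0.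
split=> [E|E].
  apply: (mulfI k0); have := congr1 (fun x => (omega n)%:C * x) E.
  rewrite !mulrA !oE => E'.
  rewrite [LHS](_ : _ = (n`!%:R)%:C * (bcoef p a)%:C * (omega (n + a))%:C * T a b * (omega (n + b))%:C); last by ring.
  by rewrite E'; ring.
apply: (mulfI on); rewrite !mulrA !oE.
rewrite [LHS](_ : _ = (n`!%:R)%:C * (omega (n + a))%:C * (omega (n + b))%:C * ((bcoef p a)%:C * T a b)); last by ring.
by rewrite E; ring.
Qed.

Lemma sym_monoms : kernel_sym p T ->
  forall j k, inner (W (fun z => z ^+ j)) (fun z => z ^+ k) =
              inner (fun z => z ^+ j) (W (fun z => z ^+ k)).
Proof.
move=> S.
have small j k : (j < n)%N -> inner (W (fun z => z ^+ j)) (fun z => z ^+ k) =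
    inner (fun z => z ^+ j) (W (fun z => z ^+ k)).
  move=> jn; rewrite (inner0l (bm k) (wcomp_small jn)).
  rewrite (innerC hbeta (bWf (bm k)) (bm j)).
  have [nk|kn] := leqP n k.
    by rewrite -(subnKC nk) inner_wcomp leqNgt jn /= mulr0 mul0r /conjc/= oppr0.
  by rewrite (inner0l (bm j) (wcomp_small kn)) /conjc/= oppr0.
move=> j k; have [nj|jn] := leqP n j; last exact: small.
have [nk|kn] := leqP n k; first by rewrite -(subnKC nj) -(subnKC nk); apply/sym_entry/S.
have := small k j kn.
rewrite (innerC hbeta (bm j) (bWf (bm k))) (innerC hbeta (bWf (bm j)) (bm k)).
by move=> /(congr1 (@conjc R)); rewrite !conjcK.
Qed.

End Entries.

(** The operator kills the monomials of degree less than [n], so symmetry makes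
    the image of [z ^+ n], a multiple of [u], orthogonal to them. *)
Lemma symbol_factor : holomorphic_on_disk u ->
  (forall k, (k < n)%N -> inner (W (fun z => z ^+ n)) (fun z => z ^+ k) =
              inner (fun z => z ^+ n) (W (fun z => z ^+ k))) ->
  exists2 v, holomorphic_on_disk v & forall z, cabs z < 1 -> u z = z ^+ n * v z.
Proof.
move=> hu H; have [s Hs] := taylor hu.
have s0 k : (k < n)%N -> s k = 0.
  move=> kn; have := H k kn.
  rewrite (innerC hbeta (bWf (bm k)) (bm n)) (inner0l (bm n) (wcomp_small kn)).
  have Hn := pseriesZ (n`!%:R) Hs.
  have HW : pseries_on_disk (fun k => n`!%:R * s k) (W (fun z => z ^+ n)).
    move: Hn; apply: eq_pseries => z z1.
    by rewrite wcomp_monom// ffactnn subnn expr0 mulr1 mulrC.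
  rewrite (inner_monom hbeta k (bWf (bm n)) HW).
  have -> : (0 : C)^*%C = 0 by rewrite /conjc/= oppr0.
  move=> /eqP; rewrite !mulf_eq0 pnatr_eq0 -leqn0 leqNgt fact_gt0/=.
  by rewrite (inj_eq (@complexI R) (omega k) 0) (gt_eqF (omega_gt0 hbeta k)) orbF => /eqP.
have [v Hv uE] := pseries_divXn Hs s0.
by exists v; [exact: pseries_holo Hv|exact: uE].
Qed.

End CompositionDifferentiation.

Close Scope complex_scope.

Theorem theorem2 (R : realType) (beta : R) (hbeta : -1 < beta)
  (n : nat) (hn : (1 <= n)%N)
  (theta : R[i] -> R[i]) (htheta : holomorphic_self_map theta)
  (u : R[i] -> R[i]) (hu : holomorphic_on_disk u)
  (hu0 : exists2 z, unit_disk z & u z != 0)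
  (hW : bergman_bounded beta (wcomp_diff n u theta)) :
  bergman_self_adjoint beta (wcomp_diff n u theta) <->
  exists (c0 c2 : R) (c1 : R[i]), c0 != 0 /\
    forall z : R[i], unit_disk z ->
      u z = c0%:C%C * z ^+ n / cpow (1 - c1^*%C * z) (beta + n%:R + 2) /\
      theta z = c1 + c2%:C%C * z / (1 - c1^*%C * z).
Proof.
have [ht td] := htheta.
have td' z : cabs z < 1 -> cabs (theta z) < 1 by move=> /unit_diskE/td/unit_diskE.
set q := beta + n%:R + 2.
have q0 : 0 < q by rewrite /q addrAC ltr_wpDr//; lra.
have coefs v : holomorphic_on_disk v -> exists T : nat -> nat -> R[i],
    forall a, pseries_on_disk (T a) (fun z => v z * theta z ^+ a).
  move=> hv; have h a : exists s, pseries_on_disk s (fun z => v z * theta z ^+ a).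
    by apply: taylor; apply: holoM hv _; exact: holoX ht.
  by exists (fun a => projT1 (cid (h a))) => a; case: (cid _).
have in0 : cabs (0 : R[i]) < 1 by rewrite cabs0.
have scale (c z : R[i]) : cabs c < 1 -> cabs z < 1 -> cabs (c^*%C * z) < 1.
  move=> c1 z1; rewrite cabsM cabs_conj; apply: le_lt_trans z1.
  by rewrite ler_piMl ?cabs_ge0// ltW.
split.
  move=> [_ SA]; have bm := bergman_monom hbeta.
  have [v hv uE] := symbol_factor hbeta td' hW hu (fun k _ => SA _ _ (bm n) (bm k)).
  have [T HT] := coefs v hv.
  have S : kernel_sym q T.
    move=> a b; apply/(sym_entry hbeta td' hW uE HT); exact: SA.
  have v0 : exists2 z, cabs z < 1 & v z != 0.
    have [z /unit_diskE z1 uz] := hu0; exists z => //.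
    by apply: contraNneq uz => vz; rewrite uE// vz mulr0.
  have [c0 [c2 [c00 H]]] := form_of_sym q0 ht HT S v0 (td' _ in0).
  exists c0, c2, (theta 0); split => // z /unit_diskE z1.
  have [vz tz] := H z z1; split => //.
  by rewrite uE// vz binser_cpow ?scale ?td'// mulrCA mulrA.
move=> [c0 [c2 [c1 [_ H]]]].
have c1E : theta 0 = c1.
  have [_ ->] := H 0 ((unit_diskE 0).2 in0).
  by rewrite !mulr0 mul0r addr0.
have c1lt : cabs c1 < 1 by rewrite -c1E td'.
pose v z := c0%:C%C * binser q (c1^*%C * z).
have hv : holomorphic_on_disk v.
  apply: (pseries_holo (pseriesZ c0%:C%C (pseries_scale _ (pseries_binser q)))).
  by rewrite cabs_conj ltW.
have uE z : cabs z < 1 -> u z = z ^+ n * v z.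
  move=> z1; have [-> _] := H z ((unit_diskE z).2 z1).
  by rewrite /v binser_cpow ?scale// mulrCA mulrA.
have [T HT] := coefs v hv.
have S : kernel_sym q T.
  apply: (sym_of_form HT c1lt (c2 := c2)) => z z1; split => //.
  by have [_ ->] := H z ((unit_diskE z).2 z1).
split => // f g bf bg.
apply: (sym_of_monom hbeta hW) => //.
- exact: wcompD.
- exact: wcompZ.
- exact: (sym_monoms hbeta td' hW uE HT S).
Qed.
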